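(* Let $(M^{3},\varphi,\xi,\eta,g)$ be a $3$-dimensional almost contact metric manifold with $h\neq0$ at every point, and let $\kappa,\mu$ be smooth functions on $M$ such that $d\kappa\wedge\eta=0$ and $\mu\neq-2$ at every point. Then $M$ is an almost Kenmotsu generalized $(\kappa,\mu)'$-manifold if and only if for any point $p\in M$ there exists an open neighbourhood $U$ of $p$ with coordinates $x_{1},x_{2},t$ such that on $U$: $\mu$ only depends on $t$; $\kappa=-1-e^{-2f}$, where $f$ satisfies the equation $df=(\mu+2)dt$; the tensor fields of the structure can be written as $$\varphi=\sum_{i,j=1}^{2}\varphi^{i}_{j}\,dx_{j}\otimes\frac{\partial}{\partial x_{i}}, \quad \xi=\frac{\partial}{\partial t}, \quad \eta=dt, \quad g=dt\otimes dt+\sum_{i,j=1}^{2} g_{ij}\,dx_{i}\otimes dx_{j},$$ where $\varphi^{i}_{j},g_{ij}$ are functions only of $t$; the fundamental $2$-form is $\Phi=e^{2t}\, dx_1 \wedge dx_2$; and the non-zero components $h^{i}_{j}, B^{i}_{j}$ $(i,j\in\{1,2\})$ in $U$ of $h$ and $h'$, respectively, are functions of $t$ satisfying the condition $\sum_{s=1}^2 B^{i}_{s}B^{s}_{j}=e^{-2f}\delta_{j}^{i}$ and the system of differential equations $$\frac{d \varphi^{i}_{j}}{dt}=2h^{i}_{j}, \quad \frac{d B^{i}_{j}}{dt}=-(\mu+2) B^{i}_{j}, \quad \frac{d h^{i}_{j}}{dt}=2\lambda^2 \varphi^{i}_{j}-(\mu+2)h^{i}_{j},$$ where $\lambda=e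^{-f}$.
   Context: All manifolds are smooth and connected. An almost contact metric manifold $(M^{2n+1},\varphi,\xi,\eta,g)$ is a manifold with a $(1,1)$-tensor field $\varphi$, a vector field $\xi$, a $1$-form $\eta$ and a Riemannian metric $g$ such that $\varphi^2=-I+\eta\otimes\xi$, $\eta(\xi)=1$ and $g(\varphi X,\varphi Y)=g(X,Y)-\eta(X)\eta(Y)$. Its fundamental $2$-form is $\Phi(X,Y)=g(X,\varphi Y)$ (so $\Phi=e^{2t}dx_1\wedge dx_2$ means $\Phi(\partial/\partial x_1,\partial/\partial x_2)=e^{2t}$ and $\Phi(\partial/\partial t,\cdot)=0$). It is almost Kenmotsu if $d\eta=0$ and $d\Phi=2\eta\wedge\Phi$. Put $h:=\frac12\mathcal{L}_{\xi}\varphi$ ($\mathcal L$ the Lie derivative) and $h':=h\circ\varphi$. Components of a $(1,1)$-tensor field $T$ are given by $T(\partial/\partial x_j)=\sum_i T^i_j\,\partial/\partial x_i$ (all components of $h$ and $h'$ involving the $t$-direction vanish). With $R(X,Y)=[\nabla_X,\nabla_Y]-\nabla_{[X,Y]}$ ($\nabla$ the Levi-Civita connection of $g$), an almost Kenmotsu manifold is called a generalized $(\kappa,\mu)'$-manifold, for smooth functions $\kappa,\mu$ on $M$, if for all vector fields $X,Y$: $R(X,Y)\xi=\kappa(\eta(Y)X-\eta(X)Y)+\mu(\eta(Y)h'X-\eta(X)h'Y)$. *)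

(* Defs.v *)
From HB Require Import structures.
From mathcomp Require Import all_boot all_order all_algebra.
From mathcomp Require Import all_classical all_reals all_analysis.
From mathcomp Require Import ring.

Set Implicit Arguments.
Unset Strict Implicit.
Unset Printing Implicit Defensive.

Import Order.TTheory GRing.Theory Num.Theory.
Import numFieldNormedType.Exports.

Local Open Scope classical_set_scope.
Local Open Scope ring_scope.

(** * Smooth functions on open subsets of R^n *)

(* Iterated partial derivatives up to order k exist and are continuous on A
   (A is meant to be open). *)
Fixpoint Ck_on (R : realType) (n k : nat) (A : set 'rV[R]_n)
    (f : 'rV[R]_n -> R) : Prop :=
  (forall x, A x -> {for x, continuous f}) /\
  (if k is k'.+1 then
     forall i : 'I_n,
       (forall x, A x -> derivable (f : 'rV[R]_n -> R^o) x (delta_mx 0 i)) /\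
       Ck_on k' A (fun x => 'D_(delta_mx 0 i) (f : 'rV[R]_n -> R^o) x)
   else True).

Definition smooth_on (R : realType) (n : nat) (A : set 'rV[R]_n)
    (f : 'rV[R]_n -> R) : Prop := forall k, Ck_on k A f.

(** * Smooth manifolds *)

(* chart_map and chart_inv are total functions; only their restrictions to
   chart_dom and chart_cod matter. *)
Record chart (R : realType) (n : nat) (M : topologicalType) := Chart {
  chart_dom : set M;
  chart_cod : set 'rV[R]_n;
  chart_map : M -> 'rV[R]_n;
  chart_inv : 'rV[R]_n -> M;
  chart_dom_open : open chart_dom;
  chart_cod_open : open chart_cod;
  chart_map_cod : forall p, chart_dom p -> chart_cod (chart_map p);
  chart_inv_dom : forall x, chart_cod x -> chart_dom (chart_inv x);
  chart_mapK : forall p, chart_dom p -> chart_inv (chart_map p) = p;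
  chart_invK : forall x, chart_cod x -> chart_map (chart_inv x) = x;
  chart_map_cont : {within chart_dom, continuous chart_map};
  chart_inv_cont : {within chart_cod, continuous chart_inv}
}.

Definition smooth_transition (R : realType) (n : nat) (M : topologicalType)
    (c d : chart R n M) : Prop :=
  forall i : 'I_n,
    smooth_on [set x | chart_cod c x /\ chart_dom d (chart_inv c x)]
              (fun x => chart_map d (chart_inv c x) 0 i).

Definition compatible (R : realType) (n : nat) (M : topologicalType)
    (c d : chart R n M) : Prop :=
  smooth_transition c d /\ smooth_transition d c.

(* The atlas is maximal, so its elements are all the local coordinate systems
   of the smooth structure. *)
Record manifold (R : realType) (n : nat) := Manifold {
  carrier :> topologicalType;
  manifold_hausdorff : hausdorff_space carrier;
  manifold_second_countable : @second_countable carrier;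
  manifold_connected : connected [set: carrier];
  atlas : set (chart R n carrier);
  atlas_cover : forall p : carrier, exists2 c, atlas c & chart_dom c p;
  atlas_compatible : forall c d, atlas c -> atlas d -> compatible c d;
  atlas_maximal : forall c, (forall d, atlas d -> compatible c d) -> atlas c
}.

Definition mchart (R : realType) (n : nat) (M : manifold R n) :=
  chart R n (carrier M).

Definition smooth_in (R : realType) (n : nat) (M : manifold R n)
    (c : mchart M) (F : M -> R) : Prop :=
  smooth_on (chart_cod c) (fun x => F (chart_inv c x)).

Definition smooth_fun (R : realType) (n : nat) (M : manifold R n)
    (F : M -> R) : Prop :=
  forall c : mchart M, atlas c -> smooth_in c F.

(* The partial derivative of F with respect to the i-th coordinate of c, at p *)
Definition pder (R : realType) (n : nat) (M : manifold R n) (c : mchart M)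
    (i : 'I_n) (F : M -> R) (p : M) : R :=
  'D_(delta_mx 0 i) ((fun x => F (chart_inv c x)) : 'rV[R]_n -> R^o)
    (chart_map c p).

(* jac c d p i j = dy_i/dx_j at p, with x, y the coordinates of c, d. *)
Definition jac (R : realType) (n : nat) (M : manifold R n) (c d : mchart M)
    (p : M) : 'M[R]_n :=
  \matrix_(i, j) pder c j (fun q => chart_map d q 0 i) p.

(** * Tensor fields *)

(* A tensor field is given by its components in all charts of the atlas,
   subject to the transformation law; the component functions are functions of
   the point p of M, and their values outside the domain of the chart are
   irrelevant.
   Vector fields are columns (X^i), 1-forms are rows (a_j), (1,1)-tensors are
   matrices (T^i_j) with T(d/dx_j) = sum_i T^i_j d/dx_i, and covariant
   2-tensors are matrices (g_ij) with g_ij = g(d/dx_i, d/dx_j). *)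

Record vfield (R : realType) (n : nat) (M : manifold R n) := VField {
  vcomp :> mchart M -> M -> 'cV[R]_n;
  vfield_smooth : forall c, atlas c ->
    forall i, smooth_in c (fun p => vcomp c p i 0);
  vfield_law : forall c d, atlas c -> atlas d ->
    forall p, chart_dom c p -> chart_dom d p ->
      vcomp d p = jac c d p *m vcomp c p
}.

Record form1 (R : realType) (n : nat) (M : manifold R n) := Form1 {
  fcomp :> mchart M -> M -> 'rV[R]_n;
  form1_smooth : forall c, atlas c ->
    forall j, smooth_in c (fun p => fcomp c p 0 j);
  form1_law : forall c d, atlas c -> atlas d ->
    forall p, chart_dom c p -> chart_dom d p ->
      fcomp c p = fcomp d p *m jac c d p
}.

Record endo (R : realType) (n : nat) (M : manifold R n) := Endo {
  ecomp :> mchart M -> M -> 'M[R]_n;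
  endo_smooth : forall c, atlas c ->
    forall i j, smooth_in c (fun p => ecomp c p i j);
  endo_law : forall c d, atlas c -> atlas d ->
    forall p, chart_dom c p -> chart_dom d p ->
      ecomp d p *m jac c d p = jac c d p *m ecomp c p
}.

Definition ev1 (R : realType) (n : nat) (a : 'rV[R]_n) (v : 'cV[R]_n) : R :=
  (a *m v) 0 0.

Definition ev2 (R : realType) (n : nat) (b : 'M[R]_n) (v w : 'cV[R]_n) : R :=
  (v^T *m b *m w) 0 0.

Record metric (R : realType) (n : nat) (M : manifold R n) := Metric {
  gcomp :> mchart M -> M -> 'M[R]_n;
  metric_smooth : forall c, atlas c ->
    forall i j, smooth_in c (fun p => gcomp c p i j);
  metric_law : forall c d, atlas c -> atlas d ->
    forall p, chart_dom c p -> chart_dom d p ->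
      gcomp c p = (jac c d p)^T *m gcomp d p *m jac c d p;
  metric_sym : forall c, atlas c -> forall p, chart_dom c p ->
    (gcomp c p)^T = gcomp c p;
  metric_pos : forall c, atlas c -> forall p, chart_dom c p ->
    forall v : 'cV[R]_n, v != 0 -> 0 < ev2 (gcomp c p) v v
}.

(** * Calculus in a chart *)

(* Below, X Y Z : M -> 'cV_n are components, in the chart c, of vector fields
   on the domain of c; similarly for the other kinds of tensors. *)

Definition bracket (R : realType) (n : nat) (M : manifold R n) (c : mchart M)
    (X Y : M -> 'cV[R]_n) (p : M) : 'cV[R]_n :=
  \col_k \sum_(i < n) (X p i 0 * pder c i (fun q => Y q k 0) p
                     - Y p i 0 * pder c i (fun q => X q k 0) p).

(* (L_X T)(d/dx_j) = [X, T(d/dx_j)] - T [X, d/dx_j] *)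
Definition lie_endo (R : realType) (n : nat) (M : manifold R n) (c : mchart M)
    (X : M -> 'cV[R]_n) (T : M -> 'M[R]_n) (p : M) : 'M[R]_n :=
  \matrix_(i, j) (bracket c X (fun q => col j (T q)) p
                - T p *m bracket c X (fun=> delta_mx j 0) p) i 0.

Definition christoffel (R : realType) (n : nat) (M : manifold R n)
    (c : mchart M) (g : M -> 'M[R]_n) (p : M) (k i j : 'I_n) : R :=
  2^-1 * \sum_(l < n) invmx (g p) k l *
    (pder c i (fun q => g q j l) p + pder c j (fun q => g q i l) p
     - pder c l (fun q => g q i j) p).

(* The Levi-Civita connection of g *)
Definition nabla (R : realType) (n : nat) (M : manifold R n) (c : mchart M)
    (g : M -> 'M[R]_n) (X Y : M -> 'cV[R]_n) (p : M) : 'cV[R]_n :=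
  \col_k (\sum_(i < n) X p i 0 * pder c i (fun q => Y q k 0) p
        + \sum_(i < n) \sum_(j < n) christoffel c g p k i j
                                    * X p i 0 * Y p j 0).

Lemma pder_eq (R : realType) (n : nat) (M : manifold R n) (c : mchart M)
    (i : 'I_n) (F G : M -> R) (p : M) :
  chart_dom c p -> (forall q, chart_dom c q -> F q = G q) ->
  pder c i F p = pder c i G p.
Proof.
move=> cp FG; apply: near_eq_derive.
have := open_nbhs_nbhs (conj (@chart_cod_open _ _ _ c) (chart_map_cod cp)).
by apply: filterS => x cx; apply: FG; exact: chart_inv_dom.
Qed.

Lemma metric_symE (R : realType) (n : nat) (M : manifold R n)
    (g : metric M) (c : mchart M) (p : M) (i j : 'I_n) :
  atlas c -> chart_dom c p -> g c p i j = g c p j i.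
Proof. by move=> ac cp; rewrite -[in LHS](metric_sym g ac cp) mxE. Qed.

Lemma metric_unit (R : realType) (n : nat) (M : manifold R n)
    (g : metric M) (c : mchart M) (p : M) :
  atlas c -> chart_dom c p -> g c p \in unitmx.
Proof.
move=> ac cp; rewrite -row_free_unit -kermx_eq0; apply/negPn/negP => k0.
have /rowV0Pn[v /sub_kermxP vg v0] := k0.
have := @metric_pos _ _ _ g c ac p cp v^T.
by rewrite trmx_eq0 v0 /ev2 trmxK vg mul0mx mxE ltxx => /(_ isT).
Qed.

(* The next lemma and christoffel_metric are the two properties that
   characterize the Levi-Civita connection: no torsion, and nabla g = 0. *)
Lemma christoffel_torsion_free (R : realType) (n : nat) (M : manifold R n)
    (g : metric M) (c : mchart M) (p : M) (k i j : 'I_n) :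
  atlas c -> chart_dom c p ->
  christoffel c (g c) p k i j = christoffel c (g c) p k j i.
Proof.
move=> ac cp; congr (_ * _); apply: eq_bigr => l _; congr (_ * _).
rewrite [X in _ - X](@pder_eq _ _ _ c l _ (fun q => g c q j i)) //; last first.
  by move=> q cq; exact: metric_symE.
by rewrite [X in X - _]addrC.
Qed.

Lemma christoffel_lower (R : realType) (n : nat) (M : manifold R n)
    (g : metric M) (c : mchart M) (p : M) (i j m : 'I_n) :
  atlas c -> chart_dom c p ->
  \sum_(k < n) christoffel c (g c) p k i j * g c p k m =
  2^-1 * (pder c i (fun q => g c q j m) p + pder c j (fun q => g c q i m) p
          - pder c m (fun q => g c q i j) p).
Proof.
move=> ac cp; pose b : 'rV[R]_n := \row_l
  (pder c i (fun q => g c q j l) p + pder c j (fun q => g c q i l) p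
   - pder c l (fun q => g c q i j) p).
transitivity (2^-1 * (b *m invmx (g c p) *m g c p) 0 m); last first.
  by rewrite mulmxKV ?metric_unit// mxE.
rewrite mxE mulr_sumr; apply: eq_bigr => k _; rewrite mulrA; congr (_ * _ * _).
rewrite mxE; apply: eq_bigr => l _; rewrite mxE mulrC; congr (_ * _).
have gV : (invmx (g c p))^T = invmx (g c p).
  by rewrite trmx_inv (metric_sym g ac cp).
by rewrite -[in LHS]gV mxE.
Qed.

Lemma christoffel_metric (R : realType) (n : nat) (M : manifold R n)
    (g : metric M) (c : mchart M) (p : M) (k i j : 'I_n) :
  atlas c -> chart_dom c p ->
  pder c k (fun q => g c q i j) p =
    \sum_(l < n) (christoffel c (g c) p l k i * g c p l j
                + christoffel c (g c) p l k j * g c p i l).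
Proof.
move=> ac cp; rewrite big_split /= christoffel_lower//.
rewrite [X in _ + X](eq_bigr (fun l =>
    christoffel c (g c) p l k j * g c p l i)); last first.
  by move=> l _; rewrite (metric_symE g i l ac cp).
rewrite christoffel_lower// -mulrDr.
have sw a : forall b d, pder c a (fun q => g c q b d) p
                     = pder c a (fun q => g c q d b) p.
  by move=> b d; apply: pder_eq => // q cq; exact: metric_symE.
rewrite (sw k j i) (sw i k j) (sw j k i); by field.
Qed.

(* R(X,Y)Z = nabla_X nabla_Y Z - nabla_Y nabla_X Z - nabla_[X,Y] Z *)
Definition curvature (R : realType) (n : nat) (M : manifold R n) (c : mchart M)
    (g : M -> 'M[R]_n) (X Y Z : M -> 'cV[R]_n) (p : M) : 'cV[R]_n :=
  nabla c g X (nabla c g Y Z) p - nabla c g Y (nabla c g X Z) p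
  - nabla c g (bracket c X Y) Z p.

(* Components of exterior derivatives and wedge products, normalized so that
   (dx_1 /\ dx_2)(d/dx_1, d/dx_2) = 1. *)

Definition grad (R : realType) (n : nat) (M : manifold R n) (c : mchart M)
    (F : M -> R) (p : M) : 'rV[R]_n :=
  \row_i pder c i F p.

Definition ext_d1 (R : realType) (n : nat) (M : manifold R n) (c : mchart M)
    (a : M -> 'rV[R]_n) (p : M) (i j : 'I_n) : R :=
  pder c i (fun q => a q 0 j) p - pder c j (fun q => a q 0 i) p.

Definition ext_d2 (R : realType) (n : nat) (M : manifold R n) (c : mchart M)
    (w : M -> 'M[R]_n) (p : M) (i j k : 'I_n) : R :=
  pder c i (fun q => w q j k) p + pder c j (fun q => w q k i) p
  + pder c k (fun q => w q i j) p.

Definition wedge11 (R : realType) (n : nat) (a b : 'rV[R]_n) : 'M[R]_n :=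
  \matrix_(i, j) (a 0 i * b 0 j - a 0 j * b 0 i).

Definition wedge12 (R : realType) (n : nat) (a : 'rV[R]_n) (w : 'M[R]_n)
    (i j k : 'I_n) : R :=
  a 0 i * w j k + a 0 j * w k i + a 0 k * w i j.

(** * Almost contact metric structures *)

Record acm (R : realType) (n : nat) (M : manifold R n) := ACM {
  phi : endo M;
  xi : vfield M;
  eta : form1 M;
  met : metric M;
  acm_phi2 : forall c, atlas c -> forall p, chart_dom c p ->
    phi c p *m phi c p = - 1%:M + xi c p *m eta c p;
  acm_eta_xi : forall c, atlas c -> forall p, chart_dom c p ->
    ev1 (eta c p) (xi c p) = 1;
  acm_met : forall c, atlas c -> forall p, chart_dom c p ->
    forall v w : 'cV[R]_n,
      ev2 (met c p) (phi c p *m v) (phi c p *m w) =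
      ev2 (met c p) v w - ev1 (eta c p) v * ev1 (eta c p) w
}.

(* Phi_ij = g(d/dx_i, phi(d/dx_j)) *)
Definition fundamental_form (R : realType) (n : nat) (M : manifold R n)
    (S : acm M) (c : mchart M) (p : M) : 'M[R]_n :=
  \matrix_(i, j) ev2 (met S c p) (delta_mx i 0) (phi S c p *m delta_mx j 0).

Definition h_tensor (R : realType) (n : nat) (M : manifold R n) (S : acm M)
    (c : mchart M) (p : M) : 'M[R]_n :=
  2^-1 *: lie_endo c (xi S c) (phi S c) p.

Definition h'_tensor (R : realType) (n : nat) (M : manifold R n) (S : acm M)
    (c : mchart M) (p : M) : 'M[R]_n :=
  h_tensor S c p *m phi S c p.

Definition almost_kenmotsu (R : realType) (n : nat) (M : manifold R n)
    (S : acm M) : Prop :=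
  forall c : mchart M, atlas c -> forall p, chart_dom c p ->
    (forall i j, ext_d1 c (eta S c) p i j = 0) /\
    (forall i j k, ext_d2 c (fundamental_form S c) p i j k =
       2 * wedge12 (eta S c p) (fundamental_form S c p) i j k).

Definition generalized_kappa_mu' (R : realType) (n : nat) (M : manifold R n)
    (S : acm M) (kappa mu : M -> R) : Prop :=
  forall (X Y : vfield M) (c : mchart M), atlas c ->
  forall p, chart_dom c p ->
    curvature c (met S c) (X c) (Y c) (xi S c) p =
      kappa p *: (ev1 (eta S c p) (Y c p) *: X c p
                  - ev1 (eta S c p) (X c p) *: Y c p)
    + mu p *: (ev1 (eta S c p) (Y c p) *: (h'_tensor S c p *m X c p)
               - ev1 (eta S c p) (X c p) *: (h'_tensor S c p *m Y c p)).

(** * Adapted coordinates in dimension 3 *)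

(* The coordinates (x_1, x_2, t) have indices 0, 1, 2 : 'I_3. *)
Definition ix1 : 'I_3 := @Ordinal 3 0 isT.
Definition ix2 : 'I_3 := @Ordinal 3 1 isT.
Definition it : 'I_3 := @Ordinal 3 2 isT.

Definition tcoord (R : realType) (M : manifold R 3) (c : mchart M) (p : M) : R :=
  chart_map c p 0 it.

(* The 3 x 3 matrix with (x_1, x_2)-block A, (t, t)-entry a, and 0 elsewhere *)
Definition blk (R : realType) (A : 'M[R]_2) (a : R) : 'M[R]_3 :=
  block_mx A 0 0 (a%:M : 'M[R]_1) : 'M[R]_(2 + 1).

(* The derivatives with respect to t are those of the one-variable functions
   ph, B, h through which the components factor; t ranges over an open set, so
   they are determined by the components. *)
Definition adapted_coordinates (R : realType) (M : manifold R 3) (S : acm M)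
    (kappa mu : M -> R) (c : mchart M) : Prop :=
  exists (m : R -> R) (f : M -> R) (ph gg h B : R -> 'M[R]_2),
  [/\ smooth_in c f,
      forall p, chart_dom c p ->
        [/\ mu p = m (tcoord c p),
            grad c f p = (mu p + 2) *: delta_mx 0 it
          & kappa p = - 1 - expR (- (2 * f p))],
      forall p, chart_dom c p ->
        [/\ phi S c p = blk (ph (tcoord c p)) 0,
            xi S c p = delta_mx it 0,
            eta S c p = delta_mx 0 it
          & met S c p = blk (gg (tcoord c p)) 1],
      forall p, chart_dom c p ->
        [/\ fundamental_form S c p =
              expR (2 * tcoord c p)
                *: wedge11 (delta_mx 0 ix1) (delta_mx 0 ix2),
            h_tensor S c p = blk (h (tcoord c p)) 0
          & h'_tensor S c p = blk (B (tcoord c p)) 0]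
    & forall p, chart_dom c p -> forall i j : 'I_2,
        let t := tcoord c p in
        let lambda := expR (- f p) in
        [/\ \sum_(s < 2) B t i s * B t s j
              = expR (- (2 * f p)) * (i == j)%:R,
            is_derive t (1 : R) (fun s => ph s i j : R^o) (2 * h t i j),
            is_derive t (1 : R) (fun s => B s i j : R^o)
              (- (mu p + 2) * B t i j)
          & is_derive t (1 : R) (fun s => h s i j : R^o)
              (2 * lambda ^+ 2 * ph t i j - (mu p + 2) * h t i j)]].

(* Main.v *)
From HB Require Import structures.
From mathcomp Require Import all_boot all_order all_algebra.
From mathcomp Require Import all_classical all_reals all_analysis.
From mathcomp Require Import ring lra.
Require Import Defs.

(** In an orthonormal frame $(e_1,e_2=\varphi e_1,\xi)$ the equations $d\eta=0$ and
$d\Phi=2\eta\wedge\Phi$ say that $\nabla\xi=1-\xi\eta+h'$, where $h'$ is symmetric and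
trace free on $\xi^\perp$. The trace of the curvature condition on $R(X,\xi)\xi$
gives $h'^2=-(1+\kappa)$ there ([kappa_pq], [h'_at]), so that $h'$ has the
eigenvalues $\pm\lambda$ with $\lambda=\sqrt{-1-\kappa}$, which is positive since
$h\neq0$. Let $e_1$ be a unit eigenvector for $\lambda$ ([eigenfield],
[eigenframe_exists]). As $d\kappa\wedge\eta=0$, the function $\lambda$ is constant
along $e_1$ and $e_2$; the rest of the curvature condition then yields
$\xi(\lambda)=-(\mu+2)\lambda$ and
$$[e_1,e_2]=0,\quad [e_1,\xi]=(1+\lambda)e_1,\quad [e_2,\xi]=(1-\lambda)e_2$$
([eigenframe_brackets]). The forms $\eta$ and $(1+\lambda)\eta$ are closed, hence
locally $dt$ and $du$, and the rescaled fields $e^{2t-u}e_2$, $e^ue_1$, $\xi$ commute: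
their dual coframe is closed ([coframe_closed]). The Poincare lemma and the inverse
function theorem turn it into coordinates $x_1,x_2,t$ ([coframe_chart]). There every
component is an expression in $t$, $u$ and $\lambda$, which are functions of $t$ alone
once the coordinates range over a box ([box_one_variable]); with $f=-\ln\lambda$ the
required equations follow from $u'=1+\lambda$ and $\lambda'=-(\mu+2)\lambda$
([adapted_of_kmu]).

Conversely, let $g=dt^2+\sum g_{ij}(t)dx_idx_j$ be as in the theorem. Differentiating
$g\varphi=e^{2t}J$, with $J$ constant, gives $\partial_tg=2gA$ for $A=1-\xi\eta+h'$, the
second fundamental form of the slices. This determines the Levi-Civita connection
([levi_unique]), with $\nabla\xi=A$, and $R(X,Y)\xi$ is computed from
$A^2=(1+\lambda^2)(1-\xi\eta)+2h'$ and $\partial_tA=-(\mu+2)h'$ ([adapted_curv]). The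
conditions have to hold in all charts, so the computation is made in an arbitrary
chart, with the coordinate fields of the adapted one as a commuting frame
([converse_ring]).

The computations take place in a commutative ring with commuting derivations
([dsys]), which is then instantiated by the smooth functions on an open subset of a
chart ([smo], [represents]). *)

Set Implicit Arguments.
Unset Strict Implicit.
Unset Printing Implicit Defensive.

Import Order.TTheory GRing.Theory Num.Theory.
Import numFieldNormedType.Exports.

Local Open Scope classical_set_scope.
Local Open Scope ring_scope.

(** * Smooth functions on open sets *)

(** Locked, because unification would otherwise try to compare the limits that
define two different derivatives. *)
HB.lock Definition pd (R : realType) (n : nat) (i : 'I_n) (f : 'rV[R]_n -> R)
    (x : 'rV[R]_n) : R :=
  'D_(delta_mx 0 i) (f : 'rV[R]_n -> R^o) x.

Section SmoothCalculus.
Variable R : realType.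

Lemma pdE (n : nat) (i : 'I_n) (f : 'rV[R]_n -> R) x :
  pd i f x = 'D_(delta_mx 0 i) (f : 'rV[R]_n -> R^o) x.
Proof. by rewrite pd.unlock. Qed.

(** Directional derivatives are derivatives of functions of one variable; the
mean value theorem and the one-variable chain rule are applied through this. *)
Lemma is_derive_line (V W : normedModType R) (f : V -> W) (x v : V) (s0 : R)
    (df : W) :
  is_derive s0 1 (fun s : R => f (s *: v + x)) df <-> is_derive (s0 *: v + x) v f df.
Proof.
have E : (fun h : R => h^-1 *: (f (h *: v + (s0 *: v + x)) - f (s0 *: v + x))) =
         (fun h : R => h^-1 *: (f ((h *: 1 + s0) *: v + x) - f (s0 *: v + x))).
  by apply/funext => h; rewrite addrA -scalerDl [h *: 1]mulr1.
split=> -[d e]; apply: DeriveDef.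
- by rewrite /derivable E.
- by rewrite -e /derive E.
- by move: d; rewrite /derivable E.
- by rewrite -e /derive E.
Qed.

Lemma is_derive_translate (V W : normedModType R) (f : V -> W) (x v w : V) (df : W) :
  is_derive (w + x) v f df -> is_derive x v (fun y => f (w + y)) df.
Proof.
have E : (fun h : R => h^-1 *: (f (w + (h *: v + x)) - f (w + x))) =
         (fun h : R => h^-1 *: (f (h *: v + (w + x)) - f (w + x))).
  by apply/funext => h; rewrite addrCA.
by move=> [d e]; apply: DeriveDef; [rewrite /derivable E|rewrite -e /derive E].
Qed.

Section Closure.
Variable n : nat.
Implicit Types (A B : set 'rV[R]_n) (f g : 'rV[R]_n -> R) (i : 'I_n).

Lemma open_near A x : open A -> A x -> \forall y \near x, A y.
Proof. by move=> oA Ax; exact: open_nbhs_nbhs. Qed.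

Lemma Ck_onSP k A f : Ck_on k.+1 A f <->
  (forall x, A x -> {for x, continuous f}) /\
  forall i, (forall x, A x -> derivable (f : 'rV[R]_n -> R^o) x (delta_mx 0 i)) /\
            Ck_on k A (pd i f).
Proof. by rewrite pd.unlock. Qed.

Lemma Ck_on_cont k A f : Ck_on k A f -> forall x, A x -> {for x, continuous f}.
Proof. by case: k => [|k] []. Qed.

Lemma Ck_onW k A f : Ck_on k.+1 A f -> Ck_on k A f.
Proof.
elim: k f => [|k IH] f /Ck_onSP[cf df]; first by split.
by apply/Ck_onSP; split=> // i; have [d1 d2] := df i; split=> //; exact: IH.
Qed.

Lemma Ck_on_sub k A B f : B `<=` A -> Ck_on k A f -> Ck_on k B f.
Proof.
move=> BA; elim: k f => [|k IH] f; first by move=> [cf _]; split=> // x /BA /cf.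
move=> /Ck_onSP[cf df]; apply/Ck_onSP; split=> [x /BA /cf//|i].
by have [d1 d2] := df i; split=> [x /BA /d1//|]; exact: IH.
Qed.

Lemma pd_eq A i f g : open A -> (forall x, A x -> f x = g x) ->
  forall x, A x -> pd i f x = pd i g x.
Proof.
move=> oA fg x Ax; rewrite !pdE; apply: near_eq_derive.
by move: (open_near oA Ax); apply: filterS => y /fg.
Qed.

Lemma cont_eq A f g : open A -> (forall x, A x -> f x = g x) ->
  forall x, A x -> {for x, continuous f} -> {for x, continuous g}.
Proof.
move=> oA fg x Ax cf; rewrite /prop_for /continuous_at -(fg x Ax).
have H : \near x, f x = g x by move: (open_near oA Ax); apply: filterS => y /fg.
by apply: (cvg_trans _ cf); exact: (@near_eq_cvg _ _ (nbhs x) _ _ _ H).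
Qed.

Lemma derivable_eq A f g v : open A -> (forall x, A x -> f x = g x) ->
  forall x, A x -> derivable (f : 'rV[R]_n -> R^o) x v ->
  derivable (g : 'rV[R]_n -> R^o) x v.
Proof.
move=> oA fg x Ax; apply: near_eq_derivable.
by move: (open_near oA Ax); apply: filterS => y /fg.
Qed.

Lemma Ck_on_eq k A f g : open A -> (forall x, A x -> f x = g x) ->
  Ck_on k A f -> Ck_on k A g.
Proof.
move=> oA; elim: k f g => [|k IH] f g fg.
  by move=> [cf _]; split=> // x Ax; apply: (cont_eq oA fg) => //; exact: cf.
move=> /Ck_onSP[cf df]; apply/Ck_onSP; split=> [x Ax|i].
  by apply: (cont_eq oA fg) => //; exact: cf.
have [d1 d2] := df i; split=> [x Ax|].
  by apply: (derivable_eq oA fg) => //; exact: d1.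
by apply: IH d2 => x Ax; exact: (pd_eq _ oA fg).
Qed.

Lemma Ck_on_local k A f :
  (forall x, A x -> exists B, B x /\ Ck_on k B f) -> Ck_on k A f.
Proof.
elim: k f => [|k IH] f loc.
  by split=> // x /loc[B [Bx [cf _]]]; exact: cf.
apply/Ck_onSP; split=> [x /loc[B [Bx /Ck_onSP[cf _]]]|i]; first exact: cf.
split=> [x /loc[B [Bx /Ck_onSP[_ /(_ i)[df _]]]]|]; first exact: df.
by apply: IH => x /loc[B [Bx /Ck_onSP[_ /(_ i)[_ df]]]]; exists B.
Qed.

Lemma Ck_on_intro k A f (df : 'I_n -> 'rV[R]_n -> R) : open A ->
  (forall x, A x -> {for x, continuous f}) ->
  (forall i x, A x -> is_derive x (delta_mx 0 i) (f : 'rV[R]_n -> R^o) (df i x)) ->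
  (forall i, Ck_on k A (df i)) -> Ck_on k.+1 A f.
Proof.
move=> oA cf dfE dfk; apply/Ck_onSP; split=> // i; split=> [x /(dfE i)[]//|].
by apply: Ck_on_eq (dfk i) => // x /(dfE i)[_ <-]; rewrite pdE.
Qed.

Lemma Ck_on_is_derive k A f i x : Ck_on k.+1 A f -> A x ->
  is_derive x (delta_mx 0 i) (f : 'rV[R]_n -> R^o) (pd i f x).
Proof. by rewrite pdE => /Ck_onSP[_ /(_ i)[df _]] /df; exact: derivableP. Qed.

Lemma Ck_on_pd k A f i : Ck_on k.+1 A f -> Ck_on k A (pd i f).
Proof. by move=> /Ck_onSP[_ /(_ i)[]]. Qed.

Lemma Ck_on_cst k A (a : R) : open A -> Ck_on k A (fun=> a).
Proof.
move=> oA; elim: k a => [|k IH] a.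
  by split=> // x _; exact: cst_continuous.
apply: (@Ck_on_intro _ _ _ (fun _ _ => 0)) => //.
by move=> x _; exact: cst_continuous.
Qed.

Lemma is_derive_coord i j (x : 'rV[R]_n) :
  is_derive x (delta_mx 0 i) (fun y : 'rV[R]_n => y 0 j : R^o) (j == i)%:R.
Proof.
have /diff_derivable d : differentiable (fun y : 'rV[R]_n => y 0 j : R^o) x.
  exact: differentiable_coord.
apply: DeriveDef; first exact: d.
rewrite deriveE; last exact: differentiable_coord.
have lin : linear (fun N : 'rV[R]_n => N 0 j : R^o) by move=> ? ? ?; rewrite !mxE.
pose HL := GRing.isLinear.Build _ _ _ _ _ lin.
pose l : {linear 'rV[R]_n -> R^o} := HB.pack (fun N : 'rV[R]_n => N 0 j : R^o) HL.
rewrite (_ : (fun y : 'rV[R]_n => _) = l :> ('rV[R]_n -> R^o))// diff_lin/=.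
  by rewrite mxE eqxx.
exact: coord_continuous.
Qed.

Lemma Ck_on_coord k A j : open A -> Ck_on k A (fun x => x 0 j).
Proof.
move=> oA; case: k => [|k].
  by split=> // x _; exact: coord_continuous.
apply: (@Ck_on_intro _ _ _ (fun i _ => (j == i)%:R)) => //.
- by move=> x _; exact: coord_continuous.
- by move=> i x _; exact: is_derive_coord.
- by move=> i; exact: Ck_on_cst.
Qed.

Lemma Ck_onD k A f g : open A -> Ck_on k A f -> Ck_on k A g ->
  Ck_on k A (fun x => f x + g x).
Proof.
move=> oA; elim: k f g => [|k IH] f g.
  by move=> [cf _] [cg _]; split=> // x Ax; exact: (cvgD (cf _ Ax) (cg _ Ax)).
move=> fk gk; apply: (@Ck_on_intro _ _ _ (fun i x => pd i f x + pd i g x)) => //.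
- move=> x Ax; exact: (cvgD (Ck_on_cont fk Ax) (Ck_on_cont gk Ax)).
- move=> i x Ax; have := Ck_on_is_derive i fk Ax; have := Ck_on_is_derive i gk Ax.
  by move=> dg df; exact: is_deriveD.
- by move=> i; apply: IH; exact: Ck_on_pd.
Qed.

Lemma Ck_onM k A f g : open A -> Ck_on k A f -> Ck_on k A g ->
  Ck_on k A (fun x => f x * g x).
Proof.
move=> oA; elim: k f g => [|k IH] f g.
  by move=> [cf _] [cg _]; split=> // x Ax; exact: (cvgM (cf _ Ax) (cg _ Ax)).
move=> fk gk; apply: (@Ck_on_intro _ _ _
  (fun i x => f x * pd i g x + g x * pd i f x)) => //.
- move=> x Ax; exact: (cvgM (Ck_on_cont fk Ax) (Ck_on_cont gk Ax)).
- move=> i x Ax; have := Ck_on_is_derive i fk Ax; have := Ck_on_is_derive i gk Ax.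
  by move=> dg df; exact: is_deriveM.
- move=> i; apply: Ck_onD => //; apply: IH; do ?exact: Ck_on_pd.
  all: exact: Ck_onW.
Qed.

Lemma Ck_onN k A f : open A -> Ck_on k A f -> Ck_on k A (fun x => - f x).
Proof.
move=> oA fk; apply: (@Ck_on_eq _ _ (fun x => -1 * f x)) => //.
  by move=> x _; rewrite mulN1r.
by apply: Ck_onM => //; exact: Ck_on_cst.
Qed.

Lemma Ck_on_sum k A (I : Type) (r : seq I) (P : pred I) (F : I -> 'rV[R]_n -> R) :
  open A -> (forall a, Ck_on k A (F a)) ->
  Ck_on k A (fun x => \sum_(a <- r | P a) F a x).
Proof.
move=> oA Fk; elim: r => [|a r IH].
  apply: (@Ck_on_eq _ _ (fun=> 0)) => //; last exact: Ck_on_cst.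
  by move=> x _; rewrite big_nil.
apply: (@Ck_on_eq _ _ (fun x => (if P a then F a x else 0) +
                               \sum_(b <- r | P b) F b x)) => //.
  by move=> x _; rewrite big_cons; case: ifP => // _; rewrite add0r.
by apply: Ck_onD => //; case: (P a) => //; exact: Ck_on_cst.
Qed.

Lemma Ck_on_prod k A (I : Type) (r : seq I) (P : pred I) (F : I -> 'rV[R]_n -> R) :
  open A -> (forall a, Ck_on k A (F a)) ->
  Ck_on k A (fun x => \prod_(a <- r | P a) F a x).
Proof.
move=> oA Fk; elim: r => [|a r IH].
  apply: (@Ck_on_eq _ _ (fun=> 1)) => //; last exact: Ck_on_cst.
  by move=> x _; rewrite big_nil.
apply: (@Ck_on_eq _ _ (fun x => (if P a then F a x else 1) *
                               \prod_(b <- r | P b) F b x)) => //.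
  by move=> x _; rewrite big_cons; case: ifP => // _; rewrite mul1r.
by apply: Ck_onM => //; case: (P a) => //; exact: Ck_on_cst.
Qed.

Lemma is_derive_outer (u : R -> R) (du df : R) f (x v : 'rV[R]_n) :
  is_derive x v (f : 'rV[R]_n -> R^o) df -> is_derive (f x) 1 (u : R -> R^o) du ->
  is_derive x v ((fun y => u (f y)) : 'rV[R]_n -> R^o) (du * df).
Proof.
move=> fd ud.
have i1 : is_derive (0 : R) 1 (fun s => f (s *: v + x) : R^o) df.
  by apply/is_derive_line; rewrite scale0r add0r.
have i2 : is_derive (f ((0 : R) *: v + x)) 1 (u : R -> R^o) du by rewrite scale0r add0r.
have := @is_derive1_comp _ u (fun s => f (s *: v + x)) 0 _ _ i2 i1.
move=> i3; have := (@is_derive_line _ R^o (fun y => u (f y)) x v 0 _).1 i3.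
by rewrite scale0r add0r.
Qed.

(** A family of functions of one variable that is closed under
differentiation, up to linear combinations with coefficients in the ring of
smooth functions, stays smooth after composition with a smooth function. The
inverse, the exponential, the logarithm, the square root and the flat function
$e^{-1/x}$ are all obtained from this induction. *)
Lemma Ck_on_comp1 k A (O : set R) (u du : nat -> R -> R) f : open A ->
  (forall m s, O s -> is_derive s 1 (u m : R -> R^o) (du m s)) ->
  (forall j, (forall m, Ck_on j A (fun x => u m (f x))) ->
             Ck_on j.+1 A f -> forall m, Ck_on j A (fun x => du m (f x))) ->
  (forall x, A x -> O (f x)) -> Ck_on k A f ->
  forall m, Ck_on k A (fun x => u m (f x)).
Proof.
move=> oA uE IHd fO fk.
have cts m x : Ck_on k A f -> A x -> {for x, continuous (fun x => u m (f x))}.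
  move=> fk' Ax; apply: continuous_comp; first exact: (Ck_on_cont fk').
  have [d _] := uE m _ (fO _ Ax).
  by apply/differentiable_continuous/derivable1_diffP.
elim: k fk cts => [|k IH] fk cts m.
  by split=> // x Ax; exact: cts.
have fk' := Ck_onW fk.
have IH' m' : Ck_on k A (fun x => u m' (f x)).
  apply: IH => // m'' x _ Ax; exact: cts.
apply: (@Ck_on_intro _ _ _ (fun i x => pd i f x * du m (f x))) => //.
- by move=> x Ax; exact: cts.
- move=> i x Ax; rewrite mulrC.
  by apply: is_derive_outer; [exact: Ck_on_is_derive fk Ax|exact: uE (fO _ Ax)].
- move=> i; apply: Ck_onM => //; first exact: Ck_on_pd.
  exact: IHd.
Qed.

End Closure.

Section Norm.
Variable n : nat.
Implicit Types u v x y : 'rV[R]_n.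

Lemma rV_normE u : `|u| = mx_norm u. Proof. by []. Qed.

Lemma rV_coord_le u j : `|u 0 j| <= `|u|.
Proof. by rewrite rV_normE mx_normrE; exact: (le_bigmax _ _ (0, j)). Qed.

Lemma rV_norm_le u c : 0 <= c -> (forall j, `|u 0 j| <= c) -> `|u| <= c.
Proof.
by move=> c0 uc; rewrite rV_normE mx_normrE bigmax_le// => -[i j] _; rewrite ord1.
Qed.

Lemma rV_norm_lt u c : 0 < c -> (forall j, `|u 0 j| < c) -> `|u| < c.
Proof.
by move=> c0 uc; rewrite rV_normE mx_normrE bigmax_lt// => -[i j] _; rewrite ord1.
Qed.

Lemma rV_ballE x r : ball x r = [set y | `|y - x| < r].
Proof. by rewrite -ball_normE; apply/seteqP; split=> y /=; rewrite distrC. Qed.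

Lemma rV_continuous (T : topologicalType) (G : T -> 'rV[R]_n) (t : T) :
  (forall j, {for t, continuous (fun t => G t 0 j)}) -> {for t, continuous G}.
Proof.
move=> cj; apply: (@cvgrPdist_lt _ _ _ (nbhs t) _ G (G t)).2 => e e0.
have : \forall a \near t, forall j, `|G t 0 j - G a 0 j| < e.
  apply: (@filter_forall _ _ (fun j a => `|G t 0 j - G a 0 j| < e) (nbhs t)) => j.
  by have /cvgrPdist_lt := cj j; exact.
apply: filterS => a aj; apply: rV_norm_lt => // j; rewrite !mxE; exact: aj.
Qed.

End Norm.

Section Differentiability.
Variable n : nat.
Implicit Types (A B : set 'rV[R]_n) (f g : 'rV[R]_n -> R).

Lemma is_derive_dirZ (V W : normedModType R) (f : V -> W) (x v : V) (a : R) (df : W) :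
  is_derive x v f df -> is_derive x (a *: v) f (a *: df).
Proof.
have [->|a0] := eqVneq a 0; first by move=> _; rewrite !scale0r; exact: is_derive0.
move=> [/cvg_ex[l fl] fE].
have le : l = df by rewrite -fE; apply/esym/cvg_lim.
suff H : h^-1 *: (f (h *: (a *: v) + x) - f x) @[h --> 0^'] --> a *: df.
  by apply: DeriveDef; [apply/cvg_ex; exists (a *: df)|exact: cvg_lim].
have {fl}fl : (h * a)^-1 *: (f ((h * a) *: v + x) - f x) @[h --> (0:R)^'] --> df.
  rewrite -le; apply: (cvg_comp (fun h : R => h * a) _ _ fl) => P /= [e e0 eP].
  exists (e / `|a|) => /=; first by rewrite divr_gt0 ?normr_gt0.
  move=> h /=; rewrite sub0r normrN => he h0; apply: eP => /=.
    by rewrite sub0r normrN normrM -ltr_pdivlMr ?normr_gt0.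
  by rewrite mulf_neq0.
have -> : (fun h : R => h^-1 *: (f (h *: (a *: v) + x) - f x)) =
  (fun h : R => a *: ((h * a)^-1 *: (f ((h * a) *: v + x) - f x))).
  by apply/funext => h; rewrite !scalerA invfM mulrCA mulfV// mulr1.
exact: cvgZl_tmp.
Qed.

Lemma mvt_line f (df : R -> R) (x v : 'rV[R]_n) :
  (forall s, 0 <= s <= 1 ->
     is_derive (s *: v + x) v (f : 'rV[R]_n -> R^o) (df s)) ->
  exists2 s, 0 <= s <= 1 & f (v + x) - f x = df s.
Proof.
move=> fd; pose g (s : R) := f (s *: v + x).
have gd (s : R) : 0 <= s <= 1 -> is_derive s 1 (g : R -> R^o) (df s).
  by move=> /fd fs; exact/(@is_derive_line _ R^o f).
have [s sI E] : exists2 s, s \in `]0, 1[%R & g 1 - g 0 = df s * (1 - 0).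
  apply: MVT => // [s|].
    by rewrite in_itv/= => /andP[s0 s1]; apply: gd; rewrite !ltW.
  apply: derivable_within_continuous => s.
  by rewrite in_itv/= => /gd[].
exists s; first by move: sI; rewrite in_itv/= => /andP[s0 s1]; rewrite !ltW.
by move: E; rewrite /g scale1r scale0r add0r subr0 mulr1.
Qed.

Let linpart (p : 'I_n -> 'rV[R]_n -> R) x (h : 'rV[R]_n) : R^o :=
  \sum_j h 0 j * p j x.

Fact linpart_linear p x : linear (linpart p x).
Proof.
move=> a u v; rewrite /linpart scaler_sumr -big_split/=; apply: eq_bigr => j _.
by rewrite !mxE mulrDl -[X in X + _]mulrA.
Qed.

Lemma linpart_continuous p x : continuous (linpart p x).
Proof.
move=> h.
have -> : linpart p x = \sum_j (fun h : 'rV[R]_n => h 0 j * p j x).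
  by apply/funext => u; rewrite fct_sumE.
apply: (big_ind (fun g : 'rV[R]_n -> R^o => {for h, continuous g})).
- exact: cst_continuous.
- by move=> g1 g2 c1 c2; exact: (cvgD c1 c2).
- move=> j _; apply: (@cvgMr_tmp _ _ (nbhs h)); exact: coord_continuous.
Qed.

(** Walk from $x$ to $x + h$ along the axes and use the mean value theorem on each
leg. *)
Lemma partials_expansion A f p x : open A ->
  (forall i y, A y -> is_derive y (delta_mx 0 i) (f : 'rV[R]_n -> R^o) (p i y)) ->
  (forall i, {for x, continuous (p i)}) -> A x ->
  forall eps, 0 < eps -> \forall h \near (0 : 'rV[R]_n),
    `|f (h + x) - f x - linpart p x h| <= eps * `|h|.
Proof.
move=> oA fp pc Ax eps e0.
pose e' := eps / n.+1%:R.
have e'0 : 0 < e' by rewrite divr_gt0.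
have Q : \forall y \near x, A y /\ forall j, `|p j x - p j y| <= e'.
  apply: filterI; first exact: open_near.
  apply: (@filter_forall _ _ (fun j y => `|p j x - p j y| <= e') (nbhs x)) => j.
  by have /cvgrPdist_le := pc j; exact.
have [d /= d0 dP] : exists2 d, 0 < d & forall y, `|y - x| < d ->
    A y /\ forall j, `|p j x - p j y| <= e'.
  have /nbhs_ballP[d /= d0 dP] := Q.
  by exists d => // y yd; apply: dP; rewrite rV_ballE.
apply/nbhs_ballP; exists d => //= h; rewrite rV_ballE/= subr0 => hd.
(* the corners of the path: the first k coordinates have already moved *)
pose y (k : nat) : 'rV[R]_n := \row_j (if (j < k)%N then h 0 j + x 0 j else x 0 j).
have yS (k : 'I_n) : y k.+1 = h 0 k *: delta_mx 0 k + y k.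
  apply/rowP => j; rewrite !mxE eqxx/= ltnS leq_eqVlt -val_eqE/=.
  case: (ltngtP j k) => [_|_|/val_inj->]; rewrite ?mulr0 ?add0r//.
  by rewrite mulr1.
have y0 : y 0%N = x by apply/rowP => j; rewrite !mxE ltn0.
have yn : y n = h + x by apply/rowP => j; rewrite !mxE ltn_ord.
have leg (k : 'I_n) : `|f (y k.+1) - f (y k) - h 0 k * p k x| <= e' * `|h|.
  have near_y s : 0 <= s <= 1 ->
      `|s *: (h 0 k *: delta_mx 0 k) + y k - x| < d.
    move=> /andP[s0 s1]; apply: le_lt_trans hd; apply: rV_norm_le => // j.
    apply: le_trans (rV_coord_le h j); rewrite !mxE eqxx/=.
    case: (ltngtP j k) => [jk|jk|/val_inj->].
    - by rewrite -val_eqE/= (ltn_eqF jk) !mulr0 add0r addrK.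
    - by rewrite -val_eqE/= (gtn_eqF jk) !mulr0 add0r subrr normr0.
    - by rewrite eqxx mulr1 addrK normrM ger0_norm// ler_piMl.
  have [s /near_y sd ->] : exists2 s, 0 <= s <= 1 & f (y k.+1) - f (y k) =
      h 0 k * p k (s *: (h 0 k *: delta_mx 0 k) + y k).
    rewrite yS; apply: (@mvt_line f
      (fun s => h 0 k * p k (s *: (h 0 k *: delta_mx 0 k) + y k))) => s /near_y sd.
    have [As _] := dP _ sd.
    by apply: is_derive_dirZ; exact: fp As.
  have [_ /(_ k) sk] := dP _ sd.
  rewrite -mulrBr normrM mulrC distrC ler_pM//; exact: rV_coord_le.
have -> : f (h + x) - f x - linpart p x h =
    \sum_(k < n) (f (y k.+1) - f (y k) - h 0 k * p k x).
  rewrite big_split/= sumrN; congr (_ - _).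
  by rewrite -(big_mkord xpredT (fun k => f (y k.+1) - f (y k))) telescope_sumr// yn y0.
apply: le_trans (ler_norm_sum _ _ _) _.
apply: (@le_trans _ _ (\sum_(k < n) e' * `|h|)); first exact: ler_sum.
rewrite sumr_const card_ord -[_ *+ n]mulr_natr /e' mulrAC ler_wpM2r//.
by rewrite -mulrA ler_piMr ?(ltW e0)// ler_pdivrMl// mulr1 ler_nat.
Qed.

Lemma partials_differentiable A f p x : open A ->
  (forall i y, A y -> is_derive y (delta_mx 0 i) (f : 'rV[R]_n -> R^o) (p i y)) ->
  (forall i, {for x, continuous (p i)}) -> A x ->
  differentiable (f : 'rV[R]_n -> R^o) x.
Proof.
move=> oA fp pc Ax.
pose HL := GRing.isLinear.Build _ _ _ _ _ (linpart_linear p x).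
pose d : {linear 'rV[R]_n -> R^o} := HB.pack (linpart p x) HL.
have E : (f : 'rV[R]_n -> R^o) \o shift x = cst (f x : R^o) + d +o_ (0 : 'rV[R]_n) id.
  apply/eqaddoP => eps e0; move: (partials_expansion oA fp pc Ax e0).
  by apply: filterS => h; rewrite /= opprD addrA.
have dE : 'd (f : 'rV[R]_n -> R^o) x = d :> (_ -> _).
  by apply: diff_unique => //; exact: linpart_continuous.
by apply/diff_locallyP; rewrite dE; split=> //; exact: linpart_continuous.
Qed.

Lemma C1_expansion A f x : open A -> Ck_on 1 A f -> A x ->
  forall eps, 0 < eps -> \forall h \near (0 : 'rV[R]_n),
    `|f (h + x) - f x - \sum_j h 0 j * pd j f x| <= eps * `|h|.
Proof.
move=> oA fk Ax; apply: (@partials_expansion A f (fun j => pd j f)) => //.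
- by move=> i y Ay; exact: Ck_on_is_derive fk Ay.
- by move=> i; exact: (Ck_on_cont (Ck_on_pd i fk)).
Qed.

Lemma C1_differentiable A f x : open A -> Ck_on 1 A f -> A x ->
  differentiable (f : 'rV[R]_n -> R^o) x.
Proof.
move=> oA fk Ax; apply: (@partials_differentiable A f (fun j => pd j f)) => //.
- by move=> i y Ay; exact: Ck_on_is_derive fk Ay.
- by move=> i; exact: (Ck_on_cont (Ck_on_pd i fk)).
Qed.

Lemma C1_diffE A f x v : open A -> Ck_on 1 A f -> A x ->
  'd (f : 'rV[R]_n -> R^o) x v = \sum_j v 0 j * pd j f x.
Proof.
move=> oA fk Ax; have df := C1_differentiable oA fk Ax.
rewrite [in LHS](row_sum_delta v) linear_sum; apply: eq_bigr => j _.
by rewrite linearZ/= pdE -deriveE.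
Qed.

Lemma C1_is_derive A f x v : open A -> Ck_on 1 A f -> A x ->
  is_derive x v (f : 'rV[R]_n -> R^o) (\sum_j v 0 j * pd j f x).
Proof.
move=> oA fk Ax; have df := C1_differentiable oA fk Ax.
by apply: DeriveDef; [exact: diff_derivable|rewrite deriveE// (C1_diffE _ oA fk Ax)].
Qed.

Lemma is_derive_rowP (V : normedModType R) (G : V -> 'rV[R]_n) (x v : V)
    (dG : 'rV[R]_n) :
  (forall j, is_derive x v (fun y => G y 0 j : R^o) (dG 0 j)) -> is_derive x v G dG.
Proof.
move=> Gd; have dvG : derivable G x v.
  by apply/derivable_mxP => i j; rewrite ord1; have [] := Gd j.
apply: DeriveDef => //; rewrite derive_mx//; apply/rowP => j; rewrite mxE.
by have [_] := Gd j.
Qed.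

(** The chain rule along a curve; together with [is_derive_line] it gives the
chain rule for partial derivatives. *)
Lemma C1_chain_curve A f (g : R -> 'rV[R]_n) (dg : 'rV[R]_n) s : open A ->
  Ck_on 1 A f -> A (g s) -> is_derive s 1 g dg ->
  is_derive s 1 (fun s => f (g s) : R^o) (\sum_j dg 0 j * pd j f (g s)).
Proof.
move=> oA fk Ag [dg1 dgE]; have df := C1_differentiable oA fk Ag.
have /derivable1_diffP g1 := dg1.
have fg1 : differentiable ((f : 'rV[R]_n -> R^o) \o g) s by exact: differentiable_comp.
apply: DeriveDef; first exact/derivable1_diffP.
rewrite [LHS](deriveE _ fg1) diff_comp//= -(C1_diffE _ oA fk Ag); congr ('d _ _ _).
by rewrite -dgE deriveE.
Qed.

Lemma C1_chain m A f (G : 'rV[R]_m -> 'rV[R]_n) x v (dG : 'rV[R]_n) : open A ->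
  Ck_on 1 A f -> A (G x) ->
  (forall j, is_derive x v (fun y => G y 0 j : R^o) (dG 0 j)) ->
  is_derive x v (fun y => f (G y) : R^o) (\sum_j dG 0 j * pd j f (G x)).
Proof.
move=> oA fk AG Gd.
have := (@is_derive_line _ R^o (fun y => f (G y)) x v 0 (\sum_j dG 0 j * pd j f (G x))).1.
rewrite scale0r add0r; apply.
have := @C1_chain_curve A f (fun s : R => G (s *: v + x)) dG 0 oA fk.
rewrite scale0r add0r; apply=> //.
by apply/is_derive_line; rewrite scale0r add0r; exact: is_derive_rowP.
Qed.

End Differentiability.

Section Composition.
Variable n : nat.
Implicit Types (A B : set 'rV[R]_n) (f g : 'rV[R]_n -> R).

Lemma Ck_on_inv k A f : open A -> (forall x, A x -> f x != 0) ->
  Ck_on k A f -> Ck_on k A (fun x => (f x)^-1).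
Proof.
move=> oA f0 fk.
apply: (@Ck_on_comp1 _ _ _ [set s : R | s != 0] (fun _ s => s^-1)
  (fun _ s => - s^-1 * s^-1) _ oA _ _ f0 fk 0%N).
- move=> _ s s0; have := @is_deriveV R idfun s 1 1 s0 (is_derive_id _ _).
  by rewrite /= expr2 invfM mulNr [_ *: 1]mulr1.
- move=> j H fj _; apply: Ck_onM => //; last exact: (H 0%N).
  by apply: Ck_onN => //; exact: (H 0%N).
Qed.

Lemma Ck_on_exp k A f : open A -> Ck_on k A f -> Ck_on k A (fun x => expR (f x)).
Proof.
move=> oA fk.
by apply: (@Ck_on_comp1 _ _ _ [set: R] (fun _ => expR) (fun _ => expR) _ oA _ _ _ fk 0%N).
Qed.

Lemma Ck_on_ln k A f : open A -> (forall x, A x -> 0 < f x) ->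
  Ck_on k A f -> Ck_on k A (fun x => ln (f x)).
Proof.
move=> oA f0 fk.
apply: (@Ck_on_comp1 _ _ _ [set s : R | 0 < s] (fun _ => @ln R)
  (fun _ s => s^-1) _ oA _ _ f0 fk 0%N).
by move=> j _ /Ck_onW fj _; apply: Ck_on_inv => // x /f0 /lt0r_neq0.
Qed.

(** $\sqrt s = e^{(\ln s)/2}$ *)
Lemma Ck_on_sqrt k A f : open A -> (forall x, A x -> 0 < f x) ->
  Ck_on k A f -> Ck_on k A (fun x => Num.sqrt (f x)).
Proof.
move=> oA f0 fk.
apply: (@Ck_on_eq _ _ _ (fun x => expR (2^-1 * ln (f x)))) => //.
  move=> x /f0 fx; apply/eqP; rewrite -(@eqrXn2 _ 2) ?expR_ge0 ?sqrtr_ge0//.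
  by rewrite sqr_sqrtr ?ltW// expr2 -expRD [_^-1 * _]mulrC -splitr lnK// posrE.
apply: Ck_on_exp => //; apply: Ck_onM => //; first exact: Ck_on_cst.
exact: Ck_on_ln.
Qed.

Lemma Ck_on_comp k m A (B : set 'rV[R]_m) (f : 'rV[R]_m -> R)
    (G : 'rV[R]_n -> 'rV[R]_m) : open A -> open B ->
  (forall x, A x -> B (G x)) -> Ck_on k B f ->
  (forall j, Ck_on k A (fun x => G x 0 j)) -> Ck_on k A (fun x => f (G x)).
Proof.
move=> oA oB GAB.
elim: k f => [|k IH] f fk Gk.
  split=> // x Ax; apply: continuous_comp.
    by apply: rV_continuous => j; exact: (Ck_on_cont (Gk j)).
  exact: (Ck_on_cont fk (GAB _ Ax)).
have Gk' j : Ck_on k A (fun x => G x 0 j) by exact: Ck_onW.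
apply: (@Ck_on_intro _ _ _ _
  (fun i x => \sum_j pd i (fun x => G x 0 j) x * pd j f (G x))) => //.
- move=> x Ax; apply: continuous_comp.
    by apply: rV_continuous => j; exact: (Ck_on_cont (Gk j)).
  exact: (Ck_on_cont fk (GAB _ Ax)).
- move=> i x Ax.
  have fk1 : Ck_on 1 B f by elim: k {IH Gk Gk'} fk => // k IH /Ck_onW.
  have := @C1_chain _ _ B f G x (delta_mx 0 i) (\row_j pd i (fun x => G x 0 j) x) oB fk1
    (GAB _ Ax).
  under eq_bigr do rewrite mxE; apply=> j.
  by rewrite mxE; exact: Ck_on_is_derive (Gk j) Ax.
- move=> i; apply: Ck_on_sum => // j; apply: Ck_onM => //; first exact: Ck_on_pd.
  by apply: IH => //; exact: Ck_on_pd.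
Qed.

Lemma smooth_pd A f i : smooth_on A f -> smooth_on A (pd i f).
Proof. by move=> fs k; exact: (Ck_on_pd i (fs k.+1)). Qed.

Lemma is_derive_comp_pd m A (B : set 'rV[R]_m) (f : 'rV[R]_m -> R)
    (G : 'rV[R]_n -> 'rV[R]_m) i x : open A -> open B ->
  A x -> B (G x) -> smooth_on B f -> (forall j, smooth_on A (fun x => G x 0 j)) ->
  pd i (fun x => f (G x)) x = \sum_j pd i (fun x => G x 0 j) x * pd j f (G x).
Proof.
move=> oA oB Ax Bx fs Gs.
have := @C1_chain _ _ B f G x (delta_mx 0 i) (\row_j pd i (fun x => G x 0 j) x) oB (fs 1%N) Bx.
under eq_bigr do rewrite mxE.
have H j : is_derive x (delta_mx 0 i) (fun y => G y 0 j : R^o)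
    ((\row_j pd i (fun x => G x 0 j) x) 0 j).
  by rewrite mxE; exact: Ck_on_is_derive (Gs j 1%N) Ax.
by rewrite pdE => /(_ H)[_].
Qed.

(** Symmetry of second derivatives. Two applications of the mean value theorem
write the second difference $f(x+se_i+se_j)-f(x+se_i)-f(x+se_j)+f(x)$ as
$s^2\partial_i\partial_jf$ and as $s^2\partial_j\partial_if$, each at a point
within $2s$ of $x$; let $s$ tend to $0$. *)
Lemma second_difference A f x i j (s : R) : open A -> Ck_on 2 A f -> 0 < s ->
  (forall y, `|y - x| <= 2 * s -> A y) ->
  exists2 y, `|y - x| <= 2 * s &
    f (s *: delta_mx 0 i + (s *: delta_mx 0 j + x)) - f (s *: delta_mx 0 i + x)
    - f (s *: delta_mx 0 j + x) + f x = s * (s * pd i (pd j f) y).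
Proof.
move=> oA f2 s0 sA.
have dn (k : 'I_n) : `|delta_mx 0 k : 'rV[R]_n| <= 1.
  by apply: rV_norm_le => // l; rewrite !mxE eqxx/=; case: (l == k); rewrite ?normr1 ?normr0.
have bd (a b : R) : 0 <= a <= s -> 0 <= b <= s ->
    `|a *: delta_mx 0 i + (b *: delta_mx 0 j + x) - x| <= 2 * s.
  move=> /andP[a0 a1] /andP[b0 b1]; rewrite addrA addrK.
  apply: le_trans (ler_normD _ _) _; rewrite mulr_natl mulr2n lerD//.
    by rewrite normrZ ger0_norm// (le_trans _ a1)// ler_piMr.
  by rewrite normrZ ger0_norm// (le_trans _ b1)// ler_piMr.
have scale01 (b : R) : 0 <= b -> b <= 1 -> 0 <= b * s <= s.
  by move=> b0 b1; rewrite mulr_ge0 ?(ltW s0)//= ler_piMl ?(ltW s0).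
have f1 := Ck_onW f2.
pose g y := f (s *: delta_mx 0 i + y) - f y.
have [b bI E1] : exists2 b, 0 <= b <= 1 & g (s *: delta_mx 0 j + x) - g x =
    s * (pd j f (s *: delta_mx 0 i + (b *: (s *: delta_mx 0 j) + x))
         - pd j f (b *: (s *: delta_mx 0 j) + x)).
  apply: (@mvt_line _ g (fun b => s * (pd j f (s *: delta_mx 0 i + (b *: (s *: delta_mx 0 j) + x))
         - pd j f (b *: (s *: delta_mx 0 j) + x)))) => b /andP[b0 b1].
  have bs : 0 <= b * s <= s by exact: scale01.
  have ss : 0 <= s <= s by rewrite lexx ltW.
  have s00 : 0 <= (0:R) <= s by rewrite lexx ltW.
  rewrite !scalerA; set y := _ *: _ + x.
  have Ay : A y by apply: sA; rewrite -[y]add0r -(scale0r (delta_mx 0 i)); exact: bd.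
  have Ay' : A (s *: delta_mx 0 i + y) by apply: sA; exact: bd.
  apply: (@is_derive_dirZ _ R^o).
  apply: is_deriveB; last exact: Ck_on_is_derive f1 Ay.
  by apply: is_derive_translate; exact: Ck_on_is_derive f1 Ay'.
have [a aI E2] : exists2 a, 0 <= a <= 1 &
    pd j f (s *: delta_mx 0 i + (b *: (s *: delta_mx 0 j) + x))
         - pd j f (b *: (s *: delta_mx 0 j) + x) =
    s * pd i (pd j f) (a *: (s *: delta_mx 0 i) + (b *: (s *: delta_mx 0 j) + x)).
  apply: (@mvt_line _ (pd j f) (fun a => s * pd i (pd j f)
    (a *: (s *: delta_mx 0 i) + (b *: (s *: delta_mx 0 j) + x)))) => a /andP[a0 a1].
  apply: (@is_derive_dirZ _ R^o); apply: (Ck_on_is_derive i (Ck_on_pd j f2)).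
  apply: sA; rewrite !scalerA; apply: bd.
    exact: scale01.
  by case/andP: bI => b0 b1; exact: scale01.
exists (a *: (s *: delta_mx 0 i) + (b *: (s *: delta_mx 0 j) + x)).
  rewrite !scalerA; apply: bd.
    by case/andP: aI => a0 a1; exact: scale01.
  by case/andP: bI => b0 b1; exact: scale01.
rewrite -E2 -E1 /g; move: (f _) (f _) (f _) (f _) => ? ? ? ?; ring.
Qed.

Lemma pd_sym A f x i j : open A -> Ck_on 2 A f -> A x ->
  pd i (pd j f) x = pd j (pd i f) x.
Proof.
move=> oA f2 Ax; apply/eqP; rewrite -subr_eq0 -normr_le0; apply/ler_addgt0Pr => e e0.
have ce k l : {for x, continuous (pd k (pd l f))}.
  exact: (Ck_on_cont (Ck_on_pd k (Ck_on_pd l f2)) Ax).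
have e20 : 0 < e / 2 by rewrite divr_gt0.
have h1 := @cvgr_dist_lt _ _ _ _ _ _ _ (ce i j) _ e20.
have h2 := @cvgr_dist_lt _ _ _ _ _ _ _ (ce j i) _ e20.
have h3 := @filterI _ (nbhs x) _ _ _ (open_near oA Ax)
  (@filterI _ (nbhs x) _ _ _ (h1 _) (h2 _)).
have [d /= d0 dP] := (nbhs_ballP x _).1 (h3 _ _ _ _).
pose s := d / 3.
have s0 : 0 < s by rewrite divr_gt0.
have sd y : `|y - x| <= 2 * s -> `|y - x| < d.
  by move/le_lt_trans; apply; rewrite /s; lra.
have sA y : `|y - x| <= 2 * s -> A y.
  by move=> /sd yd; case: (dP y) => //; rewrite rV_ballE.
have [y /sd yd Ey] := second_difference i j oA f2 s0 sA.
have [z /sd zd Ez] := second_difference j i oA f2 s0 sA.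
have By : ball x d y by rewrite rV_ballE.
have [_ [Hy _]] := dP y By.
have Bz : ball x d z by rewrite rV_ballE.
have [_ [_ Hz]] := dP z Bz.
have Emid (a b c t : R) : a - b - c + t = a - c - b + t by rewrite (addrAC a).
move: Ey; rewrite [s *: delta_mx 0 i + (_ + _)]addrCA Emid => Ey.
have yz := etrans (esym Ey) Ez.
have s0' : s != 0 by rewrite gt_eqF.
have {}yz := mulfI s0' (mulfI s0' yz).
rewrite add0r (_ : _ - _ = (pd i (pd j f) x - pd i (pd j f) y)
   - (pd j (pd i f) x - pd j (pd i f) z)); last by rewrite -yz opprB addrA subrK.
by rewrite (le_trans (ler_normB _ _))// ltW// [ltRHS]splitr ltrD.
Qed.

End Composition.
End SmoothCalculus.

(** * Inverse function theorem *)

Section SmoothMatrices.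
Variables (R : realType) (n k : nat) (A : set 'rV[R]_n).
Hypothesis oA : open A.

Lemma Ck_on_det m (M : 'rV[R]_n -> 'M[R]_m) :
  (forall i j, Ck_on k A (fun x => M x i j)) -> Ck_on k A (fun x => \det (M x)).
Proof.
move=> Mk; apply: Ck_on_sum => // s; apply: Ck_onM => //; first exact: Ck_on_cst.
exact: Ck_on_prod.
Qed.

Lemma Ck_on_invmx m (M : 'rV[R]_n -> 'M[R]_m) :
  (forall x, A x -> M x \in unitmx) ->
  (forall i j, Ck_on k A (fun x => M x i j)) ->
  forall i j, Ck_on k A (fun x => invmx (M x) i j).
Proof.
move=> Mu Mk i j.
apply: (@Ck_on_eq _ _ _ _ (fun x => (\det (M x))^-1 * cofactor (M x) j i)) => //.
  by move=> x Ax; rewrite /invmx Mu// !mxE.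
apply: Ck_onM => //.
  apply: Ck_on_inv => //; last exact: Ck_on_det.
  by move=> x /Mu; rewrite unitmxE unitfE.
apply: Ck_onM => //; first exact: Ck_on_cst.
apply: Ck_on_det => a b; apply: (@Ck_on_eq _ _ _ _
  (fun x => M x (lift j a) (lift i b))) => // x _.
by rewrite !mxE.
Qed.

End SmoothMatrices.

Section InverseFunction.
Variables (R : realType) (n : nat).
Implicit Types (x y u v : 'rV[R]_n).

Lemma open_normball (x0 : 'rV[R]_n) (r : R) : open [set x | `|x - x0| < r].
Proof. by rewrite -rV_ballE; exact: ball_open. Qed.

Lemma normball_convex (x0 x y : 'rV[R]_n) (r s : R) : 0 <= s <= 1 ->
  `|x - x0| < r -> `|y - x0| < r -> `|s *: (y - x) + x - x0| < r.
Proof.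
move=> /andP[s0 s1] xr yr.
have -> : s *: (y - x) + x - x0 = s *: (y - x0) + (1 - s) *: (x - x0).
  by apply/rowP => j; rewrite !mxE; ring.
apply: (@le_lt_trans _ _ (s * `|y - x0| + (1 - s) * `|x - x0|)).
  apply: le_trans (ler_normD _ _) _.
  by rewrite !normrZ (ger0_norm s0) ger0_norm ?subr_ge0.
have [->|s10] := eqVneq s 1; first by rewrite subrr mul0r addr0 mul1r.
have s1' : 0 < 1 - s by rewrite subr_gt0 lt_neqAle s10.
have h1 : s * `|y - x0| <= s * r by rewrite ler_wpM2l// ltW.
have h2 : (1 - s) * `|x - x0| < (1 - s) * r by rewrite ltr_pM2l.
by move: h1 h2; lra.
Qed.

Lemma rV_mulmx_le m (v : 'rV[R]_n) (M : 'M[R]_(n, m)) :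
  `|v *m M| <= (\sum_i \sum_j `|M i j|) * `|v|.
Proof.
have S0 : 0 <= \sum_i \sum_j `|M i j| by apply: sumr_ge0 => i _; exact: sumr_ge0.
apply: rV_norm_le => [|j]; first by rewrite mulr_ge0.
rewrite mxE; apply: le_trans (ler_norm_sum _ _ _) _.
rewrite mulr_suml ler_sum// => i _; rewrite normrM mulrC ler_pM//.
  by rewrite (bigD1 j)//= lerDl sumr_ge0.
exact: rV_coord_le.
Qed.

Lemma Lipschitz_of_pd A (f : 'rV[R]_n -> R) x0 r c x y : open A -> Ck_on 1 A f ->
  (forall z, `|z - x0| < r -> A z /\ forall j, `|pd j f z| <= c) ->
  `|x - x0| < r -> `|y - x0| < r -> `|f y - f x| <= n%:R * c * `|y - x|.
Proof.
move=> oA fk fb xr yr.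
have [s /(normball_convex)/(_ xr yr) sr] : exists2 s, 0 <= s <= 1 &
    f ((y - x) + x) - f x = \sum_j (y - x) 0 j * pd j f (s *: (y - x) + x).
  apply: (@mvt_line _ _ f
    (fun s => \sum_j (y - x) 0 j * pd j f (s *: (y - x) + x))) => s s01.
  apply: C1_is_derive oA fk _.
  by have [] := fb _ (normball_convex s01 xr yr).
rewrite subrK => ->; have [_ pb] := fb _ sr.
apply: le_trans (ler_norm_sum _ _ _) _.
apply: (@le_trans _ _ (\sum_(j < n) c * `|y - x|)).
  apply: ler_sum => j _; rewrite normrM mulrC ler_pM//; exact: rV_coord_le.
by rewrite sumr_const card_ord -[_ *+ n]mulr_natl mulrA.
Qed.

Section Contraction.
Variables (F : 'rV[R]_n -> 'rV[R]_n) (L : 'M[R]_n) (x0 : 'rV[R]_n) (s : R).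
Hypothesis Lu : L \in unitmx.
Hypothesis s0 : 0 < s.
Hypothesis contr : forall x y, `|x - x0| < s -> `|y - x0| < s ->
  `|(y - F y *m L) - (x - F x *m L)| <= 2^-1 * `|y - x|.
Let C : R := \sum_i \sum_j `|L i j|.

(** $y-x$ is at most $|y-x|/2$ away from $(F(y)-F(x))L$. *)
Lemma contr_expand x y : `|x - x0| < s -> `|y - x0| < s ->
  `|y - x| <= 2 * C * `|F y - F x|.
Proof.
move=> xs ys.
have : `|y - x| <= 2^-1 * `|y - x| + C * `|F y - F x|.
  have E : y - x = (y - F y *m L) - (x - F x *m L) + (F y - F x) *m L.
    rewrite mulmxBl; move: (F y *m L) (F x *m L) => a b.
    by apply/rowP => j; rewrite !mxE; ring.
  rewrite {1}E; apply: le_trans (ler_normD _ _) _.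
  by apply: lerD; [exact: contr|exact: rV_mulmx_le].
lra.
Qed.

Lemma contr_inj x y : `|x - x0| < s -> `|y - x0| < s -> F x = F y -> x = y.
Proof.
move=> xs ys Fxy; apply/eqP; rewrite eq_sym -subr_eq0 -normr_le0.
by have := contr_expand xs ys; rewrite Fxy subrr normr0 mulr0.
Qed.

(** The solution of $F(x) = y$ is the fixed point of the contraction
$x \mapsto x - (F(x) - y)L$; it is found as the point of a compact ball that
moves least. *)
Lemma contr_surj y : C * `|y - F x0| < s / 4 -> exists2 x, `|x - x0| < s & F x = y.
Proof.
move=> yC.
pose T x := x - F x *m L + y *m L.
(* half the radius: a compact part of the open ball, which T maps to itself
   because T x0 is within s / 4 of x0 *)
pose U : set 'rV[R]_n := [set x | `|x - x0| <= s / 2].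
have Us x : U x -> `|x - x0| < s.
  by move/le_lt_trans; apply; move: s0; lra.
have x0s : `|x0 - x0| < s by rewrite subrr normr0.
have TB x x' : `|x - x0| < s -> `|x' - x0| < s -> `|T x' - T x| <= 2^-1 * `|x' - x|.
  by move=> xs xs'; rewrite /T opprD addrACA subrr addr0; exact: contr.
have TU x : U x -> U (T x).
  move=> Ux; have h1 := TB x0 x x0s (Us _ Ux); move: Ux; rewrite /U/= => Ux.
  have -> : T x - x0 = (T x - T x0) + (y - F x0) *m L.
    by rewrite {3}/T mulmxBl; apply/rowP => j; rewrite !mxE; ring.
  apply: le_trans (ler_normD _ _) _.
  have := rV_mulmx_le (y - F x0) L; rewrite -/C => h2.
  lra.
have cU : compact U.
  rewrite (_ : U = closed_ball x0 (s / 2)); last first.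
    rewrite closed_ballE ?divr_gt0//; apply/seteqP.
    by split=> z; rewrite /U/closed_ball_/= distrC.
  apply: bounded_closed_compact; last exact: closed_ball_closed.
  exists (`|x0| + s / 2); split; first exact: num_real.
  move=> K /ltW; rewrite closed_ballE ?divr_gt0// => xK z; rewrite /closed_ball_/= => zx.
  apply: le_trans xK.
  rewrite -(subrK x0 z) addrC; apply: le_trans (ler_normD _ _) _.
  by rewrite lerD// distrC.
have U0 : U !=set0 by exists x0; rewrite /U/= subrr normr0 divr_ge0// ltW.
have cN : {within U, continuous (fun x => `|T x - x| : R)}.
  apply: continuous_in_subspaceT => x; rewrite inE => Ux.
  apply: (@cvgrPdist_lt _ _ _ (nbhs x) _ (fun x => `|T x - x|) _).2 => e e0.
  apply/nbhs_ballP; exists (Num.min (s / 2) (e / 2)) => /=; first by rewrite lt_min !divr_gt0.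
  move=> z; rewrite rV_ballE/= lt_min => /andP[z1 z2].
  have zs : `|z - x0| < s.
    rewrite -(subrK x z) -addrA; apply: le_lt_trans (ler_normD _ _) _.
    by rewrite [ltRHS](splitr s) ltr_leD.
  apply: le_lt_trans (ler_dist_dist _ _) _.
  have -> : T x - x - (T z - z) = (T x - T z) - (x - z).
    by apply/rowP => j; rewrite !mxE; ring.
  apply: le_lt_trans (ler_normB _ _) _.
  have := TB z x zs (Us _ Ux); rewrite (distrC x z).
  by move: z2; lra.
have [c] := EVT_min_rV U0 cU cN; rewrite inE => Uc cmin.
have cT : T c = c.
  apply/eqP; rewrite -subr_eq0 -normr_le0.
  have h1 := TB c (T c) (Us _ Uc) (Us _ (TU _ Uc)).
  have h2 := cmin (T c) (mem_set (TU _ Uc)).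
  lra.
exists c; first exact: Us.
have : (y - F c) *m L = 0.
  rewrite mulmxBl; apply/rowP => j; move/rowP: cT => /(_ j); rewrite /T.
  by move: (F c *m L) (y *m L) => a b; rewrite !mxE; lra.
move/(congr1 (mulmx^~ (invmx L))); rewrite mulmxK// mul0mx => /eqP.
by rewrite subr_eq0 => /eqP.
Qed.

End Contraction.

(** The inverse function theorem. Near a point where the Jacobian matrix $J$ is
invertible, $x \mapsto x - F(x)J^{-1}$ has small derivative, so it is a
contraction; this yields a local inverse, which is Lipschitz, hence
differentiable with Jacobian $J^{-1}$ at the image point, hence smooth by
induction on the number of derivatives. *)
Theorem inverse_function (A : set 'rV[R]_n) (F : 'rV[R]_n -> 'rV[R]_n) x0 :
  open A -> (forall j, smooth_on A (fun x => F x 0 j)) -> A x0 ->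
  (\matrix_(i, j) pd i (fun x => F x 0 j) x0) \in unitmx ->
  exists r s (G : 'rV[R]_n -> 'rV[R]_n),
  [/\ 0 < r, 0 < s,
      forall x, `|x - x0| < s -> A x,
      forall y, `|y - F x0| < r -> `|G y - x0| < s /\ F (G y) = y &
      (forall x, `|x - x0| < s -> `|F x - F x0| < r -> G (F x) = x) /\
      forall j, smooth_on [set y | `|y - F x0| < r] (fun y => G y 0 j)].
Proof.
move=> oA Fs Ax0.
pose J x : 'M[R]_n := \matrix_(i, j) pd i (fun x => F x 0 j) x.
rewrite -/(J x0) => Ju.
pose L := invmx (J x0).
have Lu : L \in unitmx by rewrite unitmx_inv.
pose H k x := x 0 k - (F x *m L) 0 k.
have FLk q k : Ck_on q A (fun x => (F x *m L) 0 k).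
  apply: (@Ck_on_eq _ _ _ _ (fun x => \sum_j F x 0 j * L j k)) => //.
    by move=> x _; rewrite mxE.
  by apply: Ck_on_sum => // j; apply: Ck_onM => //; [exact: Fs|exact: Ck_on_cst].
have Hk q k : Ck_on q A (H k).
  apply: Ck_onD => //; first exact: Ck_on_coord.
  exact: Ck_onN.
have Js q i j : Ck_on q A (fun x => J x i j).
  apply: (@Ck_on_eq _ _ _ _ (pd i (fun x => F x 0 j))) => //.
    by move=> x _; rewrite mxE.
  exact: Ck_on_pd (Fs j q.+1).
have H0 i k : pd i (H k) x0 = 0.
  have [_] : is_derive x0 (delta_mx 0 i) (H k : 'rV[R]_n -> R^o) ((k == i)%:R - (J x0 *m L) i k).
    apply: is_deriveB; first exact: is_derive_coord.
    have -> : (J x0 *m L) i k = \sum_j pd i (fun x => F x 0 j) x0 * L j k.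
      by rewrite mxE; apply: eq_bigr => j _; rewrite mxE.
    rewrite (_ : (fun x => (F x *m L) 0 k) = \sum_j (fun x => F x 0 j * L j k)); last first.
      by apply/funext => x; rewrite mxE fct_sumE.
    apply: is_derive_sum => j.
    have d1 := @Ck_on_is_derive _ _ 0 _ _ i _ (Fs j 1%N) Ax0.
    have d2 := @is_derive_cst _ _ R^o (L j k) x0 (delta_mx 0 i).
    have := @is_deriveM _ _ _ _ x0 (delta_mx 0 i) _ _ d1 d2.
    by rewrite scaler0 add0r [_ *: _]mulrC.
  by rewrite -pdE => ->; rewrite /L mulmxV// mxE eq_sym subrr.
(* n * eps is at most 1 / 2, the contraction factor *)
pose eps : R := (2 * n.+1%:R)^-1.
have eps0 : 0 < eps by rewrite invr_gt0 mulr_gt0.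
have detJ0 : \det (J x0) != 0 by rewrite -unitfE -unitmxE.
have [s /= s0 sP] : exists2 s : R, 0 < s & forall x, `|x - x0| < s ->
    A x /\ (\det (J x) != 0 /\ forall k i, `|pd i (H k) x| <= eps).
  have h1 : \forall x \near x0, \det (J x) != 0.
    have cdet : {for x0, continuous (fun x => \det (J x))}.
      by apply: (Ck_on_cont (@Ck_on_det _ _ 0 A oA _ J (Js 0%N))).
    have := @cvgr_neq0 _ _ _ _ _ _ _ cdet detJ0; exact.
  have h2 : \forall x \near x0, forall k i, `|pd i (H k) x| <= eps.
    apply: (@filter_forall _ _ (fun k x => forall i, `|pd i (H k) x| <= eps) (nbhs x0)) => k.
    apply: (@filter_forall _ _ (fun i x => `|pd i (H k) x| <= eps) (nbhs x0)) => i.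
    have ci : {for x0, continuous (pd i (H k))}.
      exact: (Ck_on_cont (Ck_on_pd i (Hk 1%N k))).
    have := @cvgr_norm_le _ _ _ _ _ _ _ ci eps; rewrite H0 normr0; exact.
  have [s s0 sP] := (nbhs_ballP x0 _).1
    (@filterI _ _ (nbhs_filter x0) _ _ (open_near oA Ax0)
       (@filterI _ _ (nbhs_filter x0) _ _ h1 h2)).
  by exists s => // x xs; apply: sP; rewrite rV_ballE.
have contr x y : `|x - x0| < s -> `|y - x0| < s ->
    `|(y - F y *m L) - (x - F x *m L)| <= 2^-1 * `|y - x|.
  move=> xs ys; apply: rV_norm_le => [|k]; first by rewrite mulr_ge0.
  have -> : ((y - F y *m L) - (x - F x *m L)) 0 k = H k y - H k x.
    by rewrite /H mxE [X in _ + X]mxE [X in X + _]mxE [X in _ - X]mxE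
      [X in _ + X - _]mxE [X in _ - (_ + X)]mxE.
  have := @Lipschitz_of_pd A (H k) x0 s eps x y oA (Hk 1%N k) _ xs ys.
  move=> /(_ _)/le_trans; apply.
    by move=> z /sP[Az [_ zk]]; split.
  rewrite ler_wpM2r// /eps invfM mulrCA ler_piMr// ler_pdivrMr// mul1r.
  by rewrite ler_nat.
(* C bounds the operator norm of L = J(x0)^-1, and r is small enough for contr_surj *)
pose C : R := \sum_i \sum_j `|L i j|.
have C0 : 0 <= C by apply: sumr_ge0 => i _; exact: sumr_ge0.
pose r := s / (4 * (C + 1)).
have C1 : 0 < 4 * (C + 1) by rewrite mulr_gt0// ltr_wpDl.
have r0 : 0 < r by rewrite divr_gt0.
have surj y : `|y - F x0| < r -> exists x, `|x - x0| < s /\ F x = y.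
  move=> yr; have [|x xs xy] := contr_surj Lu s0 contr (y := y); last by exists x.
  have : (C + 1) * `|y - F x0| < s / 4.
    rewrite -ltr_pdivlMl ?ltr_wpDl// (lt_le_trans yr)// /r invfM mulrA.
    by rewrite [_^-1 * (s / 4)]mulrC.
  by apply: le_lt_trans; rewrite ler_wpM2r// lerDl.
pose G y := xget x0 [set x | `|x - x0| < s /\ F x = y].
have GP y : `|y - F x0| < r -> `|G y - x0| < s /\ F (G y) = y.
  by move=> /surj yx; exact: (xgetPex x0 yx).
exists r, s, G; split => //; first by move=> x /sP[].
split=> [x xs Fxr|].
  have [Gs FG] := GP _ Fxr; exact: (contr_inj contr Gs xs FG).
pose W := [set y | `|y - F x0| < r].
have oW : open W by exact: open_normball.
have Glip y z : W y -> W z -> `|G z - G y| <= 2 * C * `|z - y|.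
  move=> /GP[Gy FGy] /GP[Gz FGz].
  by have := contr_expand contr Gy Gz; rewrite FGy FGz.
have Wnear y : W y -> exists2 d, 0 < d & forall z, `|z - y| < d -> W z.
  by move=> /(open_near oW)/nbhs_ballP[d /= d0 dW]; exists d => // z zd; apply: dW; rewrite rV_ballE.
have Gc y : W y -> forall j, {for y, continuous (fun y => G y 0 j)}.
  move=> Wy j; apply: (@cvgrPdist_lt _ _ _ (nbhs y) _ (fun y => G y 0 j) _).2 => e e0.
  have [d d0 dW] := Wnear _ Wy.
  have C2 : 0 < 2 * C + 1 by rewrite ltr_wpDl// mulr_ge0.
  apply/nbhs_ballP; exists (Num.min d (e / (2 * C + 1))) => /=.
    by rewrite lt_min d0 divr_gt0.
  move=> z; rewrite rV_ballE/= lt_min => /andP[/dW Wz]; rewrite ltr_pdivlMr// => ze.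
  have := Glip _ _ Wy Wz; have := rV_coord_le (G z - G y) j.
  rewrite !mxE distrC => h1 h2; apply: le_lt_trans (le_trans h1 h2) _.
  apply: le_lt_trans ze; rewrite mulrC ler_wpM2l// lerDl//.
(* if u = G(y + h e_i) - G y, then h e_i = u J(G y) + o(u), and u = O(h) *)
have Gdiff y : W y -> forall i, is_derive y (delta_mx 0 i) G (row i (invmx (J (G y)))).
  move=> Wy i; set K := invmx _.
  have [Gys FGy] := GP _ Wy.
  have JGu : J (G y) \in unitmx by have [_ [dJ _]] := sP _ Gys; rewrite unitmxE unitfE.
  suff Hlim : h^-1 *: (G (h *: delta_mx 0 i + y) - G y) @[h --> (0:R)^'] --> row i K.
    by apply: DeriveDef; [apply/cvg_ex; exists (row i K)|exact: cvg_lim].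
  apply: (@cvgrPdist_le _ _ _ ((0:R)^') _ _ (row i K)).2 => e e0.
  pose CK : R := \sum_i \sum_j `|K i j|.
  have CK0 : 0 <= CK by apply: sumr_ge0 => a _; exact: sumr_ge0.
  pose C2 := CK * (2 * C).
  have C20 : 0 <= C2 by rewrite mulr_ge0// mulr_ge0.
  pose e' := e / (C2 + 1).
  have e'0 : 0 < e' by rewrite divr_gt0// ltr_wpDl.
  have [d d0 dP] : exists2 d, 0 < d & forall u, `|u| < d ->
      `|F (u + G y) - F (G y) - u *m J (G y)| <= e' * `|u|.
    have : \forall u \near (0 : 'rV[R]_n), forall j,
        `|F (u + G y) 0 j - F (G y) 0 j - \sum_l u 0 l * pd l (fun x => F x 0 j) (G y)|
          <= e' * `|u|.
      apply: (@filter_forall _ _ (fun j u => `|F (u + G y) 0 j - F (G y) 0 j -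
        \sum_l u 0 l * pd l (fun x => F x 0 j) (G y)| <= e' * `|u|) (nbhs (0 : 'rV[R]_n))) => j.
      apply: (C1_expansion oA (Fs j 1%N)) => //; exact: (sP _ Gys).1.
    move=> /nbhs_ballP[d /= d0 dP]; exists d => // u ud.
    apply: rV_norm_le => [|j]; first by rewrite mulr_ge0// ltW.
    have ub : ball 0 d u by rewrite rV_ballE/= subr0.
    have E : (F (u + G y) - F (G y) - u *m J (G y)) 0 j = F (u + G y) 0 j - F (G y) 0 j -
        \sum_l u 0 l * pd l (fun x => F x 0 j) (G y).
      by rewrite !mxE; congr (_ - _); apply: eq_bigr => l _; rewrite mxE.
    by rewrite E; exact: dP.
  have [d' d'0 dW] := Wnear _ Wy.
  have C3 : 0 < 2 * C + 1 by rewrite ltr_wpDl// mulr_ge0.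
  exists (Num.min d' (d / (2 * C + 1))) => /=; first by rewrite lt_min d'0 divr_gt0.
  move=> h /=; rewrite sub0r normrN lt_min => /andP[hd' hd] h0.
  have dn : `|delta_mx 0 i : 'rV[R]_n| <= 1.
    apply: rV_norm_le => // l; rewrite !mxE eqxx/=.
    by case: (l == i); rewrite ?normr1 ?normr0.
  have hdn : `|h *: (delta_mx 0 i : 'rV[R]_n)| <= `|h| by rewrite normrZ ler_piMr.
  have Wh : W (h *: delta_mx 0 i + y).
    by apply: dW; rewrite addrK; exact: le_lt_trans hd'.
  set u := G _ - G y.
  have uh : `|u| <= 2 * C * `|h|.
    apply: le_trans (Glip _ _ Wy Wh) _; rewrite addrK ler_wpM2l// mulr_ge0//.
  have ud : `|u| < d.
    apply: le_lt_trans uh _; move: hd; rewrite ltr_pdivlMr// mulrC; apply: le_lt_trans.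
    by rewrite ler_wpM2r// lerDl.
  have := dP _ ud; rewrite /u subrK; have [_ ->] := GP _ Wh; rewrite -/u FGy addrK => Du.
  have E : h *: row i K - u = (h *: delta_mx 0 i - u *m J (G y)) *m K.
    by rewrite mulmxBl mulmxK// -scalemxAl -rowE.
  have h0' : 0 < `|h| by rewrite normr_gt0.
  have -> : row i K - h^-1 *: u = h^-1 *: (h *: row i K - u).
    by rewrite [in RHS]scalerBr scalerA mulVf// scale1r.
  rewrite normrZ normfV ler_pdivrMl// E.
  apply: le_trans (rV_mulmx_le _ _) _; rewrite -/CK.
  apply: (@le_trans _ _ (CK * (e' * (2 * C * `|h|)))).
    rewrite ler_wpM2l//; apply: le_trans Du _; rewrite ler_wpM2l// ltW//.
  have -> : CK * (e' * (2 * C * `|h|)) = `|h| * (e' * C2) by rewrite /C2; ring.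
  rewrite ler_wpM2l// /e' mulrAC ler_pdivrMr ?ltr_wpDl// ler_wpM2l ?ltW//.
  by rewrite ltrDl.
pose B := [set x | `|x - x0| < s].
have oB : open B by exact: open_normball.
have BA : B `<=` A by move=> x /sP[].
have JVs q i j : Ck_on q B (fun x => invmx (J x) i j).
  apply: Ck_on_invmx => // [x /sP[_ [dJ _]]|a b]; first by rewrite unitmxE unitfE.
  exact: Ck_on_sub BA (Js _ _ _).
move=> j k; elim: k j => [|k IH] j; first by split=> // y Wy; exact: Gc.
apply: (@Ck_on_intro _ _ _ _ _ (fun i y => invmx (J (G y)) i j)) => //.
- by move=> y Wy; exact: Gc.
- move=> i y Wy; have [dG dGE] := Gdiff y Wy i; apply: DeriveDef.
    by have /derivable_mxP := dG; apply.
  by have := derive_mx dG; rewrite dGE => /rowP/(_ j); rewrite !mxE => <-.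
(* the partial derivatives of G are smooth functions of G, which is C^k by induction *)
- move=> i; apply: (@Ck_on_comp _ _ _ _ _ B (fun x => invmx (J x) i j) G) => //.
  by move=> y /GP[].
Qed.

End InverseFunction.

(** * Poincare lemma *)

Section Poincare.
Variable R : realType.

Definition int01 (f : R -> R) : R :=
  (\int[@lebesgue_measure R]_(s in `[0, 1]) f s)%R.

Lemma cont01_integrable (f : R -> R) :
  (forall s : R, 0 <= s <= 1 -> {for s, continuous f}) ->
  (@lebesgue_measure R).-integrable `[0, 1] (EFin \o f).
Proof.
move=> fc; apply: continuous_compact_integrable; first exact: segment_compact.
by apply: continuous_in_subspaceT => s; rewrite inE/= in_itv/= => /fc.
Qed.

Lemma int01_FTC (P p : R -> R) :
  (forall s : R, 0 <= s <= 1 -> is_derive s 1 (P : R -> R^o) (p s)) ->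
  (forall s : R, 0 <= s <= 1 -> {for s, continuous p}) ->
  int01 p = P 1 - P 0.
Proof.
move=> Pd pc; rewrite /int01 /Rintegral (@continuous_FTC2 _ p P)//.
- by apply: continuous_in_subspaceT => s; rewrite inE/= in_itv/= => /pc.
- have Pc (s : R) : 0 <= s <= 1 -> {for s, continuous P}.
    by move=> /Pd[ds _]; apply/differentiable_continuous/derivable1_diffP.
  split=> [s|//|//].
  + by rewrite in_itv/= => /andP[/ltW s0 /ltW s1]; have [|//] := Pd s; rewrite s0.
  + by apply: cvg_at_right_filter; apply: Pc; rewrite lexx ler01.
  + by apply: cvg_at_left_filter; apply: Pc; rewrite lexx ler01.
- move=> s; rewrite in_itv/= => /andP[/ltW s0 /ltW s1]; rewrite derive1E.
  by have [|_ ->//] := Pd s; rewrite s0.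
Qed.

(** Differentiation under the integral sign, with a constant as dominating
function. *)
Lemma int01_derive (f df : R -> R -> R) (rho K : R) : 0 < rho ->
  (forall t s : R, `|t| < rho -> 0 <= s <= 1 ->
     [/\ is_derive t 1 (fun t => f t s : R^o) (df t s),
         {for s, continuous (f t)} & `|df t s| <= K]) ->
  is_derive (0:R) 1 (fun t => int01 (f t) : R^o) (int01 (df 0)).
Proof.
move=> r0 H.
have K0 : 0 <= K.
  have [||_ _] := H 0 0; rewrite ?normr0 ?lexx ?ler01//.
  by apply: le_trans.
have I0 : [set` `]- rho, rho[] (0:R) by rewrite /= in_itv/= oppr_lt0 r0.
have Ir (t : R) : [set` `]- rho, rho[] t -> `|t| < rho by rewrite /= in_itv/= ltr_norml.
have S01 (s : R) : [set` `[0, 1]] s -> 0 <= s <= 1 by rewrite /= in_itv.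
have dfE (t s : R) : `|t| < rho -> 0 <= s <= 1 -> partial1of2 f t s = df t s.
  by move=> tr s01; rewrite partial1of2E; have [[_ ->]] := H t s tr s01.
have h1 (t : R) : [set` `]- rho, rho[] t ->
    (@lebesgue_measure R).-integrable `[0, 1] (EFin \o f t).
  by move=> /Ir tr; apply: cont01_integrable => s s01; have [] := H t s tr s01.
have h2 (t s : R) : [set` `]- rho, rho[] t -> [set` `[0, 1]] s ->
    derivable ((f ^~ s) : R -> R^o) t 1.
  by move=> /Ir tr /S01 s01; have [[]] := H t s tr s01.
have h3 (s : R) : 0 <= (fun=> K) s by [].
have h4 : (@lebesgue_measure R).-integrable `[0, 1] (EFin \o (fun=> K)).
  by apply: cont01_integrable => s _; exact: cst_continuous.
have h5 (t s : R) : [set` `]- rho, rho[] t -> [set` `[0, 1]] s -> `|partial1of2 f t s| <= (fun=> K) s.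
  by move=> /Ir tr /S01 s01; rewrite dfE//; have [] := H t s tr s01.
have mB : measurable (`[0, 1]%classic : set R) by exact: measurable_itv.
have D := @derivable_under_integral R _ _ (@lebesgue_measure R) f _ mB 0 _ _ I0
  h1 h2 (fun=> K) h3 h4 h5.
have E := @differentiation_under_integral R _ _ (@lebesgue_measure R) f _ mB 0 _ _ I0
  h1 h2 (fun=> K) h3 h4 h5.
apply: DeriveDef; first exact: D.
rewrite -derive1E E; apply: eq_Rintegral => s.
by rewrite inE => /S01 s01; rewrite dfE ?normr0.
Qed.

(** The primitive is the integral along the segments issued from $x_0$;
differentiating under the integral sign
and using closedness turns the $j$-th derivative of the integrand into
$\frac{d}{ds}(s\,\theta_j(x_0 + s(x - x_0)))$. *)
Theorem poincare n (x0 : 'rV[R]_n) (r : R) (th : 'I_n -> 'rV[R]_n -> R) : 0 < r ->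
  (forall i, smooth_on [set x | `|x - x0| < r] (th i)) ->
  (forall i j x, `|x - x0| < r -> pd i (th j) x = pd j (th i) x) ->
  exists s (f : 'rV[R]_n -> R), [/\ 0 < s, s <= r,
    smooth_on [set x | `|x - x0| < s] f &
    forall i x, `|x - x0| < s -> pd i f x = th i x].
Proof.
move=> r0 ths closed.
pose A := [set x | `|x - x0| < r].
have oA : open A by exact: open_normball.
have Ax0 : A x0 by rewrite /A/= subrr normr0.
(* K bounds the th i and their derivatives near x0; it is needed to dominate the
   derivative of the integrand *)
pose K : R := 1 + \sum_i `|th i x0| + \sum_j \sum_i `|pd j (th i) x0|.
have K1 i : `|th i x0| < K.
  rewrite /K (bigD1 i)//=.
  have : 0 <= \sum_(l < n | l != i) `|th l x0| by exact: sumr_ge0.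
  have : 0 <= \sum_j \sum_i `|pd j (th i) x0| by apply: sumr_ge0 => *; exact: sumr_ge0.
  lra.
have K2 j i : `|pd j (th i) x0| < K.
  have h0 : 0 <= \sum_l `|th l x0| by exact: sumr_ge0.
  have h1 : `|pd j (th i) x0| <= \sum_i `|pd j (th i) x0|.
    by rewrite (bigD1 i)//= lerDl sumr_ge0.
  have h2 : \sum_i `|pd j (th i) x0| <= \sum_j \sum_i `|pd j (th i) x0|.
    by rewrite [leRHS](bigD1 j)//= lerDl; apply: sumr_ge0 => *; exact: sumr_ge0.
  by rewrite /K; lra.
have near_lt (g : 'rV[R]_n -> R) : {for x0, continuous g} -> `|g x0| < K ->
    \forall x \near x0, `|g x| <= K.
  move=> cg gK; have := @cvgr_norm_le _ _ _ _ _ _ _ cg K gK; exact.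
have [s1 s10 s1P] : exists2 s : R, 0 < s & forall x, `|x - x0| < s ->
    (forall i, `|th i x| <= K) /\ (forall j i, `|pd j (th i) x| <= K).
  have h1 : \forall x \near x0, forall i, `|th i x| <= K.
    apply: (@filter_forall _ _ (fun i x => `|th i x| <= K) (nbhs x0)) => i.
    apply: near_lt; last exact: K1.
    exact: (Ck_on_cont (ths i 0%N)).
  have h2 : \forall x \near x0, forall j i, `|pd j (th i) x| <= K.
    apply: (@filter_forall _ _ (fun j x => forall i, `|pd j (th i) x| <= K) (nbhs x0)) => j.
    apply: (@filter_forall _ _ (fun i x => `|pd j (th i) x| <= K) (nbhs x0)) => i.
    apply: near_lt; last exact: K2.
    exact: (Ck_on_cont (Ck_on_pd j (ths i 1%N))).
  have [s s0 sP] := (nbhs_ballP x0 _).1 (@filterI _ _ (nbhs_filter x0) _ _ h1 h2).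
  by exists s => // x xs; apply: sP; rewrite rV_ballE.
pose s := Num.min s1 r.
have s0 : 0 < s by rewrite lt_min s10.
have sr x : `|x - x0| < s -> A x by rewrite lt_min => /andP[].
have sK x : `|x - x0| < s ->
    (forall i, `|th i x| <= K) /\ (forall j i, `|pd j (th i) x| <= K).
  by rewrite lt_min => /andP[/s1P].
pose z x (sg : R) : 'rV[R]_n := sg *: (x - x0) + x0.
have zs x (sg : R) : `|x - x0| < s -> 0 <= sg <= 1 -> `|z x sg - x0| < s.
  move=> xs /andP[g0 g1]; rewrite /z addrK normrZ ger0_norm//.
  by apply: le_lt_trans xs; rewrite ler_piMl.
pose g x sg := \sum_i (x - x0) 0 i * th i (z x sg).
pose f x := int01 (g x).
have thzd i x (sg : R) : `|x - x0| < s -> 0 <= sg <= 1 ->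
    is_derive sg 1 (fun sg => th i (z x sg) : R^o) (\sum_l (x - x0) 0 l * pd l (th i) (z x sg)).
  move=> xs sg01; apply/is_derive_line.
  by apply: (C1_is_derive _ oA (ths i 1%N)); exact: sr (zs _ _ _ _).
have thzc i x (sg : R) : `|x - x0| < s -> 0 <= sg <= 1 -> {for sg, continuous (fun sg => th i (z x sg))}.
  by move=> xs /(thzd i _ _ xs)[d _]; apply/differentiable_continuous/derivable1_diffP.
have pthzc i j x (sg : R) : `|x - x0| < s -> 0 <= sg <= 1 ->
    {for sg, continuous (fun sg => pd j (th i) (z x sg))}.
  move=> xs sg01.
  have [d _] : is_derive sg 1 (fun sg => pd j (th i) (z x sg) : R^o)
      (\sum_l (x - x0) 0 l * pd l (pd j (th i)) (z x sg)).
    apply/is_derive_line.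
    by apply: (C1_is_derive _ oA (Ck_on_pd j (ths i 2%N))); exact: sr (zs _ _ _ _).
  by apply/differentiable_continuous/derivable1_diffP.
have gc x (sg : R) : `|x - x0| < s -> 0 <= sg <= 1 -> {for sg, continuous (g x)}.
  move=> xs sg01.
  rewrite (_ : g x = \sum_i (fun sg => (x - x0) 0 i * th i (z x sg))); last first.
    by apply/funext => t; rewrite fct_sumE.
  apply: (big_ind (fun u : R -> R => {for sg, continuous u})).
  - exact: cst_continuous.
  - by move=> g1 g2 c1 c2; exact: (cvgD c1 c2).
  - move=> i _; apply: (@cvgMl_tmp _ _ (nbhs sg)); exact: thzc.
have fd j x : `|x - x0| < s -> is_derive x (delta_mx 0 j) (f : 'rV[R]_n -> R^o) (th j x).
  move=> xs; pose e := delta_mx 0 j : 'rV[R]_n.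
  have en : `|e| <= 1.
    by apply: rV_norm_le => // l; rewrite !mxE eqxx/=; case: (l == j); rewrite ?normr1 ?normr0.
  pose y (t : R) := t *: e + x.
  have ys (t : R) : `|t| < s - `|x - x0| -> `|y t - x0| < s.
    move=> ts; rewrite /y -addrA; apply: le_lt_trans (ler_normD _ _) _.
    rewrite -ltrBrDr; apply: le_lt_trans ts.
    by rewrite normrZ ler_piMr.
  pose dg t sg := th j (z (y t) sg) + \sum_i (y t - x0) 0 i * (sg * pd j (th i) (z (y t) sg)).
  have rho0 : 0 < s - `|x - x0| by rewrite subr_gt0.
  have main : is_derive (0 : R) 1 (fun t => int01 (g (y t)) : R^o) (int01 (dg 0)).
    apply: (@int01_derive (fun t => g (y t)) dg _ (K + \sum_(i < n) s * K) rho0) => t sg ts sg01.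
    have yt := ys _ ts.
    split; [|exact: gc|].
    - rewrite /g /dg.
      have yd i : is_derive t 1 (fun t => (y t - x0) 0 i : R^o) (i == j)%:R.
        have := @is_derive_line _ _ R^o (fun u : 'rV[R]_n => (u - x0) 0 i) x e t (i == j)%:R.
        move=> H; apply/H.
        rewrite (_ : (fun u => _) = (fun u : 'rV[R]_n => u 0 i - x0 0 i)); last first.
          by apply/funext => u; rewrite !mxE.
        rewrite -[(i == j)%:R]subr0.
        by apply: is_deriveB; exact: is_derive_coord.
      have thd i : is_derive t 1 (fun t => th i (z (y t) sg) : R^o) (sg * pd j (th i) (z (y t) sg)).
        have := (@is_derive_line _ _ R^o (th i) (sg *: (x - x0) + x0) (sg *: e) t
            (sg *: (pd j (th i) (z (y t) sg) : R^o))).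
        have -> : (fun s2 : R => th i (s2 *: (sg *: e) + (sg *: (x - x0) + x0))) =
                  (fun t => th i (z (y t) sg)).
          apply/funext => t'; congr (th i _); rewrite /z /y.
          by apply/rowP => l; rewrite !mxE; ring.
        have -> : t *: (sg *: e) + (sg *: (x - x0) + x0) = z (y t) sg.
          by rewrite /z /y; apply/rowP => l; rewrite !mxE; ring.
        move=> H; apply/H; apply: is_derive_dirZ.
        apply: (Ck_on_is_derive j (ths i 1%N)); exact: sr (zs _ _ _ _).
      rewrite (_ : (fun t => \sum_i _) =
          \sum_i (fun t => (y t - x0) 0 i * th i (z (y t) sg))); last first.
        by apply/funext => t'; rewrite fct_sumE.
      have -> : th j (z (y t) sg) + \sum_i (y t - x0) 0 i * (sg * pd j (th i) (z (y t) sg)) =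
         \sum_i ((y t - x0) 0 i *: (sg * pd j (th i) (z (y t) sg) : R^o) +
                 th i (z (y t) sg) *: ((i == j)%:R : R^o)).
        rewrite big_split/= addrC; congr (_ + _).
        rewrite (bigD1 j)//= eqxx big1 ?addr0; first by rewrite [_ *: _]mulr1.
        by move=> i /negPf ->; rewrite scaler0.
      by apply: is_derive_sum => i; exact: is_deriveM.
    - have [k1 k2] := sK _ (zs _ _ yt sg01).
      apply: le_trans (ler_normD _ _) _; rewrite lerD//.
      apply: le_trans (ler_norm_sum _ _ _) _; apply: ler_sum => i _.
      rewrite normrM ler_pM//.
        by apply: le_trans (rV_coord_le _ _) _; exact: ltW.
      case/andP: sg01 => g0 g1; rewrite normrM ger0_norm//.
      by apply: le_trans (k2 j i); rewrite ler_piMl.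
  have y0 : y 0 = x by rewrite /y scale0r add0r.
  (* closedness exchanges i and j, and the integrand becomes the derivative of P *)
  have val : int01 (dg 0) = th j x.
    pose P sg := sg * th j (z x sg).
    rewrite (_ : th j x = P 1 - P 0); last first.
      by rewrite /P mul1r mul0r subr0 /z scale1r subrK.
    have Pd (sg : R) : 0 <= sg <= 1 -> is_derive sg 1 (P : R -> R^o) (dg 0 sg).
      move=> sg01; have d1 := thzd j _ _ xs sg01.
      have := @is_deriveM _ _ _ _ sg 1 _ _ (is_derive_id sg (1 : R)) d1.
      move=> dP; apply: (@is_derive_eq _ _ _ P sg 1 _ _ dP).
      rewrite /dg y0 [X in _ + X = _]mulr1 addrC; congr (_ + _).
      rewrite [LHS]mulr_sumr; apply: eq_bigr => i _; rewrite mulrCA; congr (_ * (_ * _)).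
      by apply: closed; exact: sr (zs _ _ _ _).
    apply: int01_FTC => // sg sg01.
    rewrite (_ : dg 0 = (fun sg => th j (z x sg)) +
       \sum_i (fun sg => (x - x0) 0 i * (sg * pd j (th i) (z x sg)))); last first.
      by apply/funext => t; rewrite /dg y0 fctE fct_sumE.
    apply: (@cvgD _ _ _ (nbhs sg)); first exact: thzc.
    apply: (big_ind (fun u : R -> R => {for sg, continuous u})).
    - exact: cst_continuous.
    - by move=> g1 g2 c1 c2; exact: (cvgD c1 c2).
    - move=> i _; apply: (@cvgMl_tmp _ _ (nbhs sg)).
      apply: (@cvgM _ _ (nbhs sg)); [exact: cvg_id|exact: pthzc].
  have := (@is_derive_line _ _ R^o f x e 0 (th j x)).1.
  by rewrite scale0r add0r; apply; rewrite -val; exact: main.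
pose B := [set x | `|x - x0| < s].
have oB : open B by exact: open_normball.
have BA : B `<=` A by exact: sr.
exists s, f; split => //; first by rewrite /s ge_min lexx orbT.
  have fc : Ck_on 0 B f.
    split=> // x Bx; apply: differentiable_continuous.
    apply: (partials_differentiable oB fd) => // i.
    exact: (Ck_on_cont (ths i 0%N) (BA _ Bx)).
  case=> [//|k]; apply: (@Ck_on_intro _ _ _ _ _ th) => //.
  - by move=> x Bx; case: fc => fc _; exact: fc.
  - by move=> i; exact: (Ck_on_sub BA (ths i k)).
by move=> i x xs; rewrite pdE; have [_] := fd i x xs.
Qed.

End Poincare.

(** * Connections over a ring with commuting derivations *)

Section DifferentialAlgebra.
Variables (C : comNzRingType) (n : nat).

(** The rules that partial derivatives of smooth functions obey. Tensor calculus
in a chart uses nothing else, so it is carried out in any commutative ring with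
such operators, where [ring] and equality of elements are available. *)
Record dsys (D : 'I_n -> C -> C) : Prop := Dsys {
  dsysD : forall i f g, D i (f + g) = D i f + D i g;
  dsysM : forall i f g, D i (f * g) = D i f * g + f * D i g;
  dsysC : forall i j f, D i (D j f) = D j (D i f)
}.

Definition dir (D : 'I_n -> C -> C) (X : 'cV[C]_n) (f : C) : C :=
  \sum_i X i 0 * D i f.

Definition dirm (D : 'I_n -> C -> C) (X : 'cV[C]_n) a b (M : 'M[C]_(a, b)) :=
  map_mx (dir D X) M.

Definition brk (D : 'I_n -> C -> C) (X Y : 'cV[C]_n) : 'cV[C]_n :=
  dirm D X Y - dirm D Y X.

Definition ip (g : 'M[C]_n) (X Y : 'cV[C]_n) : C := (X^T *m g *m Y) 0 0.

Lemma scalar11 (M : 'M[C]_1) : M = (M 0 0)%:M.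
Proof. by apply/matrixP => i j; rewrite !ord1 mxE. Qed.

Lemma tr00 (M : 'M[C]_1) : M^T 0 0 = M 0 0.
Proof. by rewrite mxE. Qed.

Lemma ipDl g X X' Y : ip g (X + X') Y = ip g X Y + ip g X' Y.
Proof. by rewrite /ip linearD !mulmxDl mxE. Qed.
Lemma ipDr g X Y Y' : ip g X (Y + Y') = ip g X Y + ip g X Y'.
Proof. by rewrite /ip mulmxDr mxE. Qed.
Lemma ipZl g a X Y : ip g (a *: X) Y = a * ip g X Y.
Proof. by rewrite /ip linearZ /= -!scalemxAl mxE. Qed.
Lemma ipZr g a X Y : ip g X (a *: Y) = a * ip g X Y.
Proof. by rewrite /ip -!scalemxAr mxE. Qed.
Lemma ipNl g X Y : ip g (- X) Y = - ip g X Y.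
Proof. by rewrite -scaleN1r ipZl mulN1r. Qed.
Lemma ipNr g X Y : ip g X (- Y) = - ip g X Y.
Proof. by rewrite -scaleN1r ipZr mulN1r. Qed.
Lemma ip0l g Y : ip g 0 Y = 0.
Proof. by rewrite -(scale0r 0) ipZl mul0r. Qed.
Lemma ip0r g Y : ip g Y 0 = 0.
Proof. by rewrite -(scale0r 0) ipZr mul0r. Qed.
Lemma ipC g X Y : g^T = g -> ip g X Y = ip g Y X.
Proof.
move=> gs; rewrite /ip; set M := _ *m _ *m Y.
by rewrite -[LHS]tr00 /M !trmx_mul trmxK gs mulmxA.
Qed.

Lemma ip_anti (F : 'M[C]_n) X Y : F^T = - F -> ip F X Y = - ip F Y X.
Proof.
move=> Fa; rewrite /ip; set m := _ *m _ *m Y.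
by rewrite -[LHS]tr00 /m !trmx_mul trmxK Fa mulNmx mulmxN mulmxA mxE.
Qed.

Section Dsys.
Variable D : 'I_n -> C -> C.
Hypothesis HD : dsys D.

Lemma dsys0 i : D i 0 = 0.
Proof. by apply: (addrI (D i 0)); rewrite -(dsysD HD) !addr0. Qed.

Lemma dsysN i f : D i (- f) = - D i f.
Proof. by apply: (addrI (D i f)); rewrite -(dsysD HD) !subrr dsys0. Qed.

Lemma dsys1 i : D i 1 = 0.
Proof. by apply: (addrI (D i 1)); rewrite -{3}(mulr1 1) (dsysM HD) mulr1 mul1r addr0. Qed.

Lemma dirD X f f' : dir D X (f + f') = dir D X f + dir D X f'.
Proof. by rewrite /dir -big_split/=; apply: eq_bigr => i _; rewrite (dsysD HD) mulrDr. Qed.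

Lemma dirM X f f' : dir D X (f * f') = dir D X f * f' + f * dir D X f'.
Proof.
rewrite /dir mulr_suml mulr_sumr -big_split/=; apply: eq_bigr => i _.
by rewrite (dsysM HD); ring.
Qed.

Lemma dir0 X : dir D X 0 = 0.
Proof. by rewrite /dir big1// => i _; rewrite dsys0 mulr0. Qed.
Lemma dir1 X : dir D X 1 = 0.
Proof. by rewrite /dir big1// => i _; rewrite dsys1 mulr0. Qed.
Lemma dirN X f : dir D X (- f) = - dir D X f.
Proof. by apply: (addrI (dir D X f)); rewrite -dirD !subrr dir0. Qed.

Lemma dir_sum X (I : Type) (r : seq I) (P : pred I) (F : I -> C) :
  dir D X (\sum_(i <- r | P i) F i) = \sum_(i <- r | P i) dir D X (F i).
Proof. exact: (big_morph _ (dirD X) (dir0 X)). Qed.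

Lemma dirDl X Y f : dir D (X + Y) f = dir D X f + dir D Y f.
Proof. by rewrite /dir -big_split/=; apply: eq_bigr => i _; rewrite mxE mulrDl. Qed.
Lemma dirZl a X f : dir D (a *: X) f = a * dir D X f.
Proof. by rewrite /dir mulr_sumr; apply: eq_bigr => i _; rewrite mxE mulrA. Qed.
Lemma dirNl X f : dir D (- X) f = - dir D X f.
Proof. by rewrite -scaleN1r dirZl mulN1r. Qed.

Lemma dir_delta i f : dir D (delta_mx i 0) f = D i f.
Proof.
rewrite /dir (bigD1 i)//= mxE !eqxx mul1r big1 ?addr0// => j /negPf ji.
by rewrite mxE ji mul0r.
Qed.

Lemma dirmD X a b (M M' : 'M[C]_(a, b)) : dirm D X (M + M') = dirm D X M + dirm D X M'.
Proof. by apply/matrixP => i j; rewrite !mxE dirD. Qed.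
Lemma dirmN X a b (M : 'M[C]_(a, b)) : dirm D X (- M) = - dirm D X M.
Proof. by apply/matrixP => i j; rewrite !mxE dirN. Qed.
Lemma dirmZ X a b f (M : 'M[C]_(a, b)) :
  dirm D X (f *: M) = dir D X f *: M + f *: dirm D X M.
Proof. by apply/matrixP => i j; rewrite !mxE dirM. Qed.
Lemma dirmM X a b c (M : 'M[C]_(a, b)) (M' : 'M[C]_(b, c)) :
  dirm D X (M *m M') = dirm D X M *m M' + M *m dirm D X M'.
Proof.
apply/matrixP => i j; rewrite !mxE dir_sum -big_split/=.
by apply: eq_bigr => k _; rewrite !mxE dirM.
Qed.
Lemma dirmT X a b (M : 'M[C]_(a, b)) : dirm D X M^T = (dirm D X M)^T.
Proof. by apply/matrixP => i j; rewrite !mxE. Qed.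
Lemma dirmDl X Y a b (M : 'M[C]_(a, b)) : dirm D (X + Y) M = dirm D X M + dirm D Y M.
Proof. by apply/matrixP => i j; rewrite !mxE dirDl. Qed.
Lemma dirmZl f X a b (M : 'M[C]_(a, b)) : dirm D (f *: X) M = f *: dirm D X M.
Proof. by apply/matrixP => i j; rewrite !mxE dirZl. Qed.
Lemma dirm_delta X (i : 'I_n) : dirm D X (delta_mx i (0 : 'I_1)) = 0.
Proof.
by apply/matrixP => k l; rewrite !mxE; case: (_ && _); rewrite ?dir0 ?dir1.
Qed.
Lemma dirm1 X a : dirm D X (1%:M : 'M[C]_a) = 0.
Proof. by apply/matrixP => k l; rewrite !mxE; case: (_ == _); rewrite ?dir0 ?dir1. Qed.

Lemma brkC X Y : brk D Y X = - brk D X Y.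
Proof. by rewrite /brk opprB. Qed.

Lemma brkZr X f Y : brk D X (f *: Y) = dir D X f *: Y + f *: brk D X Y.
Proof. by rewrite /brk dirmZ dirmZl scalerBr addrA. Qed.
Lemma brkZl X f Y : brk D (f *: X) Y = - dir D Y f *: X + f *: brk D X Y.
Proof. by rewrite [LHS]brkC brkZr opprD scaleNr [brk D Y X]brkC scalerN opprK. Qed.
Lemma brkDl X X' Y : brk D (X + X') Y = brk D X Y + brk D X' Y.
Proof. by rewrite /brk dirmDl dirmD opprD addrACA. Qed.
Lemma dir_dirm X Y f : dir D (dirm D X Y) f = \sum_i dir D X (Y i 0) * D i f.
Proof. by apply: eq_bigr => i _; rewrite mxE. Qed.

(** Here the commutation of the derivations is used. *)
Lemma dir_brk X Y f :
  dir D (brk D X Y) f = dir D X (dir D Y f) - dir D Y (dir D X f).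
Proof.
rewrite /brk dirDl dirNl !dir_dirm.
have E (U V : 'cV[C]_n) : dir D U (dir D V f) = \sum_i dir D U (V i 0) * D i f +
    \sum_i \sum_j V i 0 * U j 0 * D j (D i f).
  rewrite [X in dir D U X]/dir dir_sum -big_split/=; apply: eq_bigr => i _.
  rewrite dirM; congr (_ + _); rewrite /dir mulr_sumr.
  by apply: eq_bigr => j _; rewrite mulrA.
have S : \sum_i \sum_j X i 0 * Y j 0 * D j (D i f) = \sum_i \sum_j Y i 0 * X j 0 * D j (D i f).
  rewrite exchange_big/=; apply: eq_bigr => i _; apply: eq_bigr => j _.
  by rewrite (dsysC HD); ring.
by rewrite !E S opprD addrACA subrr addr0.
Qed.

Lemma dir_entry X a b (M : 'M[C]_(a, b)) i j : dir D X (M i j) = (dirm D X M) i j.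
Proof. by rewrite mxE. Qed.

Lemma dir_ip g X Y Z : dir D X (ip g Y Z) =
  ip g (dirm D X Y) Z + ip g Y (dirm D X Z) + ip (dirm D X g) Y Z.
Proof.
rewrite /ip dir_entry !dirmM dirmT mulmxDl.
by rewrite mxE [X in X + _]mxE; ring.
Qed.

Lemma d_form1 (th : 'rV[C]_n) (X Y : 'cV[C]_n) : dir D X ((th *m Y) 0 0) =
  \sum_i \sum_j X i 0 * Y j 0 * D i (th 0 j) + (th *m dirm D X Y) 0 0.
Proof.
rewrite dir_entry dirmM mxE; congr (_ + _).
rewrite mxE exchange_big/=; apply: eq_bigr => j _.
by rewrite mxE mulr_suml; apply: eq_bigr => i _; ring.
Qed.

Lemma closed_form1 (eta : 'rV[C]_n) X Y :
  (forall i j, D i (eta 0 j) = D j (eta 0 i)) ->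
  dir D X ((eta *m Y) 0 0) - dir D Y ((eta *m X) 0 0) = (eta *m brk D X Y) 0 0.
Proof.
move=> ec.
rewrite !d_form1 /brk mulmxBr [X in _ - (X + _)]exchange_big/= [in RHS]mxE [X in _ = _ + X]mxE.
set a := \sum_i _; set b := \sum_i _.
have -> : a = b.
  by apply: eq_bigr => i _; apply: eq_bigr => j _; rewrite ec; ring.
ring.
Qed.

(** Cartan's formula for the exterior derivative of a $2$-form; the last sum is
$dF(X,Y,Z)$. *)
Lemma exact2_form (F : 'M[C]_n) X Y Z : F^T = - F ->
  dir D X (ip F Y Z) + dir D Y (ip F Z X) + dir D Z (ip F X Y) =
  ip F (brk D X Y) Z + ip F (brk D Y Z) X + ip F (brk D Z X) Y +
  \sum_i \sum_j \sum_k X i 0 * Y j 0 * Z k 0 *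
     (D i (F j k) + D j (F k i) + D k (F i j)).
Proof.
move=> Fa.
have FC U V : ip F U V = - ip F V U by exact: ip_anti.
have E U V W : ip (dirm D U F) V W =
    \sum_i \sum_j \sum_k U i 0 * V j 0 * W k 0 * D i (F j k).
  rewrite /ip mxE exchange_big/=.
  transitivity (\sum_k \sum_j \sum_i U i 0 * V j 0 * W k 0 * D i (F j k)).
    apply: eq_bigr => k _; rewrite mxE mulr_suml; apply: eq_bigr => j _.
    rewrite !mxE mulr_sumr mulr_suml; apply: eq_bigr => i _; ring.
  rewrite exchange_big/= (exchange_big _ _ _ _ _ (fun j k => \sum_i _))/=.
  rewrite exchange_big/=.
  transitivity (\sum_j \sum_i \sum_k U i 0 * V j 0 * W k 0 * D i (F j k)).
    by apply: eq_bigr => j _; rewrite exchange_big.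
  by rewrite exchange_big.
rewrite !dir_ip !E /brk !ipDl !ipNl.
have -> : \sum_i \sum_j \sum_k Y i 0 * Z j 0 * X k 0 * D i (F j k) =
          \sum_i \sum_j \sum_k X i 0 * Y j 0 * Z k 0 * D j (F k i).
  rewrite (eq_bigr (fun i => \sum_k \sum_j Y i 0 * Z j 0 * X k 0 * D i (F j k))); last first.
    by move=> i _; rewrite exchange_big.
  rewrite exchange_big/=; apply: eq_bigr => k _; apply: eq_bigr => i _.
  by apply: eq_bigr => j _; ring.
have -> : \sum_i \sum_j \sum_k Z i 0 * X j 0 * Y k 0 * D i (F j k) =
          \sum_i \sum_j \sum_k X i 0 * Y j 0 * Z k 0 * D k (F i j).
  rewrite exchange_big/=; apply: eq_bigr => j _; rewrite exchange_big/=.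
  by apply: eq_bigr => k _; apply: eq_bigr => i _; ring.
set s1 := \sum_i _; set s2 := \sum_i _; set s3 := \sum_i _; set s4 := \sum_i _.
have -> : s4 = s1 + s2 + s3.
  rewrite -!big_split/=; apply: eq_bigr => i _; rewrite -!big_split/=.
  apply: eq_bigr => j _; rewrite -!big_split/=; apply: eq_bigr => k _; ring.
rewrite (FC Y (dirm D X Z)) (FC Z (dirm D Y X)) (FC X (dirm D Z Y)); ring.
Qed.

(** [lie X T] is the matrix of $L_XT$; its columns are given on the coordinate
fields. *)
Definition lie (X : 'cV[C]_n) (T : 'M[C]_n) : 'M[C]_n :=
  \matrix_(i, j) (brk D X (col j T) - T *m brk D X (delta_mx j 0)) i 0.

Lemma lieE X T Y : lie X T *m Y = brk D X (T *m Y) - T *m brk D X Y.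
Proof.
have -> : lie X T = dirm D X T - \matrix_(i, j) dir D (col j T) (X i 0) +
    T *m \matrix_(i, j) D j (X i 0).
  apply/matrixP => i j; rewrite !mxE; congr (_ - _ + _).
  rewrite -sumrN; apply: eq_bigr => k _; rewrite /brk dirm_delta sub0r !mxE.
  by rewrite dir_delta mulrN opprK.
rewrite !mulmxDl mulNmx /brk dirmM mulmxBr opprB -mulmxA.
have -> : (\matrix_(i, j) D j (X i 0)) *m Y = dirm D Y X.
  by apply/matrixP => i j; rewrite ord1 !mxE; apply: eq_bigr => k _; rewrite mxE mulrC.
have -> : (\matrix_(i, j) dir D (col j T) (X i 0)) *m Y = dirm D (T *m Y) X.
  apply/matrixP => i j; rewrite ord1 !mxE /dir.
  transitivity (\sum_k \sum_l T l k * Y k 0 * D l (X i 0)).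
    by apply: eq_bigr => k _; rewrite !mxE mulr_suml; apply: eq_bigr => l _; rewrite !mxE; ring.
  by rewrite exchange_big/=; apply: eq_bigr => l _; rewrite mxE mulr_suml.
move: (dirm D X T *m Y) (dirm D (T *m Y) X) (T *m dirm D Y X) (T *m dirm D X Y).
by move=> a b c d; apply/matrixP => i j; rewrite !mxE; ring.
Qed.

(** * The Levi-Civita connection *)

Variable hf : C.
Hypothesis hf2 : hf + hf = 1.

Lemma two_inj (a : C) : a + a = 0 -> a = 0.
Proof. by move=> aa; rewrite -[a]mul1r -hf2 mulrDl -mulrDr aa mulr0. Qed.

Record levi (g : 'M[C]_n) (N : 'cV[C]_n -> 'cV[C]_n -> 'cV[C]_n) : Prop := Levi {
  levi_torsion : forall X Y, N X Y - N Y X = brk D X Y;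
  levi_metric : forall X Y Z, dir D X (ip g Y Z) = ip g (N X Y) Z + ip g Y (N X Z)
}.

(** The difference of two such connections is symmetric in its first two
arguments and, after lowering, antisymmetric in the last two; so it is $0$. *)
Lemma levi_unique g gi N N' X Y : g^T = g -> gi *m g = 1%:M ->
  levi g N -> levi g N' -> N X Y = N' X Y.
Proof.
move=> gs gig [t m] [t' m'].
pose S X Y Z := ip g (N X Y - N' X Y) Z.
have S1 U V W : S U V W = S V U W.
  rewrite /S; congr (ip g _ W); apply/eqP; rewrite subr_eq addrAC eq_sym subr_eq.
  apply/eqP; move: (t U V) (t' U V) => <- /eqP.
  rewrite subr_eq => /eqP ->; move: (N U V) (N V U) (N' V U) => a b c.
  by apply/matrixP => i j; rewrite !mxE; ring.
have S2 U V W : S U V W = - S U W V.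
  apply/eqP; rewrite -subr_eq0 opprK /S !ipDl !ipNl; apply/eqP.
  rewrite [ip g (N U W) V]ipC// [ip g (N' U W) V]ipC//.
  have := m U V W; rewrite m' => E.
  have -> : ip g (N U V) W - ip g (N' U V) W + (ip g V (N U W) - ip g V (N' U W)) =
    (ip g (N U V) W + ip g V (N U W)) - (ip g (N' U V) W + ip g V (N' U W)) by ring.
  by rewrite -E subrr.
have S0 U V W : S U V W = 0.
  apply: two_inj; rewrite {1}S2 S1 S2 opprK S1 S2 S1.
  by rewrite addNr.
have : gi *m (g *m (N X Y - N' X Y)) = 0.
  rewrite (_ : g *m _ = 0) ?mulmx0//.
  apply/matrixP => i j; rewrite ord1 [RHS]mxE -(S0 X Y (delta_mx i 0)).
  rewrite /S ipC// /ip trmx_delta -mulmxA -rowE [RHS]mxE//.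
by rewrite mulmxA gig mul1mx => /subr0_eq.
Qed.

(** The Christoffel symbols with the last index lowered. *)
Definition chrl (g : 'M[C]_n) (i j m : 'I_n) : C :=
  hf * (D i (g j m) + D j (g i m) - D m (g i j)).

Definition gaml (g : 'M[C]_n) (X Y : 'cV[C]_n) : 'cV[C]_n :=
  \col_m \sum_i \sum_j chrl g i j m * X i 0 * Y j 0.

Definition nab (g gi : 'M[C]_n) (X Y : 'cV[C]_n) : 'cV[C]_n :=
  dirm D X Y + gi *m gaml g X Y.

(** The Koszul formula gives a torsion free metric connection. *)
Lemma nab_levi g gi : g^T = g -> gi *m g = 1%:M -> levi g (nab g gi).
Proof.
move=> gs gig.
have gE i j : g i j = g j i by rewrite -{1}gs mxE.
have ggi : g *m gi = 1%:M by exact: mulmx1C.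
split=> [X Y|X Y Z].
  suff E : gaml g Y X = gaml g X Y by rewrite /nab E opprD addrACA subrr addr0.
  apply/colP => m; rewrite !mxE exchange_big/=; apply: eq_bigr => i _.
  apply: eq_bigr => j _; rewrite /chrl (gE j i).
  rewrite [D j (g i m) + _]addrC; ring.
rewrite dir_ip /nab !(ipDl, ipDr).
have E U V : ip g (gi *m U) V = ip 1%:M U V.
  by rewrite /ip trmx_mul mulmx1 -(mulmxA U^T) -[in gi^T *m g]gs -trmx_mul ggi trmx1 mulmx1.
rewrite E (ipC Y (gi *m _))// E.
suff -> : ip (dirm D X g) Y Z = ip 1%:M (gaml g X Y) Z + ip 1%:M (gaml g X Z) Y by ring.
rewrite /ip !mulmx1 !mxE.
transitivity (\sum_m \sum_j \sum_i X i 0 * Y j 0 * Z m 0 * D i (g j m)).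
  apply: eq_bigr => m _; rewrite mxE mulr_suml; apply: eq_bigr => j _.
  by rewrite !mxE mulr_sumr mulr_suml; apply: eq_bigr => i _; ring.
have -> : \sum_j (gaml g X Y)^T 0 j * Z j 0 =
  \sum_m \sum_j \sum_i chrl g i j m * X i 0 * Y j 0 * Z m 0.
  apply: eq_bigr => m _; rewrite !mxE exchange_big/= mulr_suml; apply: eq_bigr => j _.
  by rewrite mulr_suml.
have -> : \sum_j (gaml g X Z)^T 0 j * Y j 0 =
  \sum_m \sum_j \sum_i chrl g i m j * X i 0 * Y j 0 * Z m 0.
  rewrite exchange_big/=; apply: eq_bigr => j _.
  rewrite !mxE exchange_big/= mulr_suml; apply: eq_bigr => m _.
  by rewrite mulr_suml; apply: eq_bigr => i _; ring.
rewrite -big_split/=; apply: eq_bigr => m _; rewrite -big_split/=.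
apply: eq_bigr => j _; rewrite -big_split/=; apply: eq_bigr => i _.
rewrite /chrl (gE m j).
transitivity ((hf + hf) * (X i 0 * Y j 0 * Z m 0 * D i (g j m))).
  by rewrite hf2 mul1r.
by ring.
Qed.

Section Nabla.
Variables g gi : 'M[C]_n.
Let N := nab g gi.

Lemma gamlDl X X' Y : gaml g (X + X') Y = gaml g X Y + gaml g X' Y.
Proof.
apply/colP => m; rewrite !mxE -big_split/=; apply: eq_bigr => i _.
by rewrite -big_split/=; apply: eq_bigr => j _; rewrite mxE; ring.
Qed.
Lemma gamlDr X Y Y' : gaml g X (Y + Y') = gaml g X Y + gaml g X Y'.
Proof.
apply/colP => m; rewrite !mxE -big_split/=; apply: eq_bigr => i _.
by rewrite -big_split/=; apply: eq_bigr => j _; rewrite mxE; ring.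
Qed.
Lemma gamlZl a X Y : gaml g (a *: X) Y = a *: gaml g X Y.
Proof.
apply/colP => m; rewrite !mxE mulr_sumr; apply: eq_bigr => i _.
by rewrite mulr_sumr; apply: eq_bigr => j _; rewrite mxE; ring.
Qed.
Lemma gamlZr a X Y : gaml g X (a *: Y) = a *: gaml g X Y.
Proof.
apply/colP => m; rewrite !mxE mulr_sumr; apply: eq_bigr => i _.
by rewrite mulr_sumr; apply: eq_bigr => j _; rewrite mxE; ring.
Qed.

Lemma nabDl X X' Y : N (X + X') Y = N X Y + N X' Y.
Proof. by rewrite /N /nab dirmDl gamlDl mulmxDr addrACA. Qed.
Lemma nabZl a X Y : N (a *: X) Y = a *: N X Y.
Proof. by rewrite /N /nab dirmZl gamlZl -scalemxAr scalerDr. Qed.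
Lemma nabNl X Y : N (- X) Y = - N X Y.
Proof. by rewrite -scaleN1r nabZl scaleN1r. Qed.
Lemma nabDr X Y Y' : N X (Y + Y') = N X Y + N X Y'.
Proof. by rewrite /N /nab dirmD gamlDr mulmxDr addrACA. Qed.
Lemma nabZr X a Y : N X (a *: Y) = dir D X a *: Y + a *: N X Y.
Proof. by rewrite /N /nab dirmZ gamlZr -scalemxAr scalerDr addrA. Qed.
Lemma nab0r X : N X 0 = 0.
Proof. by rewrite -(scale0r 0) nabZr dir0 !scale0r addr0. Qed.

Definition curv X Y Z := N X (N Y Z) - N Y (N X Z) - N (brk D X Y) Z.

Lemma curvC X Y Z : curv Y X Z = - curv X Y Z.
Proof.
rewrite /curv brkC nabNl; move: (N _ _) (N _ _) (N _ _) => a b c.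
by apply/colP => i; rewrite !mxE; ring.
Qed.

Lemma curvDl X X' Y Z : curv (X + X') Y Z = curv X Y Z + curv X' Y Z.
Proof.
rewrite /curv brkDl !nabDl nabDr; do ?move: (N _ _) => ?.
by apply/colP => i; rewrite !mxE; ring.
Qed.

(** The derivatives of [f] cancel: the curvature is a tensor. *)
Lemma curvZl f X Y Z : curv (f *: X) Y Z = f *: curv X Y Z.
Proof.
rewrite /curv brkZl nabDl !nabZl nabZr; do ?move: (N _ _) => ?.
by apply/colP => i; rewrite !mxE; ring.
Qed.

Lemma curvDr X Y Y' Z : curv X (Y + Y') Z = curv X Y Z + curv X Y' Z.
Proof. by rewrite -[LHS]opprK -curvC curvDl opprD -!curvC. Qed.
Lemma curvZr f X Y Z : curv X (f *: Y) Z = f *: curv X Y Z.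
Proof. by rewrite -[LHS]opprK -curvC curvZl -scalerN -curvC. Qed.

Lemma curv_delta X Y Z : curv X Y Z =
  \sum_i \sum_j (X i 0 * Y j 0) *: curv (delta_mx i 0) (delta_mx j 0) Z.
Proof.
have c0 V W : curv 0 V W = 0 by have := curvZl 0 0 V W; rewrite !scale0r.
have c0r V W : curv V 0 W = 0 by have := curvZr 0 V 0 W; rewrite !scale0r.
have XE (V : 'cV[C]_n) : V = \sum_i V i 0 *: delta_mx i 0.
  rewrite {1}[V]matrix_sum_delta; apply: eq_bigr => i _; by rewrite big_ord1.
rewrite {1}(XE X) (big_morph (fun V => curv V Y Z) (fun _ _ => curvDl _ _ _ _) (c0 _ _)).
apply: eq_bigr => i _; rewrite curvZl {1}(XE Y).
rewrite (big_morph (fun V => curv _ V Z) (fun _ _ => curvDr _ _ _ _) (c0r _ _)).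
by rewrite scaler_sumr; apply: eq_bigr => j _; rewrite curvZr scalerA.
Qed.

End Nabla.
End Dsys.
End DifferentialAlgebra.

(** * Almost Kenmotsu structures in an orthonormal frame *)

Lemma ord3P (i : 'I_3) : [\/ i = ix1, i = ix2 | i = it].
Proof.
case: i => [[|[|[|//]]] Hi]; [apply: Or31|apply: Or32|apply: Or33]; exact: val_inj.
Qed.

Lemma sum3 (V : nmodType) (F : 'I_3 -> V) : \sum_i F i = F ix1 + F ix2 + F it.
Proof.
rewrite !big_ord_recl big_ord0 addr0 addrA.
by congr (F _ + F _ + F _); exact: val_inj.
Qed.

Lemma wedge_eval (C : comNzRingType) (F : 'M[C]_3) (a : 'rV[C]_3) (t : C) (X Y Z : 'cV[C]_3) :
  \sum_i \sum_j \sum_k X i 0 * Y j 0 * Z k 0 *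
    (t * (a 0 i * F j k + a 0 j * F k i + a 0 k * F i j)) =
  t * ((a *m X) 0 0 * ip F Y Z + (a *m Y) 0 0 * ip F Z X + (a *m Z) 0 0 * ip F X Y).
Proof. by rewrite /ip !sum3 !mxE !sum3 !mxE !sum3 !mxE; ring. Qed.

Lemma frame_matrix (C : comNzRingType) (g : 'M[C]_3) (e : 'I_3 -> 'cV[C]_3) :
  (forall a b, ip g (e a) (e b) = (a == b)%:R) -> exists2 E : 'M[C]_3, (forall i j, E i j = e j i 0) &
  E *m (E^T *m g) = 1%:M.
Proof.
move=> orth.
pose E : 'M[C]_3 := \matrix_(i, j) e j i 0; exists E; first by move=> i j; rewrite mxE.
apply: mulmx1C; apply/matrixP => a b; rewrite [RHS]mxE -orth /ip !mxE.
apply: eq_bigr => k _; rewrite !mxE; congr (_ * _).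
by apply: eq_bigr => l _; rewrite !mxE.
Qed.

Section FrameClosed.
Variables (C : comNzRingType) (D : 'I_3 -> C -> C).
Hypothesis HD : dsys D.

(** $d\theta$ is a tensor, so it vanishes as soon as it does on a frame. *)
Lemma frame_closed (g : 'M[C]_3) (e : 'I_3 -> 'cV[C]_3) (th : 'rV[C]_3) :
  (forall a b, ip g (e a) (e b) = (a == b)%:R) -> g^T = g ->
  (forall a b, dir D (e a) ((th *m e b) 0 0) - dir D (e b) ((th *m e a) 0 0) =
               (th *m brk D (e a) (e b)) 0 0) ->
  forall i j, D i (th 0 j) = D j (th 0 i).
Proof.
move=> orth gs H.
pose W : 'M[C]_3 := \matrix_(i, j) (D i (th 0 j) - D j (th 0 i)).
have WE a b : ip W (e a) (e b) = 0.
  have := H a b; rewrite !(d_form1 HD).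
  have -> : (th *m brk D (e a) (e b)) 0 0 =
      (th *m dirm D (e a) (e b)) 0 0 - (th *m dirm D (e b) (e a)) 0 0.
    by rewrite /brk mulmxBr mxE [X in _ + X]mxE.
  have -> : ip W (e a) (e b) = \sum_i \sum_j e a i 0 * e b j 0 * D i (th 0 j) -
     \sum_i \sum_j e b i 0 * e a j 0 * D i (th 0 j).
    rewrite /ip mxE [X in _ = X - _]exchange_big -sumrB; apply: eq_bigr => j _.
    by rewrite mxE mulr_suml -sumrB; apply: eq_bigr => i _; rewrite !mxE; ring.
  set x := (th *m _) 0 0; set y := (th *m _) 0 0; set u := \sum_i _; set v := \sum_i _.
  move=> E; have -> : u - v = (u + x - (v + y)) - (x - y) by ring.
  by rewrite E subrr.
have [E EE E1] := frame_matrix orth.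
have W0 : E^T *m W *m E = 0.
  apply/matrixP => a b; rewrite [RHS]mxE -(WE a b) /ip !mxE.
  apply: eq_bigr => k _; rewrite EE !mxE; congr (_ * _).
  by apply: eq_bigr => l _; rewrite !mxE EE.
have : (E *m (E^T *m g))^T *m W *m (E *m (E^T *m g)) = 0.
  rewrite !trmx_mul trmxK gs.
  have -> : g *m E *m E^T *m W *m (E *m (E^T *m g)) = g *m E *m (E^T *m W *m E) *m (E^T *m g).
    by rewrite !mulmxA.
  by rewrite W0 mulmx0 mul0mx.
rewrite E1 trmx1 mul1mx mulmx1 => /matrixP W00 i j.
by have := W00 i j; rewrite !mxE => /subr0_eq.
Qed.

End FrameClosed.

(** The compatibility of $g$ and $\varphi$ enters through two of its consequences:
$g\varphi$ is skew and $\eta$ is the form dual to $\xi$. *)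
Record ak_structure (C : comNzRingType) (D : 'I_3 -> C -> C) (g gi phi : 'M[C]_3)
    (xi : 'cV[C]_3) (eta : 'rV[C]_3) : Prop := AKStructure {
  ak_gsym : g^T = g;
  ak_ginv : gi *m g = 1%:M;
  ak_phi2 : phi *m phi = - 1%:M + xi *m eta;
  ak_phixi : phi *m xi = 0;
  ak_skew : (g *m phi)^T = - (g *m phi);
  ak_eta : eta = xi^T *m g;
  ak_deta : forall i j, D i (eta 0 j) = D j (eta 0 i);
  ak_dPhi : forall i j k, D i ((g *m phi) j k) + D j ((g *m phi) k i)
      + D k ((g *m phi) i j) =
    (1 + 1) * (eta 0 i * (g *m phi) j k + eta 0 j * (g *m phi) k i
               + eta 0 k * (g *m phi) i j)
}.

Section Contact3.
Variables (C : comNzRingType) (D : 'I_3 -> C -> C) (hf : C).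
Hypothesis HD : dsys D.
Hypothesis hf2 : hf + hf = 1.
Variables (g gi phi : 'M[C]_3) (xi : 'cV[C]_3) (eta : 'rV[C]_3).
Hypothesis AK : ak_structure D g gi phi xi eta.
Let gs := ak_gsym AK.
Let gig := ak_ginv AK.
Let phi2 := ak_phi2 AK.
Let phixi := ak_phixi AK.
Let Fskew := ak_skew AK.
Let etag := ak_eta AK.
Let deta := ak_deta AK.
Let dPhi := ak_dPhi AK.

Variable e : 'I_3 -> 'cV[C]_3.
Hypothesis orth : forall a b, ip g (e a) (e b) = (a == b)%:R.
Hypothesis exi : e it = xi.
Hypothesis ephi : e ix2 = phi *m e ix1.

Let N := nab D hf g gi.
Let hm := hf *: lie D xi phi.
Let h' := hm *m phi.

Lemma frame_expand v : v = \sum_c ip g v (e c) *: e c.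
Proof.
have [E EE E1] := frame_matrix orth.
rewrite -[LHS]mul1mx -E1 -mulmxA; apply/colP => i.
rewrite summxE mxE; apply: eq_bigr => c _; rewrite EE !mxE mulrC; congr (_ * _).
rewrite ipC// /ip mxE; apply: eq_bigr => k _; congr (_ * _).
by rewrite !mxE; apply: eq_bigr => l _; rewrite !mxE EE.
Qed.

Let c a b d := ip g (N (e a) (e b)) (e d).

Fact LN : levi D g N. Proof. exact: nab_levi. Qed.

Fact dir_orth X a b : dir D X (ip g (e a) (e b)) = 0.
Proof. by rewrite orth; case: (a == b); rewrite ?dir1 ?dir0. Qed.

Fact c_anti a b d : c a b d = - c a d b.
Proof.
apply/eqP; rewrite -addr_eq0 /c [X in _ + X]ipC//; apply/eqP.
by rewrite -(levi_metric LN) dir_orth.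
Qed.

Fact c_diag a b : c a b b = 0.
Proof. by apply: (two_inj hf2); rewrite {1}c_anti addNr. Qed.

Fact eta_e a : (eta *m e a) 0 0 = (it == a)%:R.
Proof. by rewrite etag -exi -[LHS]/(ip _ _ _) orth. Qed.

Fact brk_c a b d : ip g (brk D (e a) (e b)) (e d) = c a b d - c b a d.
Proof. by rewrite -(levi_torsion LN) ipDl ipNl. Qed.

(** $d\eta=0$ makes $\nabla\xi$ symmetric. *)
Fact c_sym3 a b : c a b it = c b a it.
Proof.
have := closed_form1 HD (e a) (e b) deta.
rewrite !eta_e.
have d0 X (t : bool) : dir D X t%:R = 0 by case: t; rewrite ?dir0 ?dir1.
rewrite !d0 subrr => E; apply/eqP; rewrite -subr_eq0 -brk_c ipC// exi.
by rewrite -[ip _ _ _]/((xi^T *m g *m _) 0 0) -etag -E.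
Qed.

(** $d\Phi=2\eta\wedge\Phi$ says that the flow of $\xi$ multiplies the area
of the planes orthogonal to it by $e^{2t}$: the divergence of $\xi$ is $2$. *)
Fact c_trace : c ix1 it ix1 + c ix2 it ix2 = 1 + 1.
Proof.
pose F := g *m phi.
have FE U V : ip F U V = ip g U (phi *m V) by rewrite /ip /F !mulmxA.
have phie2 : phi *m e ix2 = - e ix1.
  rewrite ephi mulmxA phi2 mulmxDl mulNmx mul1mx -mulmxA.
  have -> : eta *m e ix1 = 0 by rewrite [LHS]scalar11 eta_e; apply/matrixP => i j; rewrite !mxE mul0rn.
  by rewrite mulmx0 addr0.
have phie3 : phi *m e it = 0 by rewrite exi.
have F12 : ip F (e ix1) (e ix2) = - 1 by rewrite FE phie2 ipNr orth.
have F23 : ip F (e ix2) (e it) = 0 by rewrite FE phie3 ip0r.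
have F31 : ip F (e it) (e ix1) = 0 by rewrite FE -ephi orth.
have := exact2_form HD (e ix1) (e ix2) (e it) Fskew; rewrite -/F F12 F23 F31.
rewrite !FE phie2 phie3 -ephi !ip0r ipNr !(dir0 HD) (dirN HD) (dir1 HD) !brk_c.
have -> : \sum_i \sum_j \sum_k e ix1 i 0 * e ix2 j 0 * e it k 0 *
     (D i (F j k) + D j (F k i) + D k (F i j)) = - (1 + 1).
  transitivity ((1 + 1) * ((eta *m e ix1) 0 0 * ip F (e ix2) (e it) +
     (eta *m e ix2) 0 0 * ip F (e it) (e ix1) + (eta *m e it) 0 0 * ip F (e ix1) (e ix2))).
    rewrite -wedge_eval; apply: eq_bigr => i _; apply: eq_bigr => j _.
    by apply: eq_bigr => k _; rewrite /F dPhi.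
  by rewrite F12 F23 F31 !eta_e/=; ring.
rewrite !c_diag => E.
have -> : c ix1 it ix1 + c ix2 it ix2 = (0 + (c ix2 it ix2 - 0) + - (0 - c ix1 it ix1) + - (1 + 1)) + (1 + 1) by ring.
by rewrite -E; ring.
Qed.

(* with these names, nabla xi = 1 - xi eta + h', where h' has entries p, q, q, - p *)
Let p := c ix1 it ix1 - 1.
Let q := c ix1 it ix2.
Let w := c it ix1 ix2.
Let al := c ix1 ix1 ix2.
Let be := c ix2 ix2 ix1.
Let e1 := e ix1. Let e2 := e ix2. Let e3 := e it.

Fact c_expand a b : N (e a) (e b) = c a b ix1 *: e1 + c a b ix2 *: e2 + c a b it *: e3.
Proof. by rewrite [LHS]frame_expand sum3. Qed.

Fact N13 : N e1 e3 = (1 + p) *: e1 + q *: e2.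
Proof. by rewrite c_expand c_diag scale0r addr0 /p [1 + _]addrC subrK. Qed.
Fact N23 : N e2 e3 = q *: e1 + (1 - p) *: e2.
Proof.
rewrite c_expand c_diag scale0r addr0; congr (_ *: _ + _ *: _).
  by rewrite c_anti c_sym3 c_anti opprK.
by rewrite /p opprB addrA -c_trace addrC addKr.
Qed.
Fact N33 : N e3 e3 = 0.
Proof.
rewrite c_expand c_diag (c_anti _ _ ix1) (c_anti _ _ ix2) !(c_sym3 it) !c_diag.
by rewrite oppr0 !scale0r !addr0.
Qed.
Fact N11 : N e1 e1 = al *: e2 - (1 + p) *: e3.
Proof.
rewrite c_expand c_diag scale0r add0r (c_anti _ _ it) -scaleNr.
by rewrite /p [1 + _]addrC subrK.
Qed.
Fact N12 : N e1 e2 = - al *: e1 - q *: e3.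
Proof. by rewrite c_expand c_diag scale0r addr0 (c_anti _ _ it) (c_anti _ _ ix1) -!scaleNr. Qed.
Fact N21 : N e2 e1 = - be *: e2 - q *: e3.
Proof.
rewrite c_expand c_diag scale0r add0r c_sym3 (c_anti _ _ it) (c_anti _ _ ix2) -!scaleNr//.
Qed.
Fact N22 : N e2 e2 = be *: e1 - (1 - p) *: e3.
Proof.
rewrite c_expand c_diag scale0r addr0 (c_anti _ _ it) -!scaleNr.
by congr (_ + - _ *: _); rewrite /p opprB addrA -c_trace addrC addKr.
Qed.
Fact N31 : N e3 e1 = w *: e2.
Proof. by rewrite c_expand c_diag (c_sym3 it) c_diag !scale0r add0r addr0. Qed.
Fact N32 : N e3 e2 = - w *: e1.
Proof. by rewrite c_expand c_diag (c_sym3 it) c_diag (c_anti _ _ ix1) !scale0r !addr0. Qed.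

Let NE := (N11, N12, N13, N21, N22, N23, N31, N32, N33).

Fact B12 : brk D e1 e2 = - al *: e1 + be *: e2.
Proof. by rewrite -(levi_torsion LN) !NE; apply/colP => i; rewrite !mxE; ring. Qed.
Fact B13 : brk D e1 e3 = (1 + p) *: e1 + (q - w) *: e2.
Proof. by rewrite -(levi_torsion LN) !NE; apply/colP => i; rewrite !mxE; ring. Qed.
Fact B23 : brk D e2 e3 = (q + w) *: e1 + (1 - p) *: e2.
Proof. by rewrite -(levi_torsion LN) !NE; apply/colP => i; rewrite !mxE; ring. Qed.

Fact phi_e2 : phi *m e2 = - e1.
Proof.
rewrite /e2 ephi mulmxA phi2 mulmxDl mulNmx mul1mx -mulmxA.
have -> : eta *m e ix1 = 0 by rewrite [LHS]scalar11 eta_e; apply/matrixP => i j; rewrite !mxE mul0rn.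
by rewrite mulmx0 addr0.
Qed.

Fact hf_double (a : C) : hf * (a + a) = a.
Proof. by rewrite mulrDr -mulrDl hf2 mul1r. Qed.

Fact h'e1 : h' *m e1 = p *: e1 + q *: e2.
Proof.
rewrite /h' -mulmxA -ephi /hm -scalemxAl (lieE HD) -exi -/e2 -/e3 phi_e2.
rewrite [brk D e3 e2]brkC [brk D e3 (- e1)]/brk (dirmN HD).
have -> : - dirm D e3 e1 - dirm D (- e1) e3 = brk D e1 e3.
  have -> : dirm D (- e1) e3 = - dirm D e1 e3 by rewrite -(scaleN1r e1) dirmZl scaleN1r.
  by rewrite opprK addrC.
rewrite B13 B23 mulmxN mulmxDr -!scalemxAr phi_e2 -ephi -/e2.
apply/colP => i; rewrite !mxE -[RHS]hf_double; congr (_ * _); ring.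
Qed.
Fact h'e2 : h' *m e2 = q *: e1 - p *: e2.
Proof.
rewrite /h' -mulmxA phi_e2 mulmxN /hm -scalemxAl (lieE HD) -exi -/e3 -ephi -/e2.
rewrite [brk D e3 e2]brkC [brk D e3 e1]brkC B13 B23.
rewrite mulmxN mulmxDr -!scalemxAr phi_e2 -ephi -/e2.
apply/colP => i; rewrite !mxE -[RHS]hf_double -mulrN; congr (_ * _); ring.
Qed.
Fact h'e3 : h' *m e3 = 0.
Proof. by rewrite /h' -mulmxA /e3 exi phixi mulmx0. Qed.

Variables kappa mu : C.
Let R := curv D hf g gi.
Hypothesis kmu : forall X Y, R X Y xi =
  kappa *: ((eta *m Y) 0 0 *: X - (eta *m X) 0 0 *: Y)
  + mu *: ((eta *m Y) 0 0 *: (h' *m X) - (eta *m X) 0 0 *: (h' *m Y)).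

Fact e_indep a b d : a *: e1 + b *: e2 + d *: e3 = 0 -> [/\ a = 0, b = 0 & d = 0].
Proof.
move=> E.
have H (v : 'cV[C]_3) : ip g (a *: e1 + b *: e2 + d *: e3) v = 0 by rewrite E ip0l.
split; [have := H e1|have := H e2|have := H e3];
  rewrite !(ipDl, ipZl) !orth /=; rewrite !(mulr0, mulr1, addr0, add0r); done.
Qed.

Fact curv13 : R e1 e3 e3 = - (dir D e3 p - (q * w + q * w) + 1 + (p + p) + p * p + q * q) *: e1
  - (dir D e3 q + (p * w + p * w) + (q + q)) *: e2.
Proof.
rewrite /R /curv -/N N33 N13 B13 /N (nab0r HD) (nabDr HD) !(nabZr HD) nabDl !nabZl -/N !NE.
by rewrite (dirD HD) (dir1 HD); apply/colP => i; rewrite !mxE; ring.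
Qed.
Fact curv23 : R e2 e3 e3 = - (dir D e3 q + (p * w + p * w) + (q + q)) *: e1
  - (- dir D e3 p + (q * w + q * w) + 1 - (p + p) + p * p + q * q) *: e2.
Proof.
rewrite /R /curv -/N N33 N23 B23 /N (nab0r HD) (nabDr HD) !(nabZr HD) nabDl !nabZl -/N !NE.
by rewrite (dirD HD) (dirN HD) (dir1 HD); apply/colP => i; rewrite !mxE; ring.
Qed.

Fact kmu13 : R e1 e3 e3 = (kappa + mu * p) *: e1 + (mu * q) *: e2.
Proof.
rewrite /e1 /e3 exi kmu -exi !eta_e/= -/e1 -/e2 -/e3 h'e1 h'e3.
by apply/colP => i; rewrite !mxE; ring.
Qed.
Fact kmu23 : R e2 e3 e3 = (mu * q) *: e1 + (kappa - mu * p) *: e2.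
Proof.
rewrite /e2 /e3 exi kmu -exi !eta_e/= -/e1 -/e2 -/e3 h'e2 h'e3.
by apply/colP => i; rewrite !mxE; ring.
Qed.

Fact coef2 a b a' b' : a *: e1 + b *: e2 = a' *: e1 + b' *: e2 -> a = a' /\ b = b'.
Proof.
move=> E; have : (a - a') *: e1 + (b - b') *: e2 + 0 *: e3 = 0.
  rewrite scale0r addr0 !scalerBl addrACA -opprD E; exact: subrr.
by move=> /e_indep[/subr0_eq -> /subr0_eq ->].
Qed.

Fact eq13 : - (dir D e3 p - (q * w + q * w) + 1 + (p + p) + p * p + q * q) = kappa + mu * p
  /\ - (dir D e3 q + (p * w + p * w) + (q + q)) = mu * q.
Proof. by apply: coef2; rewrite -kmu13 curv13 !scaleNr. Qed.
Fact eq23 : - (dir D e3 q + (p * w + p * w) + (q + q)) = mu * q /\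
  - (- dir D e3 p + (q * w + q * w) + 1 - (p + p) + p * p + q * q) = kappa - mu * p.
Proof. by apply: coef2; rewrite -kmu23 curv23 !scaleNr. Qed.

(** The trace over $e_1,e_2$ of the curvature condition: the terms with $\mu$
and with derivatives cancel. *)
Lemma kappa_pq : p * p + q * q = - 1 - kappa.
Proof.
have [E1 _] := eq13; have [_ E2] := eq23.
apply: subr0_eq; apply: (two_inj hf2).
have -> : (p * p + q * q - (-1 - kappa)) + (p * p + q * q - (-1 - kappa)) =
  (kappa + mu * p + (dir D e3 p - (q * w + q * w) + 1 + (p + p) + p * p + q * q)) +
  (kappa - mu * p + (- dir D e3 p + (q * w + q * w) + 1 - (p + p) + p * p + q * q)) by ring.
by rewrite -E1 -E2; ring.
Qed.

Lemma h'_frame_kappa : exists p q : C,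
  [/\ h' *m e ix1 = p *: e ix1 + q *: e ix2,
      h' *m e ix2 = q *: e ix1 - p *: e ix2, h' *m e it = 0 &
      p * p + q * q = - 1 - kappa].
Proof. by exists p, q; split; [exact: h'e1|exact: h'e2|exact: h'e3|exact: kappa_pq]. Qed.

(** In a frame of eigenvectors of $h'$ the connection has no other coefficients
than those of $\nabla\xi$, because $\lambda$ is constant along the first two
vectors and invertible. *)
Theorem eigenframe_brackets (lam lami : C) : lam * lami = 1 ->
  h' *m e ix1 = lam *: e ix1 ->
  dir D (e ix1) lam = 0 -> dir D (e ix2) lam = 0 ->
  [/\ dir D (e it) lam = - (mu + 1 + 1) * lam,
      brk D (e ix1) (e ix2) = 0,
      brk D (e ix1) (e it) = (1 + lam) *: e ix1 &
      brk D (e ix2) (e it) = (1 - lam) *: e ix2].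
Proof.
move=> ll he1 d1 d2.
have [pl q0] : p = lam /\ q = 0.
  by apply: coef2; rewrite -h'e1 he1 scale0r addr0.
have [E1 E2] := eq13; have K := kappa_pq.
rewrite q0 pl in E1 E2 K.
have lamI (a : C) : lam * a = 0 -> a = 0.
  by move=> la; rewrite -[a]mul1r -ll mulrAC la mul0r.
have w0 : w = 0.
  apply: (two_inj hf2); apply: lamI; apply: oppr_inj; rewrite oppr0 mulrDr.
  by move: E2; rewrite (dir0 HD) mulr0 !add0r !addr0.
have d3 : dir D e3 lam = - (mu + 1 + 1) * lam.
  have -> : dir D e3 lam = - (kappa + mu * lam) - (1 + (lam + lam) + (lam * lam + 0 * 0)).
    by rewrite -E1; ring.
  by rewrite K; ring.
have R12 : R e1 e2 e3 = (lam * al + lam * al - dir D e2 lam) *: e1 +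
    (dir D e1 (1 - lam) + (lam * be + lam * be)) *: e2.
  rewrite /R /curv -/N N13 N23 B12 /N !(nabDr HD) !(nabZr HD) nabDl !nabZl -/N !NE q0 pl.
  rewrite !(dirD HD) !(dirN HD) !(dir1 HD) !(dir0 HD).
  by apply/colP => i; rewrite !mxE; ring.
have R0 : R e1 e2 e3 = 0.
  by rewrite /e1 /e2 /e3 exi kmu !eta_e/= !scale0r !subrr !scaler0 addr0.
have [al0 be0] : lam * al + lam * al - dir D e2 lam = 0 /\
    dir D e1 (1 - lam) + (lam * be + lam * be) = 0.
  by apply: coef2; rewrite -R12 R0 !scale0r addr0.
have al00 : al = 0.
  by move: al0; rewrite /e2 d2 subr0 => /(two_inj hf2)/lamI.
have be00 : be = 0.
  by move: be0; rewrite (dirD HD) (dirN HD) (dir1 HD) /e1 d1 oppr0 addr0 add0r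
    => /(two_inj hf2)/lamI.
split => //.
- by rewrite B12 al00 be00 oppr0 !scale0r addr0.
- by rewrite B13 q0 w0 pl subr0 scale0r addr0.
- by rewrite B23 q0 w0 pl addr0 scale0r add0r.
Qed.

(** Since the brackets only stretch $e_1,e_2$ along $\xi$, a dual $1$-form
becomes closed once it is divided by a function that grows at the same rate. *)
Lemma coframe_closed (k : 'I_3) (lam a ai : C) : k != it ->
  brk D (e ix1) (e ix2) = 0 ->
  brk D (e ix1) (e it) = (1 + lam) *: e ix1 ->
  brk D (e ix2) (e it) = (1 - lam) *: e ix2 ->
  a * ai = 1 -> dir D (e ix1) a = 0 -> dir D (e ix2) a = 0 ->
  dir D (e it) a = (if k == ix1 then 1 + lam else 1 - lam) * a ->
  let th := ai *: ((e k)^T *m g) in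
  forall i j, D i (th 0 j) = D j (th 0 i).
Proof.
move=> kt b12 b13 b23 aai a1 a2 a3 th.
have dai X : dir D X ai = - (ai * (ai * dir D X a)).
  have : dir D X (a * ai) = 0 by rewrite aai (dir1 HD).
  rewrite (dirM HD) => E.
  have -> : dir D X ai = ai * (dir D X a * ai + a * dir D X ai) - ai * (ai * dir D X a)
     + (1 - a * ai) * dir D X ai by ring.
  by rewrite E aai; ring.
have the b : (th *m e b) 0 0 = ai * (k == b)%:R by rewrite /th -scalemxAl mxE -orth.
have thv v : (th *m v) 0 0 = ai * ip g (e k) v by rewrite /th -scalemxAl mxE.
have d0 X (t : bool) : dir D X t%:R = 0 by case: t; rewrite ?dir0 ?dir1.
apply: (frame_closed HD orth gs) => b d.
rewrite !the !(dirM HD) !d0 !mulr0 !addr0 thv.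
have ai1 : dir D (e ix1) ai = 0 by rewrite dai a1 !mulr0 oppr0.
have ai2 : dir D (e ix2) ai = 0 by rewrite dai a2 !mulr0 oppr0.
have ai3 : dir D (e it) ai = - ((if k == ix1 then 1 + lam else 1 - lam) * ai).
  rewrite dai a3; set s := if _ then _ else _.
  have -> : - (ai * (ai * (s * a))) = - (s * ai) * (a * ai) by ring.
  by rewrite aai mulr1.
have brr (X : 'cV[C]_3) : brk D X X = 0 by rewrite /brk subrr.
case: (ord3P k) kt ai3 => -> // _ ai3;
  case: (ord3P b) => ->; case: (ord3P d) => ->;
  rewrite ?brr ?b12 ?b13 ?b23 ?[brk D (e ix2) (e ix1)]brkC ?[brk D (e it) _]brkC
    ?b12 ?b13 ?b23 ?ai1 ?ai2 ?ai3 /= ?(ipNr, ipZr) ?orth /= ?oppr0 ?ip0r; ring.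
Qed.

End Contact3.

(** * Structures that depend on one coordinate only *)

Section FrameChange.
Variables (C : comNzRingType) (n : nat) (D : 'I_n -> C -> C).
Hypothesis HD : dsys D.
Variable E : 'M[C]_n.
Hypothesis Ebrk : forall a b, brk D (col a E) (col b E) = 0.

(** Derivatives along a commuting frame obey the same rules as partial
derivatives: the frame may be treated as a coordinate frame. *)
Definition dframe (a : 'I_n) (f : C) : C := dir D (col a E) f.

Lemma dframe_dsys : dsys dframe.
Proof.
split=> [a f g|a f g|a b f]; rewrite /dframe.
- exact: dirD.
- exact: dirM.
- by apply/eqP; rewrite -subr_eq0 -(dir_brk HD) Ebrk -(scale0r 0) (dirZl D) mul0r.
Qed.

Lemma dir_frame X f : dir D (E *m X) f = dir dframe X f.
Proof.
rewrite /dir /dframe.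
transitivity (\sum_i \sum_a E i a * X a 0 * D i f).
  by apply: eq_bigr => i _; rewrite mxE mulr_suml.
rewrite exchange_big/=; apply: eq_bigr => a _; rewrite /dir mulr_sumr.
by apply: eq_bigr => i _; rewrite mxE; ring.
Qed.

Lemma dirm_frame X a b (M : 'M[C]_(a, b)) : dirm D (E *m X) M = dirm dframe X M.
Proof. by apply/matrixP => i j; rewrite !mxE dir_frame. Qed.

Lemma brk_frame X Y : brk D (E *m X) (E *m Y) = E *m brk dframe X Y.
Proof.
rewrite /brk !(dirmM HD) !dirm_frame mulmxBr opprD addrACA.
suff -> : dirm dframe X E *m Y - dirm dframe Y E *m X = 0 by rewrite add0r.
apply/colP => i; rewrite !mxE.
transitivity (\sum_b \sum_a X a 0 * Y b 0 * (brk D (col a E) (col b E)) i 0).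
  transitivity (\sum_b \sum_a X a 0 * Y b 0 * dir D (col a E) (E i b) -
                \sum_a \sum_b X a 0 * Y b 0 * dir D (col b E) (E i a)).
    have dE X0 b : dir dframe X0 (E i b) = \sum_a X0 a 0 * dir D (col a E) (E i b) by [].
    congr (_ - _); apply: eq_bigr => b _; rewrite mxE dE mulr_suml;
      by apply: eq_bigr => a _; ring.
  rewrite [X in _ - X]exchange_big -sumrB; apply: eq_bigr => b _.
  by rewrite -sumrB; apply: eq_bigr => a _; rewrite !mxE; ring.
by rewrite big1// => b _; rewrite big1// => a _; rewrite Ebrk mxE mulr0.
Qed.

End FrameChange.

Section Adapted.
Variables (C : comNzRingType) (D : 'I_3 -> C -> C) (hf : C).
Hypothesis HD : dsys D.
Hypothesis hf2 : hf + hf = 1.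
Variables (E Ei : 'M[C]_3).
Hypothesis EiE : Ei *m E = 1%:M.
Hypothesis Ebrk : forall a b, brk D (col a E) (col b E) = 0.
Variables (P H B G J : 'M[C]_3) (ex l2 mu : C).
Let d := dframe D E.
Let xi : 'cV[C]_3 := delta_mx it 0.
Let eta : 'rV[C]_3 := delta_mx 0 it.
Hypothesis dP : forall a, map_mx (d a) P = (a == it)%:R *: (H + H).
Hypothesis dB : forall a, map_mx (d a) B = (a == it)%:R *: (- (mu + 1 + 1) *: B).
Hypothesis dex : forall a, d a ex = (a == it)%:R * (ex + ex).
Hypothesis dJ : forall a, map_mx (d a) J = 0.
Hypothesis GP : G *m P = ex *: J.
Hypothesis P2 : P *m P = - 1%:M + xi *m eta.
Hypothesis BHP : B = H *m P.
Hypothesis Bxi : B *m xi = 0.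
Hypothesis etaB : eta *m B = 0.
Hypothesis B2 : B *m B = l2 *: (1%:M - xi *m eta).
Hypothesis Gs : G^T = G.
Hypothesis Gxi : G *m xi = xi.

(* A is nabla xi, the second fundamental form of the slices t = const *)
Let A := 1%:M - xi *m eta + B.
Let EEi : E *m Ei = 1%:M. Proof. exact: mulmx1C. Qed.
Let Hd : dsys d. Proof. exact: dframe_dsys. Qed.

Lemma dir_map X a b (M M' : 'M[C]_(a, b)) :
  (forall i, map_mx (d i) M = (i == it)%:R *: M') -> dirm d X M = X it 0 *: M'.
Proof.
move=> HM; apply/matrixP => i j; rewrite !mxE /dir (bigD1 it)//= big1 ?addr0.
  by have /matrixP/(_ i j) := HM it; rewrite !mxE eqxx mul1r => ->.
by move=> k /negPf kt; have /matrixP/(_ i j) := HM k; rewrite !mxE kt mul0r => ->; rewrite mulr0.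
Qed.

Fact etaxi : eta *m xi = 1%:M.
Proof.
by rewrite mul_delta_mx; apply/matrixP => i j; rewrite !ord1 !mxE.
Qed.

Fact eta_entry (X : 'cV[C]_3) : eta *m X = (X it 0)%:M.
Proof. by rewrite -rowE; apply/matrixP => i j; rewrite !ord1 !mxE. Qed.

Fact Axi : A *m xi = 0.
Proof. by rewrite /A !mulmxDl mulNmx mul1mx -mulmxA etaxi mulmx1 subrr Bxi addr0. Qed.

Fact etaA : eta *m A = 0.
Proof. by rewrite /A !mulmxDr mulmxN mulmx1 mulmxA etaxi mul1mx subrr etaB addr0. Qed.

Fact dir_xi X : dirm d X xi = 0.
Proof. exact: (dirm_delta Hd). Qed.

Fact dir_eta X : dirm d X eta = 0.
Proof. by apply/matrixP => i j; rewrite !mxE; case: (_ && _); rewrite ?(dir0 Hd) ?(dir1 Hd). Qed.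

(** Differentiating $GP = e^{2t}J$ gives the derivative of the metric. *)
Fact dG X : dirm d X G = X it 0 *: (G *m A + G *m A).
Proof.
have E1 : dirm d X (G *m P) = X it 0 *: (G *m P + G *m P).
  rewrite GP (dirmZ Hd).
  have -> : dirm d X J = 0.
    by rewrite (@dir_map X _ _ J 0) ?scaler0// => i; rewrite dJ scaler0.
  have -> : dir d X ex = X it 0 * (ex + ex).
    rewrite /dir (bigD1 it)//= dex eqxx mul1r big1 ?addr0// => k /negPf kt.
    by rewrite dex kt mul0r mulr0.
  by rewrite scaler0 addr0 -scalerA scalerDl.
have E2 : dirm d X G *m P = X it 0 *: (G *m P + G *m P - G *m (H + H)).
  rewrite scalerBr -E1 (dirmM Hd) (dir_map X dP) -scalemxAr addrK//.
have : dirm d X G *m P *m P = X it 0 *: (G *m P + G *m P - G *m (H + H)) *m P by rewrite E2.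
rewrite -mulmxA P2 mulmxDr mulmxN mulmx1 mulmxA.
have -> : dirm d X G *m xi = 0.
  have : dirm d X (G *m xi) = 0 by rewrite Gxi dir_xi.
  by rewrite (dirmM Hd) dir_xi mulmx0 addr0.
rewrite mul0mx addr0 => /eqP; rewrite eqr_oppLR => /eqP ->.
rewrite -scalemxAl -scalerN; congr (_ *: _).
rewrite !(mulNmx, mulmxDl) -!mulmxA P2 mulmxDl -BHP -!mulmxDr -mulmxBr -mulmxN.
congr (G *m _); rewrite /A.
by move: (xi *m eta) => Z; apply/matrixP => i j; rewrite !mxE; ring.
Qed.

Fact GAsym X Y : ip G (A *m X) Y = ip G X (A *m Y).
Proof.
have GA : (G *m A)^T = G *m A.
  have := dG xi; rewrite mxE !eqxx scale1r => E1.
  have E2 : (G *m A)^T + (G *m A)^T = G *m A + G *m A.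
    rewrite -linearD/= -E1; apply/matrixP => i j; rewrite !mxE.
    by rewrite -[in G j i]Gs mxE.
  apply/matrixP => i j; apply: subr0_eq; apply: (two_inj hf2).
  have /matrixP/(_ i j) := E2; rewrite !mxE => E3.
  by rewrite addrACA E3 -opprD subrr.
have : A^T *m G = G *m A by rewrite -GA trmx_mul Gs.
by rewrite /ip trmx_mul -!mulmxA => E1; rewrite [A^T *m _]mulmxA E1 -!mulmxA.
Qed.

(* the Levi-Civita connection of dt^2 + g_ij(t) dx_i dx_j, by the Gauss formula *)
Let N0 (X Y : 'cV[C]_3) : 'cV[C]_3 :=
  dirm d X Y + (Y it 0 *: (A *m X) + X it 0 *: (A *m Y)) - ip G (A *m X) Y *: xi.

Fact ip_xi X : ip G xi X = X it 0.
Proof.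
rewrite /ip; have -> : xi^T *m G = eta by rewrite -[G]Gs -trmx_mul Gxi trmx_delta.
by rewrite eta_entry mxE eqxx.
Qed.

Fact N0_levi : levi d G N0.
Proof.
split=> [X Y|X Y Z].
  rewrite /N0 /brk (GAsym Y X) (ipC Y)//; do ?[move: (dirm _ _ _) => ?].
  by apply/colP => i; rewrite !mxE; ring.
rewrite (dir_ip Hd) dG /N0.
rewrite !(ipDl, ipDr, ipNl, ipNr, ipZl, ipZr) ip_xi (ipC Y xi)// ip_xi.
have -> : ip (X it 0 *: (G *m A + G *m A)) Y Z =
    X it 0 * (ip G Y (A *m Z) + ip G Y (A *m Z)).
  rewrite /ip -scalemxAr -scalemxAl mxE; congr (_ * _).
  by rewrite mulmxDr mulmxDl mxE !mulmxA.
rewrite (GAsym Y Z) (ipC Y (A *m X))//; ring.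
Qed.

Let g := Ei^T *m G *m Ei.
Let phi := E *m P *m Ei.
Variable gi : 'M[C]_3.
Hypothesis gig : gi *m g = 1%:M.
Let N X Y := E *m N0 (Ei *m X) (Ei *m Y).

Fact gsym : g^T = g.
Proof. by rewrite /g !trmx_mul trmxK Gs mulmxA. Qed.

Fact ip_g X Y : ip g X Y = ip G (Ei *m X) (Ei *m Y).
Proof. by rewrite /ip /g trmx_mul !mulmxA. Qed.

Fact N_levi : levi D g N.
Proof.
split=> [X Y|X Y Z]; rewrite /N.
  rewrite -mulmxBr (levi_torsion N0_levi) -(brk_frame HD Ebrk).
  by rewrite !mulmxA EEi !mul1mx.
rewrite !ip_g !mulmxA EiE !mul1mx -(levi_metric N0_levi) -dir_frame.
by rewrite mulmxA EEi mul1mx.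
Qed.

Fact nab_adapted X Y : nab D hf g gi X Y = N X Y.
Proof. exact: (levi_unique hf2 X Y gsym gig (nab_levi HD hf2 gsym gig) N_levi). Qed.

Fact N0_xi X : N0 X xi = A *m X.
Proof.
rewrite /N0 dir_xi add0r Axi scaler0 addr0 mxE !eqxx scale1r.
rewrite ipC// ip_xi.
have -> : (A *m X) it 0 = 0.
  by have := eta_entry (A *m X); rewrite mulmxA etaA mul0mx => /matrixP/(_ 0 0); rewrite !mxE.
by rewrite scale0r subr0.
Qed.

Fact A2 : A *m A = (1 + l2) *: (1%:M - xi *m eta) + B + B.
Proof.
have Pr2 : (1%:M - xi *m eta) *m (1%:M - xi *m eta) = 1%:M - xi *m eta.
  rewrite mulmxBl mul1mx mulmxBr mulmx1 -!mulmxA [eta *m (xi *m eta)]mulmxA etaxi mul1mx.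
  by rewrite subrr subr0.
have PB : (1%:M - xi *m eta) *m B = B by rewrite mulmxBl mul1mx -mulmxA etaB mulmx0 subr0.
have BP : B *m (1%:M - xi *m eta) = B by rewrite mulmxBr mulmx1 mulmxA Bxi mul0mx subr0.
have B2' := B2; move: Pr2 PB BP B2'; rewrite /A; move: (1%:M - xi *m eta) => Z ZZ ZB BZ BB.
rewrite mulmxDl !mulmxDr ZZ ZB BZ BB scalerDl scale1r.
by apply/matrixP => i j; rewrite !mxE; ring.
Qed.

Fact dA X : dirm d X A = X it 0 *: (- (mu + 1 + 1) *: B).
Proof.
rewrite /A (dirmD Hd) (dirmD Hd) (dirmN Hd) (dirm1 Hd) (dirmM Hd) dir_xi dir_eta.
by rewrite mul0mx mulmx0 addr0 subr0 add0r (dir_map X dB).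
Qed.

Fact N0_A X Y : N0 X (A *m Y) =
  X it 0 *: (((1 + l2) *: (1%:M - xi *m eta) - mu *: B) *m Y) + A *m dirm d X Y
  - ip G (A *m X) (A *m Y) *: xi.
Proof.
rewrite /N0 (dirmM Hd) dA.
have -> : (A *m Y) it 0 = 0.
  by have := eta_entry (A *m Y); rewrite mulmxA etaA mul0mx => /matrixP/(_ 0 0); rewrite !mxE.
have AA : A *m (A *m Y) = ((1 + l2) *: (1%:M - xi *m eta) + B + B) *m Y by rewrite mulmxA A2.
rewrite scale0r add0r AA; move: (1%:M - xi *m eta) => Z.
move: (A *m dirm d X Y) (ip _ _ _) => u v.
rewrite !(mulmxDl, mulNmx) -!scalemxAl; move: (Z *m Y) (B *m Y) => z b.
by apply/colP => i; rewrite !mxE; ring.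
Qed.

(** As $\nabla\xi=A$, the curvature $R(X,Y)\xi$ is made of $A^2$ and of the
derivative of $A$ along $\xi$. The first is $(1+\lambda^2)(1-\xi\eta)+2h'$ and the
second is $-(\mu+2)h'$, which leaves $-\kappa$ and $-\mu$. *)
Theorem adapted_curv X Y : curv D hf g gi X Y (E *m xi) =
  (- 1 - l2) *: ((eta *m Ei *m Y) 0 0 *: X - (eta *m Ei *m X) 0 0 *: Y)
  + mu *: ((eta *m Ei *m Y) 0 0 *: (E *m B *m Ei *m X)
           - (eta *m Ei *m X) 0 0 *: (E *m B *m Ei *m Y)).
Proof.
move XE : (Ei *m X) => X'; move YE : (Ei *m Y) => Y'.
have {XE}-> : X = E *m X' by rewrite -XE mulmxA EEi mul1mx.
have {YE}-> : Y = E *m Y' by rewrite -YE mulmxA EEi mul1mx.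
have eE (Z : 'cV[C]_3) : (eta *m Ei *m (E *m Z)) 0 0 = Z it 0.
  by rewrite -mulmxA (mulmxA Ei) EiE mul1mx eta_entry mxE eqxx.
have BE (Z : 'cV[C]_3) : E *m B *m Ei *m (E *m Z) = E *m (B *m Z).
  by rewrite -!mulmxA (mulmxA Ei) EiE mul1mx.
have NE U V : nab D hf g gi (E *m U) (E *m V) = E *m N0 U V.
  by rewrite nab_adapted /N !(mulmxA Ei E) EiE !mul1mx.
rewrite /curv (brk_frame HD Ebrk) !NE !N0_xi -!mulmxBr !eE !BE.
rewrite !scalemxAr -!mulmxBr !scalemxAr -mulmxDr.
congr (E *m _); rewrite !N0_A /brk mulmxBr (ipC (A *m X'))//.
move: (A *m dirm d X' Y') (A *m dirm d Y' X') (ip _ _ _) => a b s.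
rewrite !(mulmxDl, mulNmx) -!scalemxAl !(mulmxDl, mulNmx) !mul1mx -!mulmxA !eta_entry.
have xis (t : C) : xi *m (t%:M : 'M[C]_1) = t *: xi by rewrite mul_mx_scalar.
rewrite !xis.
rewrite -scalemxAr mulmxBr -!scalemxAr.
move: (B *m X') (B *m Y') => u v.
by apply/colP => i; rewrite !mxE; ring.
Qed.

(** $L_\xi$ is $\partial_t$ on components. *)
Theorem adapted_h' : hf *: lie D (E *m xi) phi *m phi = E *m B *m Ei.
Proof.
have L : lie D (E *m xi) phi = E *m (H + H) *m Ei.
  rewrite -[LHS]mulmx1 -EEi mulmxA; congr (_ *m _).
  suff S (Y : 'cV[C]_3) : lie D (E *m xi) phi *m (E *m Y) = E *m (H + H) *m Y.
    apply/matrixP => i j.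
    have := S (delta_mx j 0); rewrite mulmxA -!colE => /colP/(_ i).
    by rewrite !mxE.
  rewrite (lieE HD).
  have -> : phi *m (E *m Y) = E *m (P *m Y) by rewrite /phi -!mulmxA (mulmxA Ei E) EiE mul1mx.
  rewrite !(brk_frame HD Ebrk) /phi -!mulmxA (mulmxA Ei E) EiE mul1mx -mulmxBr.
  congr (E *m _); rewrite /brk !dir_xi !subr0 (dirmM Hd) addrK (dir_map xi dP).
  by rewrite mxE !eqxx scale1r.
rewrite L /phi -scalemxAl -!mulmxA (mulmxA Ei E) EiE mul1mx (mulmxA (H + H)) mulmxDl -BHP.
rewrite scalemxAr scalemxAl; congr (E *m (_ *m _)).
by rewrite scalerDr -scalerDl hf2 scale1r.
Qed.

End Adapted.

(** * The ring of smooth functions on an open set *)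

(** The domain is inhabited, because $1\neq0$ is required in the ring. *)
Record sdom (R : realType) (n : nat) := Sdom {
  dset :> 'rV[R]_n -> Prop;
  dset_open : open (dset : set 'rV[R]_n);
  dset_pt : exists x, dset x
}.

Arguments dset_open {R n} s.

(** The functions vanish outside the domain, so that equality of ring elements
is equality on the domain. *)
Record smo (R : realType) (n : nat) (U : sdom R n) := Smo {
  smo_val :> 'rV[R]_n -> R;
  smo_smooth : smooth_on (dset U) smo_val;
  smo_out : forall x, ~ U x -> smo_val x = 0
}.

Section SmoothRing.
Variables (R : realType) (n : nat) (U : sdom R n).
Implicit Types f g : smo U.

Let oU : open (dset U) := dset_open U.

Lemma smoP f g : (forall x, U x -> f x = g x) -> f = g.
Proof.
case: f g => [f fs fo] [g gs go] /= fg.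
have E : f = g.
  apply/funext => x; have [Ux|Ux] := pselect (U x); first exact: fg.
  by rewrite fo// go.
by subst g; congr Smo; exact: Prop_irrelevance.
Qed.

Definition cutoff (f : 'rV[R]_n -> R) (x : 'rV[R]_n) : R :=
  if pselect (U x) then f x else 0.

Lemma cutoffE (u : 'rV[R]_n -> R) x : U x -> cutoff u x = u x.
Proof. by rewrite /cutoff; case: pselect. Qed.

Lemma cutoff_out (u : 'rV[R]_n -> R) x : ~ U x -> cutoff u x = 0.
Proof. by rewrite /cutoff; case: pselect. Qed.

Lemma cutoff_smooth (u : 'rV[R]_n -> R) : smooth_on (dset U) u -> smooth_on (dset U) (cutoff u).
Proof.
by move=> fs k; apply: Ck_on_eq (fs k) => // x Ux; rewrite cutoffE.
Qed.

Definition mkS (u : 'rV[R]_n -> R) (us : smooth_on (dset U) u) : smo U :=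
  Smo (cutoff_smooth us) (@cutoff_out u).

Lemma smooth_cst (a : R) : smooth_on (dset U) (fun=> a).
Proof. by move=> k; exact: Ck_on_cst. Qed.
Lemma smoothD f g : smooth_on (dset U) (fun x => f x + g x).
Proof. by move=> k; apply: Ck_onD => //; exact: smo_smooth. Qed.
Lemma smoothN f : smooth_on (dset U) (fun x => - f x).
Proof. by move=> k; apply: Ck_onN => //; exact: smo_smooth. Qed.
Lemma smoothM f g : smooth_on (dset U) (fun x => f x * g x).
Proof. by move=> k; apply: Ck_onM => //; exact: smo_smooth. Qed.

Definition cstS (a : R) := mkS (smooth_cst a).
Definition addS f g := mkS (smoothD f g).
Definition oppS f := mkS (smoothN f).
Definition mulS f g := mkS (smoothM f g).
Definition derS (i : 'I_n) f := mkS (smooth_pd i (smo_smooth f)).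

HB.instance Definition _ := gen_eqMixin (smo U).
HB.instance Definition _ := gen_choiceMixin (smo U).

Fact addSA : associative addS.
Proof. by move=> f g h; apply: smoP => x Ux; rewrite /= !cutoffE// addrA. Qed.
Fact addSC : commutative addS.
Proof. by move=> f g; apply: smoP => x Ux; rewrite /= !cutoffE// addrC. Qed.
Fact add0S : left_id (cstS 0) addS.
Proof. by move=> f; apply: smoP => x Ux; rewrite /= !cutoffE// add0r. Qed.
Fact addNS : left_inverse (cstS 0) oppS addS.
Proof. by move=> f; apply: smoP => x Ux; rewrite /= !cutoffE// addNr. Qed.
HB.instance Definition _ := GRing.isZmodule.Build (smo U) addSA addSC add0S addNS.

Fact mulSA : associative mulS.
Proof. by move=> f g h; apply: smoP => x Ux; rewrite /= !cutoffE// mulrA. Qed.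
Fact mulSC : commutative mulS.
Proof. by move=> f g; apply: smoP => x Ux; rewrite /= !cutoffE// mulrC. Qed.
Fact mul1S : left_id (cstS 1) mulS.
Proof. by move=> f; apply: smoP => x Ux; rewrite /= !cutoffE// mul1r. Qed.
Fact mulSDl : left_distributive mulS +%R.
Proof. by move=> f g h; apply: smoP => x Ux; rewrite /= !cutoffE// mulrDl. Qed.
Fact oneS_neq0 : cstS 1 != 0.
Proof.
have [x Ux] := dset_pt U.
apply/eqP => /(congr1 (fun f : smo U => f x)); rewrite /= !cutoffE// => /eqP.
by rewrite oner_eq0.
Qed.
HB.instance Definition _ := GRing.Zmodule_isComNzRing.Build (smo U)
  mulSA mulSC mul1S mulSDl oneS_neq0.

Lemma evD f g x : (f + g : smo U) x = f x + g x.
Proof.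
have [Ux|Ux] := pselect (U x); first by rewrite /= cutoffE.
by rewrite !smo_out// addr0.
Qed.
Lemma ev0 x : (0 : smo U) x = 0.
Proof. by rewrite /= /cutoff; case: pselect. Qed.
Lemma evN f x : (- f : smo U) x = - f x.
Proof.
have [Ux|Ux] := pselect (U x); first by rewrite /= cutoffE.
by rewrite !smo_out// oppr0.
Qed.
Lemma evM f g x : (f * g : smo U) x = f x * g x.
Proof.
have [Ux|Ux] := pselect (U x); first by rewrite /= cutoffE.
by rewrite !smo_out// mulr0.
Qed.
Lemma ev_sum (I : Type) (r : seq I) (P : pred I) (F : I -> smo U) x :
  (\sum_(i <- r | P i) F i) x = \sum_(i <- r | P i) F i x.
Proof.
by apply: (big_morph (fun f : smo U => f x)) => [f g|]; rewrite ?evD ?ev0.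
Qed.
Lemma ev1 x : U x -> (1 : smo U) x = 1.
Proof. by move=> Ux; rewrite /= cutoffE. Qed.
Lemma ev_cst a x : U x -> cstS a x = a.
Proof. by move=> Ux; rewrite /= cutoffE. Qed.
Lemma ev_der i f x : U x -> derS i f x = pd i f x.
Proof. by move=> Ux; rewrite /= cutoffE. Qed.
Lemma ev_nat (k : nat) x : U x -> (k%:R : smo U) x = k%:R.
Proof.
by move=> Ux; elim: k => [|k IH]; rewrite ?ev0// !mulrS evD ev1// IH.
Qed.

Definition evE := (evD, evN, evM, ev0).

Lemma derS_dsys : dsys derS.
Proof.
split=> [i f g|i f g|i j f]; apply: smoP => x Ux; rewrite ?evE !ev_der//.
- rewrite (@pd_eq _ _ (dset U) i _ (fun y => f y + g y))//; last by move=> y _; rewrite evD.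
  have df := Ck_on_is_derive i (@smo_smooth _ _ _ f 1%N) Ux.
  have dg := Ck_on_is_derive i (@smo_smooth _ _ _ g 1%N) Ux.
  by rewrite pdE; have [_] := is_deriveD df dg.
- rewrite (@pd_eq _ _ (dset U) i _ (fun y => f y * g y))//; last by move=> y _; rewrite evM.
  have df := Ck_on_is_derive i (@smo_smooth _ _ _ f 1%N) Ux.
  have dg := Ck_on_is_derive i (@smo_smooth _ _ _ g 1%N) Ux.
  rewrite pdE; have [_ ->] := is_deriveM df dg.
  by rewrite addrC; congr (_ + _); rewrite [LHS]mulrC.
- rewrite (@pd_eq _ _ (dset U) i _ (pd j f))//; last by move=> y Uy; rewrite ev_der.
  rewrite (@pd_eq _ _ (dset U) j _ (pd i f))//; last by move=> y Uy; rewrite ev_der.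
  exact: pd_sym (@smo_smooth _ _ _ f 2%N) Ux.
Qed.

Definition halfS : smo U := cstS 2^-1.

Lemma halfS2 : halfS + halfS = 1.
Proof.
apply: smoP => x Ux; rewrite evE ev_cst// ev1//.
by rewrite [RHS]splitr mul1r.
Qed.

Definition evm a b (x : 'rV[R]_n) (M : 'M[smo U]_(a, b)) : 'M[R]_(a, b) :=
  map_mx (fun f : smo U => f x) M.

Lemma evmP a b (M N : 'M[smo U]_(a, b)) :
  (forall x, U x -> evm x M = evm x N) -> M = N.
Proof.
move=> MN; apply/matrixP => i j; apply: smoP => x /MN/matrixP/(_ i j).
by rewrite !mxE.
Qed.
Lemma evmD a b (M N : 'M[smo U]_(a, b)) x : evm x (M + N) = evm x M + evm x N.
Proof. by apply/matrixP => i j; rewrite !mxE evE. Qed.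
Lemma evmN a b (M : 'M[smo U]_(a, b)) x : evm x (- M) = - evm x M.
Proof. by apply/matrixP => i j; rewrite !mxE evE. Qed.
Lemma evm0 a b x : evm x (0 : 'M[smo U]_(a, b)) = 0.
Proof. by apply/matrixP => i j; rewrite !mxE evE. Qed.
Lemma evmZ a b f (M : 'M[smo U]_(a, b)) x : evm x (f *: M) = f x *: evm x M.
Proof. by apply/matrixP => i j; rewrite !mxE evE. Qed.
Lemma evmM a b c (M : 'M[smo U]_(a, b)) (N : 'M[smo U]_(b, c)) x :
  evm x (M *m N) = evm x M *m evm x N.
Proof.
apply/matrixP => i j; rewrite !mxE ev_sum; apply: eq_bigr => k _.
by rewrite !mxE evE.
Qed.
Lemma evmT a b (M : 'M[smo U]_(a, b)) x : evm x M^T = (evm x M)^T.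
Proof. by apply/matrixP => i j; rewrite !mxE. Qed.
Lemma evm1 a x : U x -> evm x (1%:M : 'M[smo U]_a) = 1%:M.
Proof. by move=> Ux; apply/matrixP => i j; rewrite !mxE ev_nat. Qed.
Lemma evm_delta a b i j x : U x -> evm x (delta_mx i j : 'M[smo U]_(a, b)) = delta_mx i j.
Proof. by move=> Ux; apply/matrixP => k l; rewrite !mxE ev_nat. Qed.

Lemma evm_scal (M : 'M[smo U]_1) x : (M 0 0) x = (evm x M) 0 0.
Proof. by rewrite mxE. Qed.

Lemma evm_entry a b (M : 'M[smo U]_(a, b)) x i j : (evm x M) i j = M i j x.
Proof. by rewrite mxE. Qed.

Lemma ev_ip (g : 'M[smo U]_n) X Y x : ip g X Y x = ev2 (evm x g) (evm x X) (evm x Y).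
Proof. by rewrite /ip evm_scal !evmM evmT. Qed.

Lemma smooth_mx a b (F : 'rV[R]_n -> 'M[R]_(a, b)) :
  (forall i j, smooth_on (dset U) (fun x => F x i j)) ->
  exists M : 'M[smo U]_(a, b), forall x, U x -> evm x M = F x.
Proof.
move=> Fs; exists (\matrix_(i, j) mkS (Fs i j)) => x Ux.
by apply/matrixP => i j; rewrite !mxE /= cutoffE.
Qed.

Lemma smooth_scal (F : 'rV[R]_n -> R) : smooth_on (dset U) F ->
  exists f : smo U, forall x, U x -> f x = F x.
Proof. by move=> Fs; exists (mkS Fs) => x Ux; rewrite /= cutoffE. Qed.

Lemma smo_mx_inv a (M : 'M[smo U]_a) : (forall x, U x -> evm x M \in unitmx) ->
  exists2 N : 'M[smo U]_a, N *m M = 1%:M & forall x, U x -> evm x N = invmx (evm x M).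
Proof.
move=> Mu; have [|N NE] := @smooth_mx _ _ (fun x => invmx (evm x M)).
  move=> i j k; apply: (Ck_on_invmx oU (k := k) Mu) => a' b'.
  apply: (Ck_on_eq oU _ (@smo_smooth _ _ _ (M a' b') k)) => x _.
  by rewrite mxE.
exists N => //; apply: evmP => x Ux.
by rewrite evmM NE// mulVmx ?Mu// evm1.
Qed.

End SmoothRing.

Section Restriction.
Variables (R : realType) (n : nat).

Lemma smooth_on_sub (A B : set 'rV[R]_n) f : B `<=` A -> smooth_on A f -> smooth_on B f.
Proof. by move=> BA fs k; exact: Ck_on_sub BA (fs k). Qed.

Lemma smooth_on_eq (A : set 'rV[R]_n) f g : open A -> (forall x, A x -> f x = g x) ->
  smooth_on A f -> smooth_on A g.
Proof. by move=> oA fg fs k; exact: Ck_on_eq oA fg (fs k). Qed.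

Lemma smooth_on_comp m (A : set 'rV[R]_n) (B : set 'rV[R]_m) (f : 'rV[R]_m -> R)
    (G : 'rV[R]_n -> 'rV[R]_m) : open A -> open B ->
  (forall x, A x -> B (G x)) -> smooth_on B f ->
  (forall j, smooth_on A (fun x => G x 0 j)) -> smooth_on A (fun x => f (G x)).
Proof. by move=> oA oB AB fs Gs k; apply: (Ck_on_comp oA oB AB (fs k)) => j; exact: Gs. Qed.

End Restriction.

(** * Tensor calculus in a chart, through the ring of smooth functions *)

Section ChartBridge.
Variables (R : realType) (n : nat) (M : manifold R n) (c : mchart M) (U : sdom R n).
Hypothesis Uc : forall x, U x -> chart_cod c x.

(** [F], read in the chart, is the matrix [Fr] of elements of the ring. The
lemmas below carry each operation of tensor calculus over to the ring. *)
Definition repr_mx a b (F : M -> 'M[R]_(a, b)) (Fr : 'M[smo U]_(a, b)) : Prop :=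
  forall x, U x -> F (chart_inv c x) = evm x Fr.

Lemma repr_exists a b (F : M -> 'M[R]_(a, b)) :
  (forall i j, smooth_in c (fun p => F p i j)) -> exists Fr, repr_mx F Fr.
Proof.
move=> Fs; have [|Fr FE] := @smooth_mx _ _ U a b (fun x => F (chart_inv c x)).
  by move=> i j; apply: smooth_on_sub (Fs i j).
by exists Fr => x Ux; rewrite FE.
Qed.

Lemma pder_repr i (F : M -> R) (f : smo U) x :
  (forall y, U y -> F (chart_inv c y) = f y) -> U x ->
  pder c i F (chart_inv c x) = derS i f x.
Proof.
move=> Ff Ux; rewrite /pder chart_invK; last exact: Uc.
by rewrite -pdE ev_der//; exact: (pd_eq _ (dset_open U) Ff).
Qed.

Lemma pder_repr_entry i a b (F : M -> 'M[R]_(a, b)) Fr k l x : repr_mx F Fr -> U x ->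
  pder c i (fun q => F q k l) (chart_inv c x) = derS i (Fr k l) x.
Proof. by move=> FE Ux; apply: pder_repr => // y Uy; rewrite FE// mxE. Qed.

Lemma bracket_repr X Y Xr Yr : repr_mx X Xr -> repr_mx Y Yr ->
  repr_mx (bracket c X Y) (brk (@derS _ _ U) Xr Yr).
Proof.
move=> XE YE x Ux; apply/colP => k.
rewrite !mxE !evE !ev_sum -sumrB; apply: eq_bigr => i _; rewrite !evE.
rewrite (pder_repr_entry i k 0 YE Ux) (pder_repr_entry i k 0 XE Ux).
by rewrite XE// YE// !mxE.
Qed.

Lemma lie_repr X T Xr Tr : repr_mx X Xr -> repr_mx T Tr ->
  repr_mx (lie_endo c X T) (lie (@derS _ _ U) Xr Tr).
Proof.
move=> XE TE x Ux; apply/matrixP => i j; rewrite [LHS]mxE [RHS]mxE [X in _ = smo_val X _]mxE.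
have h1 : repr_mx (fun q => col j (T q)) (col j Tr).
  by move=> y Uy; apply/colP => k; rewrite !mxE TE// mxE.
have h2 : repr_mx (fun=> delta_mx j 0 : 'cV[R]_n) (delta_mx j 0).
  by move=> y Uy; rewrite evm_delta.
rewrite (bracket_repr XE h1 Ux) (bracket_repr XE h2 Ux) TE//.
by rewrite -evmM -evmN -evmD mxE.
Qed.

Variables (g : M -> 'M[R]_n) (gr gir : 'M[smo U]_n).
Hypothesis gE : repr_mx g gr.
Hypothesis girE : gir *m gr = 1%:M.

Lemma gi_eval x : U x -> invmx (g (chart_inv c x)) = evm x gir.
Proof.
move=> Ux; rewrite gE//; have : evm x gir *m evm x gr = 1%:M by rewrite -evmM girE evm1.
move=> E; have [_ gu] := mulmx1_unit E.
by rewrite -[RHS]mulmx1 -(mulmxV gu) mulmxA E mul1mx.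
Qed.

Lemma nabla_repr X Y Xr Yr : repr_mx X Xr -> repr_mx Y Yr ->
  repr_mx (nabla c g X Y) (nab (@derS _ _ U) (halfS U) gr gir Xr Yr).
Proof.
move=> XE YE x Ux; apply/colP => k.
rewrite /nab evmD mxE [RHS]mxE; congr (_ + _).
  rewrite !mxE ev_sum; apply: eq_bigr => i _; rewrite evE.
  by rewrite (pder_repr_entry i k 0 YE Ux) XE// !mxE.
rewrite evmM mxE.
transitivity (\sum_i \sum_j \sum_l evm x gir k l * (chrl (@derS _ _ U) (halfS U) gr i j l x *
    evm x Xr i 0 * evm x Yr j 0)).
  apply: eq_bigr => i _; apply: eq_bigr => j _.
  rewrite /christoffel gi_eval// XE// YE//.
  rewrite mulr_sumr !mulr_suml; apply: eq_bigr => l _.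
  rewrite /chrl !evE ev_cst// (pder_repr_entry i j l gE Ux) (pder_repr_entry j i l gE Ux).
  by rewrite (pder_repr_entry l i j gE Ux); ring.
transitivity (\sum_i \sum_l \sum_j evm x gir k l * (chrl (@derS _ _ U) (halfS U) gr i j l x *
    evm x Xr i 0 * evm x Yr j 0)).
  by apply: eq_bigr => i _; rewrite exchange_big.
rewrite exchange_big/=; apply: eq_bigr => l _.
transitivity (evm x gir k l * \sum_i \sum_j chrl (@derS _ _ U) (halfS U) gr i j l x *
    evm x Xr i 0 * evm x Yr j 0).
  by rewrite mulr_sumr; apply: eq_bigr => i _; rewrite mulr_sumr.
congr (_ * _); rewrite [RHS]mxE mxE ev_sum; apply: eq_bigr => i _; rewrite ev_sum.
by apply: eq_bigr => j _; rewrite !evE !mxE.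
Qed.

Lemma curvature_repr X Y Z Xr Yr Zr : repr_mx X Xr -> repr_mx Y Yr -> repr_mx Z Zr ->
  repr_mx (curvature c g X Y Z) (curv (@derS _ _ U) (halfS U) gr gir Xr Yr Zr).
Proof.
move=> XE YE ZE x Ux.
have evm3 (a b d : 'cV[smo U]_n) : evm x (a - b - d) = evm x a - evm x b - evm x d.
  by rewrite !evmD !evmN.
rewrite /curvature /curv evm3; congr (_ - _ - _).
- exact: (nabla_repr XE (nabla_repr YE ZE) Ux).
- exact: (nabla_repr YE (nabla_repr XE ZE) Ux).
- exact: (nabla_repr (bracket_repr XE YE) ZE Ux).
Qed.

End ChartBridge.

(** * Bump functions *)

Section Bump.
Variable R : realType.

(** The functions $x^{-m}e^{-1/x}$, extended by $0$: a family closed under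
differentiation up to linear combinations. *)
Definition flat (m : nat) (x : R) : R :=
  if 0 < x then x^-1 ^+ m * expR (- x^-1) else 0.

Lemma flat_pos m x : 0 < x -> flat m x = x^-1 ^+ m * expR (- x^-1).
Proof. by rewrite /flat => ->. Qed.
Lemma flat_npos m x : x <= 0 -> flat m x = 0.
Proof. by rewrite /flat ltNge => ->. Qed.

Lemma flat_le m x : `|flat m x| <= m.+1`!%:R * `|x|.
Proof.
have [x0|x0] := ltP 0 x; last by rewrite flat_npos// normr0 mulr_ge0.
rewrite flat_pos// ger0_norm ?mulr_ge0 ?expR_ge0 ?exprn_ge0 ?invr_ge0 ?(ltW x0)//.
rewrite ger0_norm ?(ltW x0)// expRN.
have y0 : 0 < x^-1 by rewrite invr_gt0.
have h := expR_ge1Dxn m (ltW y0).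
have f0 : 0 < (m.+1`!%:R : R) by rewrite ltr0n fact_gt0.
rewrite ler_pdivrMr ?expR_gt0//.
have : x^-1 ^+ m.+1 / m.+1`!%:R <= expR x^-1 by apply: le_trans h; rewrite lerDr.
rewrite ler_pdivrMr// exprSr ler_pdivrMr// => h2.
apply: le_trans h2 _; rewrite le_eqVlt; apply/orP; left; apply/eqP; ring.
Qed.

Lemma flat_derive (m : nat) (x : R) : is_derive x 1 (flat m : R -> R^o) (flat m.+2 x - m%:R * flat m.+1 x).
Proof.
have [x0|x0|x0] := ltgtP 0 x.
- apply: (@near_eq_is_derive R R^o R^o (fun x => x^-1 ^+ m * expR (- x^-1)) (flat m)).
    near=> y; rewrite flat_pos//; near: y; exact: lt_nbhsr.
  have x0' : x != 0 by rewrite gt_eqF.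
  have d1 : is_derive x 1 (fun y : R => y^-1 : R^o) (- x^-1 ^+ 2).
    have := @is_deriveV R idfun x 1 1 x0' (is_derive_id _ _).
    by rewrite /= [_ *: 1]mulr1 exprVn.
  have d2 : is_derive x 1 (fun y : R => y^-1 ^+ m : R^o) (m%:R * x^-1 ^+ m.-1 * - x^-1 ^+ 2).
    have := @is_deriveX _ _ (fun y : R => y^-1) m x 1 _ d1.
    by rewrite exprfctE.
  have d3 : is_derive x 1 (fun y : R => expR (- y^-1) : R^o) (expR (- x^-1) * x^-1 ^+ 2).
    have dN : is_derive x 1 (fun y : R => - y^-1 : R^o) (x^-1 ^+ 2).
      by rewrite -[x^-1 ^+ 2]opprK; exact: is_deriveN.
    exact: (@is_derive1_comp _ expR (fun y => - y^-1) x _ _ (is_derive_expR _) dN).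
  have := is_deriveM d2 d3; rewrite mulrfctE => dM; apply: (is_derive_eq dM).
  rewrite !flat_pos//; move: (x^-1) (expR _) => y w.
  have E (a b : R) : a *: (b : R^o) = a * b by [].
  by rewrite !E; case: m {d2 dM} => [|m]; rewrite /= ?exprS ?expr0; ring.
- rewrite !flat_npos ?(ltW x0)// mulr0 subr0.
  apply: (@near_eq_is_derive R R^o R^o (fun=> 0) (flat m)).
    near=> y; rewrite flat_npos//; apply/ltW; near: y; exact: lt_nbhsl.
- rewrite -x0 !flat_npos// mulr0 subr0.
  suff H : h^-1 *: (flat m (h *: 1 + 0) - flat m 0) @[h --> (0:R)^'] --> (0 : R^o).
    by apply: DeriveDef; [apply/cvg_ex; exists 0|exact: cvg_lim].
  apply: (@cvgrPdist_le _ R^o _ ((0:R)^') _ _ 0).2 => e e0.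
  have F0 : 0 < (m.+2`!%:R : R) by rewrite ltr0n fact_gt0.
  exists (e / m.+2`!%:R) => /=; first by rewrite divr_gt0.
  move=> h /=; rewrite sub0r normrN ltr_pdivlMr// => he h0.
  rewrite sub0r normrN addr0 (flat_npos _ (lexx 0)) subr0 [h *: 1]mulr1.
  have [hp|hn] := ltP 0 h; last by rewrite flat_npos// scaler0 normr0 ltW.
  have -> : h^-1 *: (flat m h : R^o) = flat m.+1 h.
    by rewrite !flat_pos// exprS -mulrA.
  by apply: le_trans (flat_le _ _) _; rewrite mulrC ltW.
Unshelve. all: by end_near. Qed.

Lemma Ck_on_flat n k (A : set 'rV[R]_n) (f : 'rV[R]_n -> R) m : open A -> Ck_on k A f ->
  Ck_on k A (fun x => flat m (f x)).
Proof.
move=> oA fk.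
apply: (@Ck_on_comp1 _ _ _ _ [set: R] flat
  (fun m s => flat m.+2 s - m%:R * flat m.+1 s) _ oA _ _ _ fk) => //.
  by move=> j s _; exact: flat_derive.
move=> j IH _ l; apply: Ck_onD => //; apply: Ck_onN => //.
by apply: Ck_onM => //; exact: Ck_on_cst.
Qed.

Lemma bump_exists n (x0 : 'rV[R]_n) (r : R) : 0 < r -> exists b : 'rV[R]_n -> R,
  [/\ smooth_on setT b, b x0 = 1 & forall x, b x != 0 -> `|x - x0| <= r].
Proof.
move=> r0; pose q (x : 'rV[R]_n) := \sum_i (x - x0) 0 i ^+ 2.
pose u x := flat 0 (r ^+ 2 - q x).
have qs : smooth_on setT q.
  move=> k; apply: Ck_on_sum => [|i]; first exact: openT.
  have c1 : Ck_on k setT (fun x : 'rV[R]_n => x 0 i - x0 0 i).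
    by apply: Ck_onD; [exact: openT|exact/Ck_on_coord/openT|exact/Ck_on_cst/openT].
  apply: (@Ck_on_eq _ _ _ _ (fun x => (x 0 i - x0 0 i) * (x 0 i - x0 0 i))).
  - exact: openT.
  - by move=> x _; rewrite !mxE expr2.
  - by apply: Ck_onM => //; exact: openT.
have us : smooth_on setT u.
  move=> k; apply: Ck_on_flat; first exact: openT.
  apply: Ck_onD; [exact: openT|exact/Ck_on_cst/openT|].
  by apply: Ck_onN; [exact: openT|exact: qs].
have q0 : q x0 = 0 by rewrite /q big1// => i _; rewrite subrr mxE expr0n.
have u0 : 0 < u x0 by rewrite /u q0 subr0 flat_pos ?exprn_gt0// mulr_gt0 ?expR_gt0// expr0.
exists (fun x => u x * (u x0)^-1); split.
- by move=> k; apply: Ck_onM; [exact: openT|exact: us|exact/Ck_on_cst/openT].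
- by rewrite mulfV// gt_eqF.
- move=> x; apply: contraR; rewrite -ltNge => rx.
  suff -> : u x = 0 by rewrite mul0r.
  rewrite /u flat_npos// subr_le0.
  have [i ri] : exists i, r < `|(x - x0) 0 i|.
    apply: contrapT => nri; move: rx; rewrite ltNge => /negP; apply.
    apply: rV_norm_le => [|i]; first exact: ltW.
    by rewrite leNgt; apply/negP => ri; apply: nri; exists i.
  rewrite /q (bigD1 i)//= -[leLHS]addr0 lerD//.
    by rewrite -[leRHS]real_normK ?num_real// lerXn2r ?nnegrE ?(ltW r0)// ltW.
  by apply: sumr_ge0 => j _; exact: sqr_ge0.
Qed.

End Bump.

(** * Changes of charts *)

Section Charts.
Variables (R : realType) (n : nat) (M : topologicalType).
Implicit Types c d : chart R n M.

Definition overlap c d : set 'rV[R]_n :=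
  [set x | chart_cod c x /\ chart_dom d (chart_inv c x)].

Lemma chart_inv_open c (W : set M) : open W ->
  open [set x | chart_cod c x /\ W (chart_inv c x)].
Proof.
have oc := @chart_cod_open _ _ _ c; move=> oW.
have := @chart_inv_cont _ _ _ c; rewrite continuous_open_subspace// => /(continuous_inP _ oc).
by move=> /(_ W oW).
Qed.

Lemma chart_map_open c (W : set 'rV[R]_n) : open W ->
  open [set p | chart_dom c p /\ W (chart_map c p)].
Proof.
have oc := @chart_dom_open _ _ _ c; move=> oW.
have := @chart_map_cont _ _ _ c; rewrite continuous_open_subspace// => /(continuous_inP _ oc).
by move=> /(_ W oW).
Qed.

Lemma overlap_open c d : open (overlap c d).
Proof. exact/chart_inv_open/chart_dom_open. Qed.

Lemma overlap_sym c d x : overlap c d x -> overlap d c (chart_map d (chart_inv c x)).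
Proof.
move=> [cx dx]; split; first exact: chart_map_cod.
by rewrite chart_mapK//; exact: chart_inv_dom.
Qed.

Lemma overlap_map c d p : chart_dom c p -> chart_dom d p -> overlap c d (chart_map c p).
Proof. by move=> cp dp; split; [exact: chart_map_cod|rewrite chart_mapK]. Qed.

End Charts.

Section Manifold.
Variables (R : realType) (n : nat) (M : manifold R n).
Implicit Types c d e : mchart M.

Lemma transition_smooth c d : atlas c -> atlas d -> forall i,
  smooth_on (overlap c d) (fun x => chart_map d (chart_inv c x) 0 i).
Proof. by move=> ac ad i; have [+ _] := atlas_compatible ac ad; exact. Qed.

Lemma pder_change c d (W : set 'rV[R]_n) (F : M -> R) p j : atlas c -> atlas d ->
  open W -> smooth_on W (fun y => F (chart_inv d y)) ->
  chart_dom c p -> chart_dom d p -> W (chart_map d p) ->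
  pder c j F p = \sum_i jac c d p i j * pder d i F p.
Proof.
move=> ac ad oW Fs cp dp Wp.
pose G x := chart_map d (chart_inv c x).
pose A := overlap c d `&` [set x | chart_cod c x /\
  [set q | chart_dom d q /\ W (chart_map d q)] (chart_inv c x)].
have oA : open A.
  by apply: openI; [exact: overlap_open|exact/chart_inv_open/chart_map_open].
have Ap : A (chart_map c p).
  split; first exact: overlap_map.
  by split; [exact: chart_map_cod|rewrite /= chart_mapK].
have E x : A x -> F (chart_inv c x) = F (chart_inv d (G x)).
  by move=> [[cx dx] _]; rewrite /G chart_mapK.
rewrite /pder -pdE (pd_eq _ oA E Ap).
rewrite (@is_derive_comp_pd _ _ _ A W (fun y => F (chart_inv d y)) G)//.
- rewrite /G chart_mapK//; apply: eq_bigr => i _; rewrite -pdE; congr (_ * _).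
  by rewrite mxE /pder -pdE.
- by rewrite /G chart_mapK.
- by move=> i k; apply: Ck_on_sub (transition_smooth ac ad i k) => x [].
Qed.

Lemma jac_comp c d e p : atlas c -> atlas d -> atlas e ->
  chart_dom c p -> chart_dom d p -> chart_dom e p ->
  jac c e p = jac d e p *m jac c d p.
Proof.
move=> ac ad ae cp dp ep; apply/matrixP => i j; rewrite mxE.
rewrite (@pder_change c d (overlap d e))//; last exact: overlap_map.
- by rewrite mxE; apply: eq_bigr => k _; rewrite mulrC; congr (_ * _); rewrite mxE.
- exact: overlap_open.
- exact: transition_smooth.
Qed.

Lemma jac_id c p : chart_dom c p -> jac c c p = 1%:M.
Proof.
move=> cp; apply/matrixP => i j; rewrite !mxE /pder -pdE.
have oc := @chart_cod_open _ _ _ c.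
rewrite (@pd_eq _ _ (chart_cod c) j _ (fun x => x 0 i))//; last exact: chart_map_cod.
  by rewrite pdE; have [_ ->] := @is_derive_coord R n j i (chart_map c p).
by move=> x cx; rewrite chart_invK.
Qed.

Lemma jac_inv c d p : atlas c -> atlas d -> chart_dom c p -> chart_dom d p ->
  jac d c p *m jac c d p = 1%:M.
Proof. by move=> ac ad cp dp; rewrite -jac_comp// jac_id. Qed.

Lemma jac_smooth c d i j : atlas c -> atlas d ->
  smooth_on (overlap c d) (fun x => jac c d (chart_inv c x) i j).
Proof.
move=> ac ad.
apply: (smooth_on_eq (f := pd j (fun x => chart_map d (chart_inv c x) 0 i))).
- exact: overlap_open.
- by move=> x [cx _]; rewrite mxE /pder chart_invK// pdE.
- exact/smooth_pd/transition_smooth.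
Qed.

Lemma jac_smooth' c d i j : atlas c -> atlas d ->
  smooth_on (overlap d c) (fun y => jac c d (chart_inv d y) i j).
Proof.
move=> ac ad.
apply: (smooth_on_eq (f := fun y => (fun x => jac c d (chart_inv c x) i j)
   (chart_map c (chart_inv d y)))).
- exact: overlap_open.
- by move=> y [dy cy]; rewrite chart_mapK.
- apply: (@smooth_on_comp _ _ _ (overlap d c) (overlap c d)
     (fun x => jac c d (chart_inv c x) i j) (fun y => chart_map c (chart_inv d y))).
  + exact: overlap_open.
  + exact: overlap_open.
  + by move=> y yo; exact: overlap_sym.
  + exact: jac_smooth.
  + by move=> k; exact: transition_smooth.
Qed.

(** Conditions on global vector fields constrain every tangent vector, because a
constant field of a chart can be cut off by a bump function. The support is
compact, hence closed in the Hausdorff space $M$, so that the extension by $0$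
is smooth. *)
Lemma vfield_through c p (v : 'cV[R]_n) : atlas c -> chart_dom c p ->
  exists X : vfield M, X c p = v.
Proof.
move=> ac cp; set x0 := chart_map c p.
have cx0 : chart_cod c x0 by exact: chart_map_cod.
have oc := @chart_cod_open _ _ _ c.
have /nbhs_ballP[r0 /= r00 r0c] := open_near oc cx0.
pose r := r0 / 2.
have r_gt0 : 0 < r by rewrite divr_gt0.
have rc x : `|x - x0| <= r -> chart_cod c x.
  move=> xr; apply: r0c; rewrite rV_ballE/=; apply: le_lt_trans xr _.
  by rewrite /r; lra.
have [b [bs b0 bsupp]] := bump_exists x0 r_gt0.
pose K := closed_ball x0 r.
have KE x : K x <-> `|x - x0| <= r.
  by rewrite /K closed_ballE// /closed_ball_/= distrC.
have cK : compact K.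
  apply: bounded_closed_compact; last exact: closed_ball_closed.
  exists (`|x0| + r); split; first exact: num_real.
  move=> N /ltW lN z /KE zr; apply: le_trans lN.
  by rewrite -(subrK x0 z) addrC; apply: le_trans (ler_normD _ _) _; rewrite lerD.
have Kc : K `<=` chart_cod c by move=> x /KE /rc.
have cIK : closed (chart_inv c @` K).
  apply: compact_closed; first exact: manifold_hausdorff.
  apply: continuous_compact cK.
  exact: (@continuous_subspaceW _ _ _ (chart_cod c) _ Kc (@chart_inv_cont _ _ _ c)).
pose X (d : mchart M) (q : M) : 'cV[R]_n :=
  if pselect (chart_dom c q) then b (chart_map c q) *: (jac c d q *m v) else 0.
have Xs (d : mchart M) : atlas d -> forall i, smooth_in d (fun q => X d q i 0).
  move=> ad i k; apply: Ck_on_local => y dy.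
  have [cy|ncy] := pselect (chart_dom c (chart_inv d y)).
    exists (overlap d c); split=> //.
    pose f y := b (chart_map c (chart_inv d y)) * \sum_j jac c d (chart_inv d y) i j * v j 0.
    apply: (@Ck_on_eq _ _ _ _ f); first exact: overlap_open.
      by move=> z [dz cz]; rewrite /X; case: pselect => [cz'|//]; rewrite [RHS]mxE /f; congr (_ * _); rewrite mxE.
    apply: Ck_onM; first exact: overlap_open.
      apply: (@smooth_on_comp _ _ _ (overlap d c) setT b (fun y => chart_map c (chart_inv d y))) => //.
      - exact: overlap_open.
      - exact: openT.
      - by move=> j; exact: transition_smooth.
    apply: Ck_on_sum => [|j]; first exact: overlap_open.
    apply: Ck_onM; first exact: overlap_open.
      exact: jac_smooth'.
    by apply: Ck_on_cst; exact: overlap_open.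
  exists [set z | chart_cod d z /\ (~` (chart_inv c @` K)) (chart_inv d z)]; split.
    split=> // -[x Kx xy]; apply: ncy; rewrite -xy.
    by apply: chart_inv_dom; exact: Kc.
  have oN : open [set z | chart_cod d z /\ (~` (chart_inv c @` K)) (chart_inv d z)].
    by apply: chart_inv_open; exact: closed_openC.
  apply: (@Ck_on_eq _ _ _ _ (fun=> 0)) => //; last exact: Ck_on_cst.
  move=> z [dz nKz]; rewrite /X; case: pselect => [cz|ncz]; last by rewrite mxE.
  rewrite mxE (_ : b _ = 0) ?mul0r//; apply/eqP/negPn/negP => /bsupp bz.
  by apply: nKz; exists (chart_map c (chart_inv d z)); [exact/KE|rewrite chart_mapK].
have Xl c1 d1 : atlas c1 -> atlas d1 -> forall q, chart_dom c1 q -> chart_dom d1 q ->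
    X d1 q = jac c1 d1 q *m X c1 q.
  move=> ac1 ad1 q cq dq; rewrite /X; case: pselect => [cq0|ncq0]; last by rewrite mulmx0.
  by rewrite -scalemxAr mulmxA -jac_comp.
exists (VField Xs Xl) => /=; rewrite /X; case: pselect => // cp'.
by rewrite b0 scale1r jac_id// mul1mx.
Qed.

(** The inverse function theorem makes [F] a coordinate system near the point,
and it belongs to the atlas by maximality. Its image is a ball for the supremum
norm, that is a box, on which functions of one coordinate can be recognized by
their partial derivatives. *)
Theorem new_chart c0 p (A : set 'rV[R]_n) (F : 'rV[R]_n -> 'rV[R]_n) :
  atlas c0 -> chart_dom c0 p -> open A -> A `<=` chart_cod c0 -> A (chart_map c0 p) ->
  (forall j, smooth_on A (fun x => F x 0 j)) ->
  (\matrix_(i, j) pd i (fun x => F x 0 j) (chart_map c0 p)) \in unitmx ->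
  exists c, [/\ atlas c, chart_dom c p,
    forall q, chart_dom c q -> chart_dom c0 q /\ A (chart_map c0 q),
    forall q, chart_map c q = F (chart_map c0 q) &
    exists r, chart_cod c = [set y | `|y - F (chart_map c0 p)| < r]].
Proof.
move=> ac0 c0p oA Ac Ap Fs Ju; set x0 := chart_map c0 p in Ap Ju *.
have [r [s [G [r0 s0 sA GP [GF Gs]]]]] := inverse_function oA Fs Ap Ju.
pose W := [set y | `|y - F x0| < r].
pose V := [set x | `|x - x0| < s /\ W (F x)].
have oW : open W by exact: open_normball.
have Fc x : A x -> {for x, continuous F}.
  by move=> Ax; apply: rV_continuous => j; exact: (Ck_on_cont (Fs j 0%N)).
have Gc y : W y -> {for y, continuous G}.
  by move=> Wy; apply: rV_continuous => j; exact: (Ck_on_cont (Gs j 0%N)).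
have oB : open [set x | `|x - x0| < s] by exact: open_normball.
have oV : open V.
  have := (continuous_inP F oB).1 _ W oW; apply => x; rewrite inE => xs.
  by apply: Fc; exact: sA.
pose dom := [set q | chart_dom c0 q /\ V (chart_map c0 q)].
have odom : open dom by exact: chart_map_open.
have h1 q : dom q -> W (F (chart_map c0 q)) by move=> [_ []].
have h2 y : W y -> dom (chart_inv c0 (G y)).
  move=> Wy; have [Gys FGy] := GP _ Wy.
  have cG : chart_cod c0 (G y) by apply: Ac; exact: sA.
  split; first exact: chart_inv_dom.
  by rewrite chart_invK//; split=> //; rewrite FGy.
have h3 q : dom q -> chart_inv c0 (G (F (chart_map c0 q))) = q.
  by move=> [cq [qs Wq]]; rewrite GF// chart_mapK.
have h4 y : W y -> F (chart_map c0 (chart_inv c0 (G y))) = y.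
  move=> Wy; have [Gys FGy] := GP _ Wy.
  by rewrite chart_invK//; apply: Ac; exact: sA.
have h5 : {within dom, continuous (fun q => F (chart_map c0 q))}.
  apply: continuous_in_subspaceT => q; rewrite inE => -[cq [qs Wq]].
  apply: continuous_comp; last by apply: Fc; exact: sA.
  have := @chart_map_cont _ _ _ c0.
  rewrite continuous_open_subspace; last exact: chart_dom_open.
  by apply; rewrite inE.
have icont x : chart_cod c0 x -> {for x, continuous (chart_inv c0)}.
  move=> cx; have := @chart_inv_cont _ _ _ c0.
  rewrite continuous_open_subspace; last exact: chart_cod_open.
  by apply; rewrite inE.
have h6 : {within W, continuous (fun y => chart_inv c0 (G y))}.
  apply: continuous_in_subspaceT => y; rewrite inE => Wy.
  apply: continuous_comp; first exact: Gc.
  by apply: icont; apply: Ac; have [+ _] := GP _ Wy; exact: sA.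
pose c : mchart M := @Chart R n M dom W (fun q => F (chart_map c0 q))
  (fun y => chart_inv c0 (G y)) odom oW h1 h2 h3 h4 h5 h6.
have cp : chart_dom c p by split=> //; split; rewrite /W/= subrr normr0.
have compat d : atlas d -> compatible c d.
  move=> ad; split=> i.
    pose O := [set x | W x /\ chart_dom d (chart_inv c0 (G x))].
    have oO : open O by exact: (@overlap_open R n M c d).
    apply: (@smooth_on_comp _ _ _ O (overlap c0 d)
      (fun x => chart_map d (chart_inv c0 x) 0 i) G) => //.
    - exact: overlap_open.
    - by move=> y [Wy dy]; split=> //; apply: Ac; have [+ _] := GP _ Wy; exact: sA.
    - exact: transition_smooth.
    - by move=> j; apply: smooth_on_sub (Gs j) => y [].
  pose O := [set x | chart_cod d x /\ dom (chart_inv d x)].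
  have oO : open O by exact: (@overlap_open R n M d c).
  apply: (@smooth_on_comp _ _ _ O A (fun x => F x 0 i)
     (fun x => chart_map c0 (chart_inv d x))) => //.
  - by move=> x [dx [_ [xs _]]]; exact: sA.
  - move=> j; apply: (smooth_on_sub _ (transition_smooth ad ac0 j)).
    by move=> x [dx [cx _]].
have ac : atlas c by exact: atlas_maximal.
exists c; split => //; last by exists r.
by move=> q [cq [qs _]]; split=> //; exact: sA.
Qed.

End Manifold.

(** * Almost contact metric structures in a chart *)

Section Pointwise.
Variables (R : realType) (n : nat) (M : manifold R n) (S : acm M) (c : mchart M) (p : M).
Hypotheses (ac : atlas c) (cp : chart_dom c p).
Let f := phi S c p.
Let x := xi S c p.
Let e := eta S c p.
Let g := met S c p.

Lemma acm_etaxi : e *m x = 1%:M.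
Proof. by rewrite [LHS]scalar11; congr (_%:M); exact: acm_eta_xi. Qed.

(** $\varphi^2\xi=0$, so $0=\varphi^2(\varphi\xi)=-\varphi\xi+\eta(\varphi\xi)\xi$, which
makes $\varphi\xi$ a multiple $t\xi$, and then $t^2=0$. *)
Lemma acm_phixi : f *m x = 0.
Proof.
have f2 : f *m f = - 1%:M + x *m e by exact: acm_phi2.
have f2x : f *m (f *m x) = 0.
  by rewrite mulmxA f2 mulmxDl -mulmxA acm_etaxi mulmx1 mulNmx mul1mx addNr.
have E : f *m x = (e *m (f *m x)) 0 0 *: x.
  have : f *m (f *m (f *m x)) = 0 by rewrite f2x mulmx0.
  rewrite mulmxA f2 mulmxDl mulNmx mul1mx => /eqP; rewrite addrC subr_eq0 => /eqP H.
  by rewrite -{1}H -mulmxA {1}[e *m _]scalar11 mul_mx_scalar.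
set t := (e *m _) 0 0 in E.
have : t *: (t *: x) = 0 by rewrite -E scalemxAr -E f2x.
move=> tt; have : e *m (t *: (t *: x)) = 0 by rewrite tt mulmx0.
rewrite -!scalemxAr acm_etaxi => /matrixP/(_ 0 0); rewrite !mxE mulr1 => /eqP.
by rewrite mulf_eq0 orbb => /eqP t0; rewrite E t0 scale0r.
Qed.

Lemma acm_etaphi : e *m f = 0.
Proof.
have f2 : f *m f = - 1%:M + x *m e by exact: acm_phi2.
have : f *m f *m f = f *m (f *m f) by rewrite mulmxA.
rewrite f2 mulmxDl mulmxDr mulmxN mulNmx mul1mx mulmx1 => /addrI.
rewrite mulmxA acm_phixi mul0mx => xef.
by rewrite -[LHS]mul1mx -acm_etaxi -!mulmxA (mulmxA x) xef mulmx0.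
Qed.

Lemma ev2_inj (a b : 'M[R]_n) : (forall v w, ev2 a v w = ev2 b v w) -> a = b.
Proof.
move=> E; apply/matrixP => i j; have := E (delta_mx i 0) (delta_mx j 0).
by rewrite /ev2 !trmx_delta -!rowE -!colE !mxE.
Qed.

Lemma acm_met_mx : f^T *m g *m f = g - e^T *m e.
Proof.
apply: ev2_inj => v w; have := acm_met S ac cp v w; rewrite -/f -/g -/e => E.
transitivity (ev2 g (f *m v) (f *m w)); first by rewrite /ev2 trmx_mul !mulmxA.
rewrite E /ev2 mulmxBr mulmxBl [RHS]mxE [X in _ = _ + X]mxE; congr (_ - _).
have -> : v^T *m (e^T *m e) *m w = (e *m v)^T *m (e *m w) by rewrite trmx_mul !mulmxA.
by rewrite mxE big_ord1 /ev1 mxE.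
Qed.

Lemma acm_eta_met : e = x^T *m g.
Proof.
have : x^T *m (f^T *m g *m f) = 0 by rewrite !mulmxA -trmx_mul acm_phixi trmx0 !mul0mx.
rewrite acm_met_mx mulmxBr mulmxA -trmx_mul acm_etaxi trmx1 mul1mx => /subr0_eq ->.
by [].
Qed.

Lemma acm_skew : (g *m f)^T = - (g *m f).
Proof.
have gs : g^T = g by exact: metric_sym.
have gx : g *m x = e^T by rewrite acm_eta_met trmx_mul trmxK gs.
have : f^T *m g *m (f *m f) = g *m f.
  rewrite mulmxA acm_met_mx mulmxBl -mulmxA acm_etaphi mulmx0; exact: subr0.
rewrite acm_phi2// mulmxDr mulmxN mulmx1 -!mulmxA [g *m (_ *m _)]mulmxA gx.
rewrite [f^T *m (_ *m _)]mulmxA -trmx_mul acm_etaphi trmx0 mul0mx addr0 => E.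
by rewrite trmx_mul gs -E opprK.
Qed.

Lemma fundamental_formE : fundamental_form S c p = g *m f.
Proof.
apply/matrixP => i j; rewrite mxE /ev2 trmx_delta mulmxA -mulmxA -rowE -colE !mxE.
by apply: eq_bigr => k _; rewrite !mxE.
Qed.

End Pointwise.

Section Represents.
Variables (R : realType) (M : manifold R 3) (S : acm M) (kappa mu : M -> R) (c : mchart M).
Variable U : sdom R 3.
Hypotheses (ac : atlas c) (Uc : forall x, U x -> chart_cod c x).
Hypotheses (ks : smooth_fun kappa) (ms : smooth_fun mu).

Notation dS := (@derS R 3 U).
Notation hS := (halfS U).

Record represents (g gi f : 'M[smo U]_3) (x : 'cV[smo U]_3) (e : 'rV[smo U]_3)
    (k m : smo U) : Prop := Represents {
  rp_g : repr_mx c (met S c) g;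
  rp_gi : gi *m g = 1%:M;
  rp_phi : repr_mx c (phi S c) f;
  rp_xi : repr_mx c (xi S c) x;
  rp_eta : repr_mx c (eta S c) e;
  rp_k : forall y, U y -> kappa (chart_inv c y) = k y;
  rp_m : forall y, U y -> mu (chart_inv c y) = m y
}.

Lemma repr_fun_exists (F : M -> R) : smooth_in c F ->
  exists k : smo U, forall y, U y -> F (chart_inv c y) = k y.
Proof.
move=> Fs; have [|k kE] := @smooth_scal _ _ U (fun y => F (chart_inv c y)).
  exact: smooth_on_sub Fs.
by exists k => y Uy; rewrite kE.
Qed.

Lemma represents_exists : exists g gi f x e k m, represents g gi f x e k m.
Proof.
have [g gE] : exists g : 'M[smo U]_3, repr_mx c (met S c) g by apply: repr_exists => // i j; exact: metric_smooth.
have [f fE] : exists f : 'M[smo U]_3, repr_mx c (phi S c) f by apply: repr_exists => // i j; exact: endo_smooth.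
have [x xE] : exists x : 'cV[smo U]_3, repr_mx c (xi S c) x.
  by apply: repr_exists => // i j; rewrite ord1; exact: vfield_smooth.
have [e eE] : exists e : 'rV[smo U]_3, repr_mx c (eta S c) e.
  by apply: repr_exists => // i j; rewrite ord1; exact: form1_smooth.
have [k kE] := repr_fun_exists (ks ac).
have [m mE] := repr_fun_exists (ms ac).
have [|gi giE _] := @smo_mx_inv _ _ U _ g.
  by move=> y Uy; rewrite -gE//; apply: metric_unit => //; apply: chart_inv_dom; exact: Uc.
by exists g, gi, f, x, e, k, m.
Qed.

Variables (g gi f : 'M[smo U]_3) (x : 'cV[smo U]_3) (e : 'rV[smo U]_3) (k m : smo U).
Hypothesis RP : represents g gi f x e k m.
Let domU y (Uy : U y) : chart_dom c (chart_inv c y) := chart_inv_dom (Uc Uy).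

Lemma rp_etaxi : e *m x = 1%:M.
Proof.
apply: evmP => y Uy; rewrite evmM -(rp_eta RP)// -(rp_xi RP)// evm1//.
by apply: acm_etaxi => //; exact: domU.
Qed.

Lemma rp_gs : g^T = g.
Proof.
by apply: evmP => y Uy; rewrite evmT -(rp_g RP)//; apply: metric_sym => //; exact: domU.
Qed.

Lemma rp_phixi : f *m x = 0.
Proof.
apply: evmP => y Uy; rewrite evmM evm0 -(rp_phi RP)// -(rp_xi RP)//.
by apply: acm_phixi => //; exact: domU.
Qed.

Lemma rp_etag : e = x^T *m g.
Proof.
apply: evmP => y Uy; rewrite evmM evmT -(rp_eta RP)// -(rp_xi RP)// -(rp_g RP)//.
by apply: acm_eta_met => //; exact: domU.
Qed.

Lemma rp_F : repr_mx c (fundamental_form S c) (g *m f).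
Proof. by move=> y Uy; rewrite fundamental_formE evmM (rp_g RP)// (rp_phi RP). Qed.

Lemma rp_ak : almost_kenmotsu S -> ak_structure dS g gi f x e.
Proof.
move=> AK; split.
- exact: rp_gs.
- exact: rp_gi RP.
- apply: evmP => y Uy; rewrite evmM evmD evmN evm1// evmM -(rp_phi RP)// -(rp_xi RP)//.
  by rewrite -(rp_eta RP)//; apply: acm_phi2 => //; exact: domU.
- exact: rp_phixi.
- apply: evmP => y Uy; rewrite evmT evmN evmM -(rp_phi RP)// -(rp_g RP)//.
  by apply: acm_skew => //; exact: domU.
- exact: rp_etag.
- move=> i j; apply: smoP => y Uy; have [/(_ i j) + _] := AK c ac _ (domU Uy).
  rewrite /ext_d1 (pder_repr_entry Uc i 0 j (rp_eta RP) Uy).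
  by rewrite (pder_repr_entry Uc j 0 i (rp_eta RP) Uy) => /subr0_eq.
- move=> i j l; apply: smoP => y Uy; have [_ /(_ i j l)] := AK c ac _ (domU Uy).
  rewrite /ext_d2 /wedge12 !(pder_repr_entry Uc _ _ _ rp_F Uy) (rp_eta RP)// rp_F//.
  by rewrite !evm_entry !evE ev1// => ->; congr (_ * _).
Qed.

Lemma rp_h : repr_mx c (h_tensor S c) (hS *: lie dS x f).
Proof.
by move=> y Uy; rewrite evmZ ev_cst// /h_tensor (lie_repr Uc (rp_xi RP) (rp_phi RP) Uy).
Qed.

Lemma rp_h' : repr_mx c (h'_tensor S c) (hS *: lie dS x f *m f).
Proof. by move=> y Uy; rewrite /h'_tensor rp_h// (rp_phi RP)// evmM. Qed.

Lemma tensor_eval (K : 'I_3 -> 'I_3 -> 'cV[smo U]_3) (X Y X' Y' : 'cV[smo U]_3) y :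
  evm y X = evm y X' -> evm y Y = evm y Y' ->
  evm y (\sum_i \sum_j (X i 0 * Y j 0) *: K i j) =
  evm y (\sum_i \sum_j (X' i 0 * Y' j 0) *: K i j).
Proof.
move=> XE YE.
apply/matrixP => a b; rewrite !evm_entry !summxE !ev_sum; apply: eq_bigr => i _.
rewrite !summxE !ev_sum; apply: eq_bigr => j _; rewrite !mxE !evE.
by rewrite -!(evm_entry _ y) XE YE.
Qed.

Lemma curv_eval (X Y X' Y' Z : 'cV[smo U]_3) y : evm y X = evm y X' -> evm y Y = evm y Y' ->
  evm y (curv dS hS g gi X Y Z) = evm y (curv dS hS g gi X' Y' Z).
Proof.
move=> XE YE; pose K i j := curv dS hS g gi (delta_mx i 0) (delta_mx j 0) Z.
have E V W : curv dS hS g gi V W Z = \sum_i \sum_j (V i 0 * W j 0) *: K i j.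
  exact: (curv_delta (@derS_dsys _ _ U)).
by rewrite (E X Y) (E X' Y'); exact: tensor_eval.
Qed.

(** Both sides are tensors in $X$ and $Y$, so global fields with the right value
at a point are enough. *)
Lemma rp_kmu : generalized_kappa_mu' S kappa mu -> forall X Y, curv dS hS g gi X Y x =
  k *: ((e *m Y) 0 0 *: X - (e *m X) 0 0 *: Y)
  + m *: ((e *m Y) 0 0 *: (hS *: lie dS x f *m f *m X)
          - (e *m X) 0 0 *: (hS *: lie dS x f *m f *m Y)).
Proof.
move=> KM X Y; apply: evmP => y Uy; have dy := domU Uy.
have [V VE] := vfield_through (evm y X) ac dy.
have [W WE] := vfield_through (evm y Y) ac dy.
have [Vr VrE] : exists Vr : 'cV[smo U]_3, repr_mx c (V c) Vr.
  by apply: repr_exists => // i j; rewrite ord1; exact: vfield_smooth.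
have [Wr WrE] : exists Wr : 'cV[smo U]_3, repr_mx c (W c) Wr.
  by apply: repr_exists => // i j; rewrite ord1; exact: vfield_smooth.
have VX : evm y Vr = evm y X by rewrite -VrE.
have WY : evm y Wr = evm y Y by rewrite -WrE.
have := curvature_repr Uc (rp_g RP) (rp_gi RP) VrE WrE (rp_xi RP) Uy.
rewrite (KM V W c ac _ dy) => E; rewrite -(curv_eval x VX WY) -{}E.
rewrite VE WE /ev1 (rp_eta RP)// (rp_k RP)// (rp_m RP)// rp_h'//.
by rewrite evmD !evmZ !evmD !evmN !evmZ !evmM !evm_scal !evmM.
Qed.

Lemma rp_dkappa : (forall p, chart_dom c p -> wedge11 (grad c kappa p) (eta S c p) = 0) ->
  forall i j, dS i k * e 0 j = dS j k * e 0 i.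
Proof.
move=> W i j; apply: smoP => y Uy; have /matrixP/(_ i j) := W _ (domU Uy).
rewrite !mxE !(pder_repr Uc _ (rp_k RP) Uy) (rp_eta RP)// !evm_entry !evE.
exact: subr0_eq.
Qed.

End Represents.

(** * Eigenvectors of h' *)

Section FrameAlgebra.
Variable C : comNzRingType.

Lemma frame_ext (g : 'M[C]_3) (e : 'I_3 -> 'cV[C]_3) m (A B : 'M[C]_(m, 3)) :
  (forall a b, ip g (e a) (e b) = (a == b)%:R) ->
  (forall a, A *m e a = B *m e a) -> A = B.
Proof.
move=> orth AB; have [E EE E1] := frame_matrix orth.
have colE' a : col a E = e a by apply/colP => i; rewrite mxE EE.
suff AE : A *m E = B *m E by rewrite -[A]mulmx1 -[B]mulmx1 -E1 !mulmxA AE.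
by apply/matrixP => i a; have /colP/(_ i) := AB a; rewrite -colE' colE !mulmxA -!colE !mxE.
Qed.

(** Skewness of $g\varphi$ makes $\varphi X$ orthogonal to $X$ and $\xi$, and
$\varphi^2=-1$ on $\xi^\perp$ gives it the length of $X$. *)
Lemma unit_frame D (hf : C) (g gi f : 'M[C]_3) (x : 'cV[C]_3) (e : 'rV[C]_3) (X : 'cV[C]_3) :
  hf + hf = 1 -> ak_structure D g gi f x e -> e *m x = 1%:M -> e *m X = 0 -> ip g X X = 1 ->
  exists fr : 'I_3 -> 'cV[C]_3, [/\ fr ix1 = X, fr ix2 = f *m X, fr it = x &
    forall a b, ip g (fr a) (fr b) = (a == b)%:R].
Proof.
move=> hf2 AK ex eX XX.
pose fr i := if i == ix1 then X else if i == ix2 then f *m X else x.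
exists fr; split=> // a b.
have gs := ak_gsym AK; have eg := ak_eta AK.
have ipf U V : ip g U (f *m V) = ip (g *m f) U V by rewrite /ip !mulmxA.
have anti U V : ip g U (f *m V) = - ip g V (f *m U) by rewrite !ipf (ip_anti _ _ (ak_skew AK)).
have xV V : ip g x V = (e *m V) 0 0 by rewrite eg.
have x1 : ip g x x = 1 by rewrite xV ex mxE eqxx.
have xX : ip g x X = 0 by rewrite xV eX mxE.
have XfX : ip g X (f *m X) = 0 by apply: (two_inj hf2); rewrite {1}anti addNr.
have fXx V : ip g x (f *m V) = 0 by rewrite anti (ak_phixi AK) ip0r oppr0.
have fXfX : ip g (f *m X) (f *m X) = 1.
  by rewrite anti mulmxA (ak_phi2 AK) mulmxDl mulNmx mul1mx -mulmxA eX mulmx0 addr0 ipNr opprK.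
case: (ord3P a) => ->; case: (ord3P b) => ->; rewrite /fr/= ?x1 ?xX ?XfX ?fXx ?fXfX//.
- by rewrite ipC// xX.
- by rewrite ipC// XfX.
- by rewrite ipC// fXx.
Qed.

Lemma lie_xi (D : 'I_3 -> C -> C) (f : 'M[C]_3) (x : 'cV[C]_3) : dsys D -> f *m x = 0 ->
  lie D x f *m x = 0.
Proof.
move=> HD fx; rewrite (lieE HD) fx /brk subrr mulmx0 subr0.
by apply/matrixP => i j; rewrite !mxE (dir0 HD) /dir big1 ?subrr// => k _; rewrite !mxE mul0r.
Qed.

End FrameAlgebra.

Lemma pos_dom (R : realType) n (U : sdom R n) (f : smo U) x0 : U x0 -> 0 < f x0 ->
  exists V : sdom R n, V x0 /\ forall y, V y -> U y /\ 0 < f y.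
Proof.
move=> Ux0 f0.
have o : open [set y | dset U y /\ 0 < f y].
  have := (continuous_inP (f : 'rV[R]_n -> R) (dset_open U)).1.
  move=> /(_ _ [set z : R | 0 < z]); apply; last exact: open_gt.
  by move=> y; rewrite inE => Uy; exact: (Ck_on_cont (@smo_smooth _ _ _ f 0%N)).
by exists (Sdom o (ex_intro _ x0 (conj Ux0 f0))); split.
Qed.

Section Forward.
Variables (R : realType) (M : manifold R 3) (S : acm M) (kappa mu : M -> R).
Hypothesis AK : almost_kenmotsu S.
Hypothesis KM : generalized_kappa_mu' S kappa mu.
Hypotheses (ks : smooth_fun kappa) (ms : smooth_fun mu).
Hypothesis dk : forall (c : mchart M) (p : M), atlas c -> chart_dom c p ->
  wedge11 (grad c kappa p) (eta S c p) = 0.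
Hypothesis hn : forall (c : mchart M) (p : M), atlas c -> chart_dom c p ->
  h_tensor S c p <> 0.

Section InChart.
Variables (c : mchart M) (p : M).
Hypotheses (ac : atlas c) (cp : chart_dom c p).
Let x0 := chart_map c p.
Let cx0 : chart_cod c x0 := chart_map_cod cp.
Notation H := (h'_tensor S c).
Let codU : sdom R 3 := Sdom (@chart_cod_open _ _ _ c) (ex_intro _ x0 cx0).

Lemma unit_frame_on (U : sdom R 3) (Uc : forall x, U x -> chart_cod c x) g gi f x e k m
    (RP : represents S kappa mu c g gi f x e k m) (X : 'cV[smo U]_3) :
  e *m X = 0 -> (forall y, U y -> 0 < ip g X X y) ->
  exists (fr : 'I_3 -> 'cV[smo U]_3) (s : smo U), [/\ fr ix1 = s *: X, fr ix2 = f *m fr ix1,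
    fr it = x & forall a b, ip g (fr a) (fr b) = (a == b)%:R].
Proof.
move=> eX X0.
have [|s sE] := @smooth_scal _ _ U (fun y => (Num.sqrt (ip g X X y))^-1).
  move=> j; apply: Ck_on_inv; first exact: dset_open.
    by move=> y Uy; rewrite gt_eqF// sqrtr_gt0 X0.
  by apply: Ck_on_sqrt; [exact: dset_open|exact: X0|exact: smo_smooth].
have [||fr [f1 f2 f3 orth]] := @unit_frame _ (@derS R 3 U) (halfS U) g gi f x e (s *: X) (halfS2 U)
    (rp_ak ac Uc RP AK) (rp_etaxi ac Uc RP).
- by rewrite -scalemxAr eX scaler0.
- rewrite ipZl ipZr; apply: smoP => y Uy; rewrite !evE ev1// sE//.
  have s0 : Num.sqrt (ip g X X y) != 0 by rewrite gt_eqF// sqrtr_gt0 X0.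
  by rewrite -[X in _ * (_ * X)]sqr_sqrtr ?ltW ?X0// expr2 mulKf// mulVf.
- by exists fr, s; split=> //; rewrite f2 f1.
Qed.

(** All four facts are read off an orthonormal frame $(e_1,\varphi e_1,\xi)$ near
the point, in which $h'$ has entries $p,q,q,-p$ with $p^2+q^2=-1-\kappa$. If that
sum were $0$ then $h'$, hence $h$, would vanish; and $h'+\lambda$ does not vanish on
$\xi^\perp$ because $h'$ is trace free there and $\lambda\neq0$. *)
Lemma h'_at : [/\ 0 < - 1 - kappa p, H p *m H p = (- 1 - kappa p) *: (1%:M - xi S c p *m eta S c p),
  eta S c p *m H p = 0 &
  exists w : 'cV[R]_3, (H p + (Num.sqrt (- 1 - kappa p))%:M) *m (w - xi S c p *m (eta S c p *m w)) <> 0].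
Proof.
(* 1 and xi eta have different traces, so some coordinate vector is not a multiple of xi *)
have [j Yj] : exists j, (delta_mx j 0 : 'cV[R]_3) - xi S c p *m (eta S c p *m delta_mx j 0) != 0.
  apply: contrapT => nj.
  have E : 1%:M = xi S c p *m eta S c p.
    apply/matrixP => a b; have /negP/negPn/eqP/subr0_eq/colP/(_ a) : ~ ((delta_mx b 0 : 'cV[R]_3) -
      xi S c p *m (eta S c p *m delta_mx b 0) != 0) by move=> h; apply: nj; exists b.
    by rewrite mulmxA -!colE !mxE => <-; rewrite eqxx andbT.
  have : \tr (1%:M : 'M[R]_3) = 1 by rewrite E mxtrace_mulC acm_etaxi// mxtrace1.
  rewrite mxtrace1 => /eqP; rewrite -subr_eq0 -{2}[1]/(1%:R) -natrB// pnatr_eq0.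
  by [].
have [g [gi [f [x [e [k [m RP]]]]]]] := @represents_exists R M S kappa mu c codU ac (fun _ h => h) ks ms.
pose Y : 'cV[smo codU]_3 := delta_mx j 0 - x *m (e *m delta_mx j 0).
have N0 : 0 < ip g Y Y x0.
  rewrite ev_ip -(rp_g RP)// chart_mapK//; apply: metric_pos => //.
  rewrite /Y evmD evmN !evmM evm_delta//.
  by rewrite -(rp_xi RP)// -(rp_eta RP)// chart_mapK.
have [U [Ux0 UN]] := pos_dom (U := codU) cx0 N0.
have Uc y : U y -> chart_cod c y by move=> /UN[].
have [g1 [gi1 [f1 [x1 [e1 [k1 [m1 RP1]]]]]]] := @represents_exists R M S kappa mu c U ac Uc ks ms.
pose Y1 : 'cV[smo U]_3 := delta_mx j 0 - x1 *m (e1 *m delta_mx j 0).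
have ex := rp_etaxi ac Uc RP1.
have eY1 : e1 *m Y1 = 0 by rewrite /Y1 mulmxBr (mulmxA e1 x1) ex mul1mx subrr.
have Y1pos y : U y -> 0 < ip g1 Y1 Y1 y.
  move=> Uy; have [cy] := UN y Uy; rewrite !ev_ip -(rp_g RP)// -(rp_g RP1)//.
  rewrite /Y /Y1 !evmD !evmN !evmM !evm_delta//.
  by rewrite -(rp_xi RP)// -(rp_eta RP)// -(rp_xi RP1)// -(rp_eta RP1).
have [fr [s [fr1 fr2 fr3 orth]]] := unit_frame_on Uc RP1 eY1 Y1pos.
have AK1 := rp_ak ac Uc RP1 AK; have KM1 := rp_kmu ac Uc RP1 KM.
have [a [b [he1 he2 he3 ab]]] := h'_frame_kappa (@derS_dsys _ _ U) (halfS2 U) AK1 orth fr3 fr2 KM1.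
set h' := halfS U *: _ *m _ in he1 he2 he3.
have HE : H p = evm x0 h' by rewrite -(rp_h' Uc RP1)// chart_mapK.
have kE : kappa p = k1 x0 by rewrite -(rp_k RP1)// chart_mapK.
have abx : a x0 * a x0 + b x0 * b x0 = - 1 - kappa p.
  by rewrite kE -!evM -evD ab !evE ev1.
have eh : e1 *m h' = 0.
  apply: (frame_ext orth) => l; rewrite mul0mx -mulmxA.
  have ee i : e1 *m fr i = (it == i)%:R%:M.
    by rewrite (rp_etag ac Uc RP1) -fr3 [LHS]scalar11 -[_ 0 0]/(ip _ _ _) orth.
  by case: (ord3P l) => ->; rewrite ?he1 ?he2 ?he3 ?mulmx0 ?mulmxDr ?mulmxN -?scalemxAr ?ee /=
     ?(scaler0, raddf0, subrr, addr0, oppr0).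
have hh : h' *m h' = (- 1 - k1) *: (1%:M - x1 *m e1).
  apply: (frame_ext orth) => l; rewrite -ab -(mulmxA h' h') -scalemxAl mulmxBl mul1mx -(mulmxA x1 e1).
  have ee i : e1 *m fr i = (it == i)%:R%:M.
    by rewrite (rp_etag ac Uc RP1) -fr3 [LHS]scalar11 -[_ 0 0]/(ip _ _ _) orth.
  case: (ord3P l) => ->; rewrite ee /=.
  - rewrite he1 mulmxDr -!scalemxAr he1 he2 raddf0 mulmx0 subr0.
    by apply/colP => i; rewrite !mxE; ring.
  - rewrite he2 mulmxBr -!scalemxAr he1 he2 raddf0 mulmx0 subr0.
    by apply/colP => i; rewrite !mxE; ring.
  - by rewrite he3 mulmx0 mulmx1 fr3 subrr scaler0.
have k0 : 0 < - 1 - kappa p.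
  rewrite lt_neqAle -{2}abx addr_ge0 ?andbT; last 2 first.
  - by rewrite -expr2 sqr_ge0.
  - by rewrite -expr2 sqr_ge0.
  apply/negP => /eqP k0; rewrite -k0 in abx.
  have [a0 b0] : a x0 = 0 /\ b x0 = 0.
    have := sqr_ge0 (a x0); have := sqr_ge0 (b x0); move: abx; rewrite -!expr2 => E h1 h2.
    by split; apply/eqP; rewrite -sqrf_eq0; apply/eqP; lra.
  have H0 : H p = 0.
    rewrite HE; have := @frame_ext R (evm x0 g1) (fun i => evm x0 (fr i)) 3 (evm x0 h') 0.
    apply=> [i l|i]; first by rewrite -(ev_nat _ Ux0) -orth ev_ip.
    rewrite mul0mx -evmM; case: (ord3P i) => ->; rewrite ?he1 ?he2 ?he3 ?evm0//.
      by rewrite evmD !evmZ a0 b0 !scale0r addr0.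
    by rewrite evmD evmN !evmZ a0 b0 !scale0r subr0.
  apply: (hn ac cp).
  have := H0; rewrite /h'_tensor => /(congr1 (mulmx^~ (phi S c p))).
  rewrite mul0mx -mulmxA acm_phi2// mulmxDr mulmxN mulmx1 mulmxA.
  have -> : h_tensor S c p *m xi S c p = 0.
    have := rp_h Uc RP1 Ux0; rewrite chart_mapK// => ->.
    have := rp_xi RP1 Ux0; rewrite chart_mapK// => ->.
    rewrite evmZ -scalemxAl -evmM (lie_xi (@derS_dsys _ _ U) (rp_phixi ac Uc RP1)).
    by rewrite evm0 scaler0.
  by rewrite mul0mx addr0 => /eqP; rewrite oppr_eq0 => /eqP.
have xE : xi S c p = evm x0 x1 by rewrite -(rp_xi RP1)// chart_mapK.
have eE : eta S c p = evm x0 e1 by rewrite -(rp_eta RP1)// chart_mapK.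
split=> //.
- rewrite HE -evmM hh evmZ evmD evmN evm1// evmM xE eE kE.
  by rewrite evD evN evN ev1.
- by rewrite eE HE -evmM eh evm0.
- apply: contrapT => nw.
  have {}nw (w : 'cV[R]_3) : (H p + (Num.sqrt (- 1 - kappa p))%:M) *m (w - xi S c p *m (eta S c p *m w)) = 0.
    by apply: contrapT => h; apply: nw; exists w.
  have ee i : i != it -> eta S c p *m evm x0 (fr i) = 0.
    move=> /negPf ii; rewrite eE -evmM (rp_etag ac Uc RP1) -fr3 [X in evm _ X]scalar11.
    by rewrite -[_ 0 0]/(ip _ _ _) orth eq_sym ii raddf0 evm0.
  have o i l : ip (evm x0 g1) (evm x0 (fr i)) (evm x0 (fr l)) = (i == l)%:R.
    by rewrite -[LHS]/(ev2 _ _ _) -ev_ip orth (ev_nat _ Ux0).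
  have := nw (evm x0 (fr ix1)); have := nw (evm x0 (fr ix2)).
  rewrite !ee// mulmx0 !subr0 !mulmxDl !mul_scalar_mx HE -!evmM he1 he2.
  rewrite !evmD evmN !evmZ; set s0 := Num.sqrt _.
  move=> /(congr1 (ip (evm x0 g1) (evm x0 (fr ix2)))).
  rewrite !(ipDr, ipNr, ipZr) ip0r !o /= => E2.
  move=> /(congr1 (ip (evm x0 g1) (evm x0 (fr ix1)))).
  rewrite !(ipDr, ipNr, ipZr) ip0r !o /= => E1.
  have : 0 < s0 by rewrite sqrtr_gt0.
  lra.
Qed.
End InChart.
End Forward.

(** * Frames of eigenvectors of h' *)

Section EigenFrame.
Variables (R : realType) (M : manifold R 3) (S : acm M) (kappa mu : M -> R).
Hypothesis AK : almost_kenmotsu S.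
Hypothesis KM : generalized_kappa_mu' S kappa mu.
Hypotheses (ks : smooth_fun kappa) (ms : smooth_fun mu).
Hypothesis dk : forall (c : mchart M) (p : M), atlas c -> chart_dom c p ->
  wedge11 (grad c kappa p) (eta S c p) = 0.
Hypothesis hn : forall (c : mchart M) (p : M), atlas c -> chart_dom c p ->
  h_tensor S c p <> 0.
Variables (c : mchart M).
Hypothesis ac : atlas c.
Notation H := (h'_tensor S c).

Definition lambda_of (k : M -> R) (q : M) : R := Num.sqrt (- 1 - k q).

(** As $h'^2=\lambda^2$ on $\xi^\perp$, the image of $\xi^\perp$ under
$h'+\lambda$ consists of eigenvectors. *)
Definition eigenvector (w : 'cV[R]_3) (q : M) : 'cV[R]_3 :=
  (H q + (lambda_of kappa q)%:M) *m (w - xi S c q *m (eta S c q *m w)).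

Section OnDomain.
Variable U : sdom R 3.
Hypothesis Uc : forall x, U x -> chart_cod c x.
Notation dS := (@derS R 3 U).
Notation hS := (halfS U).
Let domU y (Uy : U y) : chart_dom c (chart_inv c y) := chart_inv_dom (Uc Uy).
Let kpos y : U y -> 0 < - 1 - kappa (chart_inv c y).
Proof. by move=> Uy; have [] := h'_at AK KM ks ms hn ac (domU Uy). Qed.

Lemma lambda_repr : exists lam lami : smo U, [/\ lam * lami = 1 &
  forall y, U y -> lam y = lambda_of kappa (chart_inv c y)].
Proof.
have [k kE] := repr_fun_exists Uc (ks ac).
have k0 y : U y -> 0 < (- 1 - k) y.
  by move=> Uy; rewrite !evE ev1// -kE//; exact: kpos.
have s1 : smooth_on (dset U) (fun y => Num.sqrt ((- 1 - k) y)).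
  by move=> j; apply: Ck_on_sqrt; [exact: dset_open|exact: k0|exact: smo_smooth].
have [lam lE] := smooth_scal s1.
have [|lami liE] := @smooth_scal _ _ U (fun y => (Num.sqrt ((- 1 - k) y))^-1).
  move=> j; apply: Ck_on_inv; [exact: dset_open| |exact: s1].
  by move=> y Uy; rewrite gt_eqF// sqrtr_gt0 k0.
exists lam, lami; split.
  apply: smoP => y Uy; rewrite evM lE// liE// ev1// mulfV//.
  by rewrite gt_eqF// sqrtr_gt0 k0.
by move=> y Uy; rewrite lE// !evE ev1// /lambda_of kE.
Qed.

Variables (g gi f : 'M[smo U]_3) (x : 'cV[smo U]_3) (e : 'rV[smo U]_3) (k m : smo U).
Hypothesis RP : represents S kappa mu c g gi f x e k m.
Let h' := hS *: lie dS x f *m f.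

Lemma eigenvector_repr (lam : smo U) w : (forall y, U y -> lam y = lambda_of kappa (chart_inv c y)) ->
  repr_mx c (eigenvector w) ((h' + lam%:M) *m (map_mx (cstS U) w - x *m (e *m map_mx (cstS U) w))).
Proof.
move=> lE y Uy.
have wE : evm y (map_mx (cstS U) w) = w by apply/matrixP => i j; rewrite 2!mxE ev_cst.
have lME : evm y lam%:M = (lambda_of kappa (chart_inv c y))%:M :> 'M[R]_3.
  by apply/matrixP => i j; rewrite !mxE; case: eqP; rewrite ?mulr1n ?mulr0n ?ev0// lE.
have hE : evm y h' = H (chart_inv c y) by rewrite (rp_h' Uc RP).
rewrite /eigenvector evmM (evmD h') lME hE evmD evmN !evmM wE.
by rewrite -(rp_xi RP)// -(rp_eta RP).
Qed.

Lemma ring_h'2 : h' *m h' = (- 1 - k) *: (1%:M - x *m e).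
Proof.
apply: evmP => y Uy; have [_ + _ _] := h'_at AK KM ks ms hn ac (domU Uy).
rewrite (rp_h' Uc RP Uy) -/h' evmM => ->.
rewrite evmZ evmD evmN evm1// evmM evD !evN ev1//.
by rewrite (rp_k RP Uy) (rp_xi RP Uy) (rp_eta RP Uy).
Qed.

Lemma ring_etah' : e *m h' = 0.
Proof.
apply: evmP => y Uy; have [_ _ + _] := h'_at AK KM ks ms hn ac (domU Uy).
by rewrite (rp_h' Uc RP Uy) -/h' evmM evm0 (rp_eta RP Uy).
Qed.

(** $d\kappa\wedge\eta=0$ says that $d\kappa=\xi(\kappa)\eta$, and $\lambda$ is
a function of $\kappa$. *)
Lemma dlambda (lam lami : smo U) : lam * lami = 1 -> lam * lam = - 1 - k ->
  forall i, dS i lam = dir dS x lam * e 0 i.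
Proof.
move=> ll l2 i; have HD := @derS_dsys _ _ U.
have dk' := rp_dkappa Uc RP (fun p => @dk c p ac).
have ex : \sum_j x j 0 * e 0 j = 1.
  have := rp_etaxi ac Uc RP => /matrixP/(_ 0 0); rewrite !mxE eqxx mulr1n => <-.
  by apply: eq_bigr => j _; rewrite mulrC.
have dkE j : dS j k = dir dS x k * e 0 j.
  rewrite -[LHS]mulr1 -ex mulr_sumr /dir mulr_suml; apply: eq_bigr => l _.
  by rewrite mulrCA dk'; ring.
have dll X : lam * dir dS X lam + lam * dir dS X lam = - dir dS X k.
  rewrite -{1}[lam * _]mulrC -(dirM HD) l2 (dirD HD) !(dirN HD) (dir1 HD); ring.
have dii := dll (delta_mx i 0); rewrite !dir_delta dkE in dii.
have dxx := dll x.
have : lami * lam * (dS i lam - dir dS x lam * e 0 i) = 0.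
  apply: (two_inj (halfS2 U)).
  have -> : lami * lam * (dS i lam - dir dS x lam * e 0 i) +
     lami * lam * (dS i lam - dir dS x lam * e 0 i) =
     lami * ((lam * dS i lam + lam * dS i lam) -
             (lam * dir dS x lam + lam * dir dS x lam) * e 0 i) by ring.
  by rewrite dii dxx; ring.
by rewrite [lami * lam]mulrC ll mul1r => /subr0_eq.
Qed.

Record eigenframe (lam lami : smo U) (fr : 'I_3 -> 'cV[smo U]_3) : Prop := Eigenframe {
  ef_lam : forall y, U y -> lam y = lambda_of kappa (chart_inv c y);
  ef_lami : lam * lami = 1;
  ef_orth : forall a b, ip g (fr a) (fr b) = (a == b)%:R;
  ef_xi : fr it = x;
  ef_phi : fr ix2 = f *m fr ix1;
  ef_dlam : forall i, dS i lam = - (m + 1 + 1) * lam * e 0 i;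
  ef_brk12 : brk dS (fr ix1) (fr ix2) = 0;
  ef_brk13 : brk dS (fr ix1) (fr it) = (1 + lam) *: fr ix1;
  ef_brk23 : brk dS (fr ix2) (fr it) = (1 - lam) *: fr ix2
}.

Theorem eigenframe_exists w :
  (forall y, U y -> let q := chart_inv c y in 0 < ev2 (met S c q) (eigenvector w q) (eigenvector w q)) ->
  exists lam lami fr, eigenframe lam lami fr.
Proof.
move=> pos; have HD := @derS_dsys _ _ U.
have [lam [lami [ll lE]]] := lambda_repr.
have XE := eigenvector_repr w lE.
set v := map_mx _ w - _ in XE; set X := _ *m v in XE.
have ex := rp_etaxi ac Uc RP.
have ev : e *m v = 0 by rewrite /v mulmxBr (mulmxA e x) ex mul1mx subrr.
have eX : e *m X = 0.
  by rewrite /X mulmxA mulmxDr ring_etah' add0r mul_mx_scalar -scalemxAl ev scaler0.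
have l2 : lam * lam = - 1 - k.
  apply: smoP => y Uy; rewrite !evE ev1// lE// -expr2 sqr_sqrtr ?ltW ?kpos//.
  by rewrite (rp_k RP).
have hX : h' *m X = lam *: X.
  rewrite /X mulmxA mulmxDr ring_h'2 mul_mx_scalar mulmxDl mulmxDl -l2.
  rewrite -(scalemxAl (lam * lam)) mulmxBl mul1mx -(mulmxA x) ev mulmx0 subr0.
  by rewrite mul_scalar_mx (scalerDr lam (h' *m v)) scalerA addrC -scalemxAl.
have Xpos y : U y -> 0 < ip g X X y.
  by move=> Uy; rewrite ev_ip -(rp_g RP)// -XE//; exact: pos.
have [fr [s [fr1 fr2 fr3 orth]]] := unit_frame_on AK ac Uc RP eX Xpos.
have AK1 := rp_ak ac Uc RP AK; have KM1 := rp_kmu ac Uc RP KM.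
have he1 : h' *m fr ix1 = lam *: fr ix1.
  by rewrite fr1 -scalemxAr hX !scalerA mulrC.
have dl := dlambda ll l2.
have dirl V : dir dS V lam = dir dS x lam * (e *m V) 0 0.
  rewrite {1}/dir mxE mulr_sumr; apply: eq_bigr => i _; rewrite dl; ring.
have eV i : (e *m fr i) 0 0 = (it == i)%:R.
  by rewrite (rp_etag ac Uc RP) -fr3 -[LHS]/(ip _ _ _) orth.
have d1 : dir dS (fr ix1) lam = 0 by rewrite dirl eV mulr0.
have d2 : dir dS (fr ix2) lam = 0 by rewrite dirl eV mulr0.
have [d3 b12 b13 b23] := eigenframe_brackets HD (halfS2 U) AK1 orth fr3 fr2 KM1 ll he1 d1 d2.
exists lam, lami, fr; split=> //.
by move=> i; rewrite dl -fr3 d3.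
Qed.

End OnDomain.

(** For constant [w] the field [eigenvector w] is continuous, so it stays nonzero
near a point where it is nonzero. *)
Lemma eigenfield p : chart_dom c p -> exists (A : sdom R 3) (w : 'cV[R]_3),
  [/\ A (chart_map c p), forall y, A y -> chart_cod c y &
  forall y, A y -> let q := chart_inv c y in 0 < ev2 (met S c q) (eigenvector w q) (eigenvector w q)].
Proof.
move=> cp; have cx0 := chart_map_cod cp.
pose U : sdom R 3 := Sdom (@chart_cod_open _ _ _ c) (ex_intro _ (chart_map c p) cx0).
have Uc y : U y -> chart_cod c y by [].
have [g [gi [f [x [e [k [m RP]]]]]]] := represents_exists S (U := U) ac Uc ks ms.
have [lam [lami [ll lE]]] := lambda_repr Uc.
have [k0 _ _ [w w0]] := h'_at AK KM ks ms hn ac cp.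
have XE := eigenvector_repr Uc RP w lE; set X := _ *m _ in XE.
have X0 : 0 < ip g X X (chart_map c p).
  rewrite ev_ip -(rp_g RP)// -XE// chart_mapK//; apply: metric_pos => //.
  exact/eqP.
have [A [Ap AU]] := pos_dom (U := U) cx0 X0.
exists A, w; split=> // [y /AU[]//|y /AU[Uy]].
by rewrite ev_ip -(rp_g RP)// -XE.
Qed.

End EigenFrame.

(** * Functions of one coordinate *)

Section OneVariable.
Variable R : realType.

Lemma pd_comp n (A : set 'rV[R]_n) (i : 'I_n) (u : R -> R) (du : R) f x : open A -> A x ->
  Ck_on 1 A f -> is_derive (f x) 1 (u : R -> R^o) du ->
  is_derive x (delta_mx 0 i) ((fun y => u (f y)) : 'rV[R]_n -> R^o) (du * pd i f x).
Proof.
by move=> oA Ax fs; apply: is_derive_outer; exact: Ck_on_is_derive fs Ax.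
Qed.

Definition mx2 (a b c d : R) : 'M[R]_2 :=
  \matrix_(i, j) if i == 0 then if j == 0 then a else b else if j == 0 then c else d.

Let j0 : ix1 = lshift 1 (0 : 'I_2). Proof. exact: val_inj. Qed.
Let j1 : ix2 = lshift 1 (1 : 'I_2). Proof. exact: val_inj. Qed.
Let j2 : it = rshift 2 (0 : 'I_1). Proof. exact: val_inj. Qed.

Lemma blkE (A : 'M[R]_2) a : ((blk A a ix1 ix1 = A 0 0) * (blk A a ix1 ix2 = A 0 1) *
  (blk A a ix2 ix1 = A 1 0) * (blk A a ix2 ix2 = A 1 1) * (blk A a ix1 it = 0) *
  (blk A a ix2 it = 0) * (blk A a it ix1 = 0) * (blk A a it ix2 = 0) * (blk A a it it = a))%type.
Proof.
rewrite /blk j0 j1 j2; do !split;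
  first [exact: block_mxEul | rewrite [LHS]block_mxEur | rewrite [LHS]block_mxEdl
        | rewrite [LHS]block_mxEdr]; by rewrite mxE.
Qed.

Lemma is_derive_blk (ph : R -> 'M[R]_2) (dph : 'M[R]_2) a (t : R) (k l : 'I_3) :
  (forall i j, is_derive t 1 ((fun s => ph s i j) : R -> R^o) (dph i j)) ->
  is_derive t 1 ((fun s => blk (ph s) a k l) : R -> R^o) (blk dph 0 k l).
Proof.
move=> d; case: (ord3P k) => ->; case: (ord3P l) => ->; rewrite !blkE.
all: under eq_fun do rewrite blkE; first [exact: d|exact: is_derive_cst].
Qed.

End OneVariable.

Section ChartOneVariable.
Variables (R : realType) (M : manifold R 3) (c : mchart M).

Lemma pder_tcoord i q : chart_dom c q -> pder c i (tcoord c) q = (i == it)%:R.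
Proof.
move=> cq; have /matrixP/(_ it i) := jac_id cq; rewrite !mxE eq_sym => <-.
by [].
Qed.

Lemma coord_smooth : smooth_on (chart_cod c) (fun y : 'rV[R]_3 => y 0 it).
Proof. by move=> k; apply: Ck_on_coord; exact: chart_cod_open. Qed.

Lemma tcoord_inv y : chart_cod c y -> tcoord c (chart_inv c y) = y 0 it.
Proof. by move=> cy; rewrite /tcoord chart_invK. Qed.

Lemma pder_fun_t i (F : M -> R) (u : R -> R) (du : R) q : chart_dom c q ->
  (forall q, chart_dom c q -> F q = u (tcoord c q)) ->
  is_derive (tcoord c q) 1 (u : R -> R^o) du -> pder c i F q = du * (i == it)%:R.
Proof.
move=> cq FE ud; rewrite -(pder_tcoord i cq).
have oc := @chart_cod_open _ _ _ c; have cx := chart_map_cod cq.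
rewrite /pder -!pdE.
rewrite (pd_eq (A := chart_cod c) i oc (g := fun y => u (y 0 it)))//; last first.
  by move=> y cy; rewrite FE ?tcoord_inv//; exact: chart_inv_dom.
rewrite (pd_eq (A := chart_cod c) i oc (f := fun y => tcoord c (chart_inv c y)) (g := fun y => y 0 it))//; last first.
  by move=> y cy; rewrite tcoord_inv.
by rewrite [LHS]pdE; have [_ ->] := pd_comp (A := chart_cod c) i oc cx (coord_smooth 1%N) ud.
Qed.

Lemma pder_cst i (a : R) q : pder c i (fun=> a) q = 0.
Proof. exact: (@derive_cst R 'rV[R]_3 R^o). Qed.

(** Two points of a box with the same $t$ are joined by a segment of the box, along
which the derivative vanishes. *)
Lemma box_one_variable (y0 : 'rV[R]_3) (r : R) (F : M -> R) (s : M -> R) :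
  chart_cod c = [set y | `|y - y0| < r] -> smooth_in c F ->
  (forall q, chart_dom c q -> grad c F q = s q *: delta_mx 0 it) ->
  exists u : R -> R, forall q, chart_dom c q ->
    F q = u (tcoord c q) /\ is_derive (tcoord c q) 1 (u : R -> R^o) (s q).
Proof.
move=> cE Fs dF; pose G y := F (chart_inv c y); pose v : 'rV[R]_3 := delta_mx 0 it.
have oc := @chart_cod_open _ _ _ c.
have dG y j : chart_cod c y -> pd j G y = s (chart_inv c y) * (j == it)%:R.
  move=> cy; have /rowP/(_ j) := dF _ (chart_inv_dom cy).
  by rewrite !mxE eqxx /= => <-; rewrite /pder chart_invK// pdE.
pose P (t : R) := t *: v + (y0 - y0 0 it *: v).
pose u t := G (P t).
have main y : chart_cod c y -> G y = u (y 0 it).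
  move=> cy; set z := P (y 0 it).
  have yr : `|y - y0| < r by move: cy; rewrite cE.
  have zr : `|z - y0| < r.
    have -> : z - y0 = (y - y0) 0 it *: v.
      by apply/rowP => j; rewrite !mxE; ring.
    apply: le_lt_trans yr; rewrite normrZ -[leRHS]mulr1.
    apply: ler_pM => //; first exact: rV_coord_le.
    apply: rV_norm_le => // j; rewrite mxE; case: (_ && _); rewrite ?normr1 ?normr0//.
  have [|a _] := @mvt_line R 3 G (fun=> 0) z (y - z).
    move=> a aI; have ca : chart_cod c (a *: (y - z) + z).
      by rewrite cE /=; exact: normball_convex.
    have := @C1_is_derive R 3 _ G _ (y - z) oc (Fs 1%N) ca.
    rewrite big1// => j _; rewrite dG// !mxE.
    case: (eqVneq j it) => [->|_]; last by rewrite !mulr0.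
    by rewrite !eqxx /=; ring.
  by rewrite subrK => /subr0_eq.
exists u => q cq; have cx := chart_map_cod cq; split.
  by have := main _ cx; rewrite {1}/G chart_mapK.
set x := chart_map c q in cx *; rewrite -/(x 0 it).
pose w : 'rV[R]_3 := x - x 0 it *: v.
have E : x 0 it *: v + w = x by rewrite addrC subrK.
apply: (@near_eq_is_derive R R^o R^o (fun t => G (t *: v + w))).
  have ct : {for x 0 it, continuous (fun t : R => t *: v + w)}.
    have d : is_derive (x 0 it) (1 : R) (fun t : R => t *: v + w) v.
      by apply/(@is_derive_line R _ 'rV[R]_3 idfun w v (x 0 it)).
    by case: d => /derivable1_diffP/differentiable_continuous.
  have nx := open_near oc cx; rewrite -E in nx.
  have nt : \forall t \near x 0 it, chart_cod c (t *: v + w) by exact: (ct _ nx).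
  near=> t; have ct' : chart_cod c (t *: v + w) by near: t.
  by rewrite main//; congr u; rewrite !mxE !eqxx /=; ring.
apply/(@is_derive_line R 'rV[R]_3 R^o G w v (x 0 it)); rewrite E.
have dd := Ck_on_is_derive it (Fs 1%N) cx; apply: (is_derive_eq dd).
by rewrite dG// eqxx mulr1 /x chart_mapK.
Unshelve. all: by end_near. Qed.

End ChartOneVariable.

Lemma derS_exp (R : realType) n (U : sdom R n) (f : smo U) : exists F : smo U,
  (forall y, U y -> F y = expR (f y)) /\ forall i, derS i F = F * derS i f.
Proof.
have [|F FE] := @smooth_scal _ _ U (fun y => expR (f y)).
  by move=> k; apply: Ck_on_exp; [exact: dset_open|exact: smo_smooth].
exists F; split=> // i; apply: smoP => y Uy; rewrite evM !ev_der// FE//.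
rewrite (pd_eq i (dset_open U) FE)// pdE.
by have [_ ->] := pd_comp (A := dset U) i (dset_open U) Uy (@smo_smooth _ _ _ f 1%N) (is_derive_expR (f y)).
Qed.

(** * Adapted coordinates *)

Fact normball_center (R : realType) n (x0 : 'rV[R]_n) (r : R) : 0 < r ->
  [set x | `|x - x0| < r] x0.
Proof. by rewrite /= subrr normr0. Qed.

Definition ballU (R : realType) n (x0 : 'rV[R]_n) (r : R) (r0 : 0 < r) : sdom R n :=
  @Sdom R n [set x | `|x - x0| < r] (@open_normball R n x0 r)
    (ex_intro _ x0 (normball_center x0 r0)).

Section Coordinates.
Variables (R : realType) (M : manifold R 3) (S : acm M) (kappa mu : M -> R).
Hypothesis AK : almost_kenmotsu S.
Hypothesis KM : generalized_kappa_mu' S kappa mu.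
Hypotheses (ks : smooth_fun kappa) (ms : smooth_fun mu).
Hypothesis dk : forall (c : mchart M) (p : M), atlas c -> chart_dom c p ->
  wedge11 (grad c kappa p) (eta S c p) = 0.
Hypothesis hn : forall (c : mchart M) (p : M), atlas c -> chart_dom c p ->
  h_tensor S c p <> 0.
Notation lambda := (lambda_of kappa).

Lemma kappa_lt (p : M) : 0 < - 1 - kappa p.
Proof.
have [c ac cp] := atlas_cover p.
by have [] := h'_at AK KM ks ms hn ac cp.
Qed.

Lemma lambda_smooth : smooth_fun lambda.
Proof.
move=> c ac k; have oc := @chart_cod_open _ _ _ c.
apply: Ck_on_sqrt => //; first by move=> x _; exact: kappa_lt.
by apply: Ck_onD => //; [exact: Ck_on_cst|apply: Ck_onN => //; exact: ks].
Qed.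

Lemma lambda_grad (c : mchart M) q : atlas c -> chart_dom c q ->
  grad c lambda q = (- (mu q + 2) * lambda q) *: eta S c q.
Proof.
move=> ac cq; have [A [w [Aq Ac Aw]]] := eigenfield AK KM ks ms hn ac cq.
have [g [gi [f [x [e [k [m RP]]]]]]] := represents_exists S (U := A) ac Ac ks ms.
have [lam [lami [fr EF]]] := eigenframe_exists AK KM ks ms dk hn ac Ac RP Aw.
apply/rowP => i; rewrite !mxE -(chart_mapK cq).
rewrite (pder_repr Ac i (f := lam))//; last by move=> y Ay; rewrite (ef_lam EF).
rewrite (ef_dlam EF) !evE ev1// (rp_m RP)// (rp_eta RP)// evm_entry -(ef_lam EF)//.
by rewrite -addrA.
Qed.

Lemma grad_change (c d : mchart M) (W : set 'rV[R]_3) (F : M -> R) q : atlas c -> atlas d ->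
  open W -> smooth_on W (fun y => F (chart_inv d y)) ->
  chart_dom c q -> chart_dom d q -> W (chart_map d q) ->
  grad c F q = grad d F q *m jac c d q.
Proof.
move=> ac ad oW Fs cq dq Wq; apply/rowP => j; rewrite !mxE.
rewrite (pder_change j ac ad oW Fs cq dq Wq); apply: eq_bigr => i _.
by rewrite [X in _ = X * _]mxE mulrC.
Qed.

(** Closed forms $\eta=dt$ and $(1+\lambda)\eta=du$ provide the growth rates
$a=e^u$ and $b=e^{2t-u}$ of the eigenvectors $e_1$ and $e_2$. The forms dual to
$be_2,ae_1,\xi$ are then closed; their potentials are the coordinates
$x_1,x_2,t$. Here [s] and [si] are $a/b$ and $b/a$. *)
Theorem coframe_chart p : exists (c : mchart M) (y0 : 'rV[R]_3) (r : R) (u : M -> R),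
  [/\ atlas c, chart_dom c p, chart_cod c = [set y | `|y - y0| < r], smooth_in c u &
  forall q, chart_dom c q ->
    let t := tcoord c q in let s := expR (2 * u q - 2 * t) in let si := expR (2 * t - 2 * u q) in
    [/\ grad c u q = (1 + lambda q) *: delta_mx 0 it,
        phi S c q = blk (mx2 0 s (- si) 0) 0,
        xi S c q = delta_mx it 0, eta S c q = delta_mx 0 it &
        met S c q = blk (mx2 (expR (2 * t) * si) 0 0 (expR (2 * t) * s)) 1]].
Proof.
have [c0 ac0 c0p] := atlas_cover p; set x0 := chart_map c0 p.
have [A [w [Ap Ac Aw]]] := eigenfield AK KM ks ms hn ac0 c0p.
have /nbhs_ballP[r0 /= r00 r0A] := open_near (dset_open A) Ap.
rewrite rV_ballE in r0A.
(* the closed forms $\eta$ and $(1+\lambda)\eta$ have potentials t and u *)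
have [r1 [T [u0 [r10 r1A Ts us [dT du]]]]] : exists (r1 : R) (T u0 : 'rV[R]_3 -> R),
  [/\ 0 < r1, forall y, `|y - x0| < r1 -> A y, smooth_on [set x | `|x - x0| < r1] T,
   smooth_on [set x | `|x - x0| < r1] u0 &
   (forall i y, `|y - x0| < r1 -> pd i T y = eta S c0 (chart_inv c0 y) 0 i) /\
   (forall i y, `|y - x0| < r1 -> pd i u0 y =
       (1 + lambda (chart_inv c0 y)) * eta S c0 (chart_inv c0 y) 0 i)].
  pose U := ballU x0 r00.
  have UA y : U y -> A y by exact: r0A.
  have Uc y : U y -> chart_cod c0 y by move=> /UA/Ac.
  have [g [gi [f [x [e [k [m RP]]]]]]] := represents_exists S (U := U) ac0 Uc ks ms.
  have [lam [lami [fr EF]]] := eigenframe_exists AK KM ks ms dk hn ac0 Uc RP (fun y Uy => Aw y (UA y Uy)).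
  have AK1 := rp_ak ac0 Uc RP AK; have de := ak_deta AK1.
  have HD := @derS_dsys _ _ U.
  have [|s1 [T [s10 s1r Ts dT]]] := @poincare R 3 x0 r0 (fun i => smo_val (e 0 i)) r00
      (fun i => @smo_smooth _ _ _ (e 0 i)).
    by move=> i j y Uy; have := de i j => /(congr1 (fun f : smo U => f y)); rewrite !ev_der.
  have [|s2 [u0 [s20 s2r us du]]] := @poincare R 3 x0 r0 (fun i => smo_val ((1 + lam) * e 0 i)) r00
      (fun i => @smo_smooth _ _ _ ((1 + lam) * e 0 i)).
    move=> i j y Uy; rewrite -!(ev_der (U := U))//; congr (smo_val _ y).
    by rewrite !(dsysM HD) !(dsysD HD) !(dsys1 HD) !(ef_dlam EF) de; ring.
  exists (Num.min s1 s2), T, u0; split.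
  - by rewrite lt_min s10 s20.
  - by move=> y; rewrite lt_min => /andP[ys _]; apply: r0A; apply: lt_le_trans ys s1r.
  - by apply: smooth_on_sub Ts => y; rewrite /= lt_min => /andP[].
  - by apply: smooth_on_sub us => y; rewrite /= lt_min => /andP[].
  - split=> i y; rewrite lt_min => /andP[y1 y2].
      rewrite dT// (rp_eta RP) ?evm_entry//; exact: lt_le_trans y1 s1r.
    have Uy : U y by exact: lt_le_trans y1 s1r.
    by rewrite du// !evE ev1// (rp_eta RP)// evm_entry (ef_lam EF).
pose U := ballU x0 r10.
have UA y : U y -> A y by exact: r1A.
have Uc y : U y -> chart_cod c0 y by move=> /UA/Ac.
have [g [gi [f [x [e [k [m RP]]]]]]] := represents_exists S (U := U) ac0 Uc ks ms.
have [lam [lami [fr EF]]] := eigenframe_exists AK KM ks ms dk hn ac0 Uc RP (fun y Uy => Aw y (UA y Uy)).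
have AK1 := rp_ak ac0 Uc RP AK; have HD := @derS_dsys _ _ U.
have gs := ak_gsym AK1.
have orth := ef_orth EF.
have eV i : (e *m fr i) 0 0 = (it == i)%:R.
  by rewrite (rp_etag ac0 Uc RP) -(ef_xi EF) -[LHS]/(ip _ _ _) orth.
have [tS tE] := smooth_scal (U := U) Ts; have [uS uE] := smooth_scal (U := U) us.
have dt i : derS i tS = e 0 i.
  apply: smoP => y Uy; rewrite ev_der// (pd_eq i (dset_open U) tE)// dT//.
  by rewrite (rp_eta RP)// evm_entry.
have dul i : derS i uS = (1 + lam) * e 0 i.
  apply: smoP => y Uy; rewrite ev_der// (pd_eq i (dset_open U) uE)// du// !evE ev1//.
  by rewrite (rp_eta RP)// evm_entry (ef_lam EF).
(* a = e^u and b = e^(2t - u) with their inverses; ab = e^(2t) is the factor of Phi *)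
have [a [aE da]] := derS_exp uS; have [ai [aiE _]] := derS_exp (- uS).
have [b [bE db]] := derS_exp (tS + tS - uS); have [bi [biE _]] := derS_exp (uS - (tS + tS)).
have aai : a * ai = 1 by apply: smoP => y Uy; rewrite evM aE// aiE// evN ev1// -expRD subrr expR0.
have bbi : b * bi = 1.
  by apply: smoP => y Uy; rewrite evM bE// biE// ev1// -expRD -evD (_ : _ + _ = 0) ?ev0 ?expR0//; ring.
have dira V : dir (@derS R 3 U) V a = (1 + lam) * a * (e *m V) 0 0.
  rewrite mxE mulr_sumr; apply: eq_bigr => i _; rewrite da dul; ring.
have dirb V : dir (@derS R 3 U) V b = (1 - lam) * b * (e *m V) 0 0.
  rewrite mxE mulr_sumr; apply: eq_bigr => i _.
  rewrite db (dsysD HD) (dsysN HD) (dsysD HD) dul dt; ring.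
pose th1 := bi *: ((fr ix2)^T *m g); pose th2 := ai *: ((fr ix1)^T *m g).
have cl1 : forall i j, derS i (th1 0 j) = derS j (th1 0 i).
  apply: (coframe_closed HD AK1 orth (k := ix2) isT (ef_brk12 EF) (ef_brk13 EF) (ef_brk23 EF) bbi).
  - by rewrite dirb eV mulr0.
  - by rewrite dirb eV mulr0.
  - by rewrite dirb eV mulr1.
have cl2 : forall i j, derS i (th2 0 j) = derS j (th2 0 i).
  apply: (coframe_closed HD AK1 orth (k := ix1) isT (ef_brk12 EF) (ef_brk13 EF) (ef_brk23 EF) aai).
  - by rewrite dira eV mulr0.
  - by rewrite dira eV mulr0.
  - by rewrite dira eV mulr1.
have potential (th : 'rV[smo U]_3) : (forall i j, derS i (th 0 j) = derS j (th 0 i)) ->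
    exists s f0, [/\ 0 < s, s <= r1, smooth_on [set x | `|x - x0| < s] f0 &
      forall i y, `|y - x0| < s -> pd i f0 y = th 0 i y].
  move=> cl; apply: (@poincare R 3 x0 r1 (fun i => smo_val (th 0 i)) r10
      (fun i => @smo_smooth _ _ _ (th 0 i))) => i j y Uy.
  by have := cl i j => /(congr1 (fun f : smo U => f y)); rewrite !ev_der.
have [s1 [F1 [s10 s1r F1s dF1]]] := potential _ cl1.
have [s2 [F2 [s20 s2r F2s dF2]]] := potential _ cl2.
pose r2 := Num.min s1 s2.
have r20 : 0 < r2 by rewrite lt_min s10 s20.
pose B : set 'rV[R]_3 := [set y | `|y - x0| < r2].
have oB : open B by exact: open_normball.
have BU y : B y -> U y by rewrite /B /= lt_min => /andP[y1 _]; exact: lt_le_trans y1 s1r.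
have Bx0 : B x0 by rewrite /B /= subrr normr0.
pose F (y : 'rV[R]_3) : 'rV[R]_3 := \row_j (if j == ix1 then F1 y else if j == ix2 then F2 y else T y).
(* thr is the coframe dF, and cols the dual frame *)
pose thr (i : 'I_3) : 'rV[smo U]_3 := if i == ix1 then th1 else if i == ix2 then th2 else e.
have Fj j : (fun y => F y 0 j) = if j == ix1 then F1 else if j == ix2 then F2 else T.
  by apply/funext => y; rewrite mxE; case: (j == ix1); case: (j == ix2).
have Fs j : smooth_on B (fun y => F y 0 j).
  rewrite Fj; case: ifP => _; [|case: ifP => _].
  - by apply: smooth_on_sub F1s => y; rewrite /B /= lt_min => /andP[].
  - by apply: smooth_on_sub F2s => y; rewrite /B /= lt_min => /andP[].
  - by apply: smooth_on_sub Ts => y /BU.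
have dF i j y : B y -> pd j (fun y => F y 0 i) y = thr i 0 j y.
  move=> By; rewrite Fj /thr; case: ifP => _; [|case: ifP => _].
  - by rewrite dF1//; move: By; rewrite /B /= lt_min => /andP[].
  - by rewrite dF2//; move: By; rewrite /B /= lt_min => /andP[].
  - by rewrite dT ?(rp_eta RP) ?evm_entry//; exact: BU.
pose cols (i : 'I_3) : 'cV[smo U]_3 :=
  if i == ix1 then b *: fr ix2 else if i == ix2 then a *: fr ix1 else x.
pose Th : 'M[smo U]_3 := \matrix_(i, j) thr i 0 j.
pose E : 'M[smo U]_3 := \matrix_(i, j) cols j i 0.
have thc i j : (thr i *m cols j) 0 0 = (i == j)%:R.
  have xv v : (e *m v) 0 0 = ip g x v by rewrite (rp_etag ac0 Uc RP).
  have sv z v v' : ((z *: (v^T *m g)) *m v') 0 0 = z * ip g v v' by rewrite -scalemxAl mxE.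
  rewrite /thr /cols /th1 /th2; case: (ord3P i) => ->; case: (ord3P j) => ->;
    rewrite /= ?sv ?xv -?(ef_xi EF) ?ipZr ?orth /= ?mulr0 ?mulr1 ?[bi * b]mulrC ?bbi ?[ai * a]mulrC ?aai//.
have ThE : Th *m E = 1%:M.
  apply/matrixP => i j; rewrite [RHS]mxE -thc !mxE; apply: eq_bigr => l _.
  by rewrite !mxE.
have Ju : (\matrix_(i, j) pd i (fun x => F x 0 j) x0) \in unitmx.
  have -> : \matrix_(i, j) pd i (fun x => F x 0 j) x0 = (evm x0 Th)^T.
    by apply/matrixP => i j; rewrite !mxE dF.
  rewrite unitmx_tr; have : evm x0 Th *m evm x0 E = 1%:M by rewrite -evmM ThE evm1//; exact: BU.
  by move=> /mulmx1_unit[].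
have [c [ac cp cdom cmap [r cE]]] := new_chart ac0 c0p oB (fun y By => Uc y (BU y By)) Bx0 Fs Ju.
pose u q := u0 (chart_map c0 q).
exists c, (F x0), r, u; split=> //.
  move=> j; apply: (@smooth_on_comp _ _ _ (chart_cod c) B u0 (fun y => chart_map c0 (chart_inv c y))).
  - exact: chart_cod_open.
  - exact: oB.
  - by move=> y cy; have [] := cdom _ (chart_inv_dom cy).
  - by apply: smooth_on_sub us => y /BU.
  - move=> i; apply: smooth_on_sub (transition_smooth ac ac0 i) => y cy.
    by split=> //; have [] := cdom _ (chart_inv_dom cy).
move=> q cq; have [c0q Bq] := cdom _ cq; set y := chart_map c0 q in Bq *.
have Uy : U y by exact: BU.
have qE : chart_inv c0 y = q by rewrite /y chart_mapK.
have J : jac c0 c q = evm y Th.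
  apply/matrixP => i j; rewrite !mxE -dF// /pder -!pdE -/y.
  apply: (pd_eq j oB) => // z Bz; rewrite cmap chart_invK//; exact/Uc/BU.
have JE : jac c0 c q *m evm y E = 1%:M by rewrite J -evmM ThE evm1.
have Ji : jac c c0 q = evm y E.
  by rewrite -[LHS]mulmx1 -JE mulmxA jac_inv// mul1mx.
have ETh : E *m Th = 1%:M by exact: mulmx1C.
have tq : tcoord c q = tS y by rewrite /tcoord cmap mxE /= tE.
have uq : u q = uS y by rewrite uE.
set s := expR (2 * u q - 2 * tcoord c q); set si := expR (2 * tcoord c q - 2 * u q).
have aS : (a * bi) y = s by rewrite evM aE// biE// -expRD /s tq uq !evE; congr expR; ring.
have aSi : (b * ai) y = si by rewrite evM bE// aiE// -expRD /si tq uq !evE; congr expR; ring.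
have aa : (a * a) y = expR (2 * tcoord c q) * s.
  by rewrite evM aE// -!expRD /s tq uq; congr expR; ring.
have bb : (b * b) y = expR (2 * tcoord c q) * si.
  by rewrite evM bE// -!expRD /si tq uq !evE; congr expR; ring.
have etaq : eta S c q = delta_mx 0 it.
  rewrite (form1_law (eta S) ac ac0 cq c0q) Ji -qE (rp_eta RP)// -evmM.
  have -> : e = delta_mx 0 it *m Th by rewrite -rowE; apply/rowP => j; rewrite !mxE.
  by rewrite -mulmxA ThE mulmx1 evm_delta.
have xiq : xi S c q = delta_mx it 0.
  rewrite (vfield_law (xi S) ac0 ac c0q cq) J -qE (rp_xi RP)// -evmM.
  have -> : x = E *m delta_mx it 0 by rewrite -colE; apply/colP => j; rewrite !mxE.
  by rewrite mulmxA ThE mul1mx evm_delta.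
split=> //.
- have us' : smooth_on B (fun z => u (chart_inv c0 z)).
    apply: (smooth_on_eq (f := u0)) => //; last by apply: smooth_on_sub us => z /BU.
    by move=> z Bz; rewrite /u chart_invK//; exact/Uc/BU.
  rewrite -etaq (form1_law (eta S) ac ac0 cq c0q) scalemxAl (grad_change ac ac0 oB us')//.
  congr (_ *m _); apply/rowP => j; rewrite !mxE -{1}qE /pder chart_invK; last exact: Uc.
  rewrite -pdE (pd_eq (g := u0) j oB)//; first by rewrite du// qE.
  by move=> z Bz; rewrite /u chart_invK//; exact/Uc/BU.
- have := endo_law (phi S) ac0 ac c0q cq; rewrite J -qE (rp_phi RP)// qE => H.
  have -> : phi S c q = evm y (Th *m f *m E).
    by rewrite !evmM -H -mulmxA -evmM ThE evm1// mulmx1.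
  pose P : 'M[smo U]_3 := \matrix_(i, j) (if (i == ix1) && (j == ix2) then a * bi
     else if (i == ix2) && (j == ix1) then - (b * ai) else 0).
  have fE : f *m E = E *m P.
    have f2 : f *m fr ix2 = - fr ix1.
      rewrite (ef_phi EF) mulmxA (ak_phi2 AK1) mulmxDl mulNmx mul1mx -mulmxA.
      have -> : e *m fr ix1 = 0 by rewrite [LHS]scalar11 eV; apply/matrixP => i j; rewrite !mxE mul0rn.
      by rewrite mulmx0 addr0.
    have f1 : f *m fr ix1 = fr ix2 by rewrite (ef_phi EF).
    have fc j : f *m cols j = \sum_l P l j *: cols l.
      rewrite sum3 !mxE; case: (ord3P j) => ->; rewrite /cols /= -?scalemxAr ?f1 ?f2
        ?(ak_phixi AK1) ?scale0r ?addr0 ?add0r//.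
        rewrite scalerA scalerN mulNr -mulrA [ai * a]mulrC aai mulr1 scaleNr//.
      by rewrite scalerA -mulrA [bi * b]mulrC bbi mulr1.
    apply/matrixP => i j; have /colP/(_ i) := fc j; rewrite summxE !mxE.
    have -> : \sum_l f i l * cols j l 0 = \sum_l f i l * E l j.
      by apply: eq_bigr => l _; rewrite mxE.
    by move=> ->; apply: eq_bigr => l _; rewrite !mxE mulrC.
  rewrite -mulmxA fE mulmxA ThE mul1mx.
  apply/matrixP => i j; rewrite evm_entry mxE !(fun_if (fun z : smo U => z y)) evN aS aSi ev0.
  by case: (ord3P i) => ->; case: (ord3P j) => ->; rewrite blkE /= ?mxE /=.
- rewrite (metric_law (met S) ac ac0 cq c0q) Ji -{1}qE (rp_g RP)// -evmT -!evmM.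
  have -> : E^T *m g *m E = \matrix_(i, j) ip g (cols i) (cols j).
    apply/matrixP => i j; rewrite [RHS]mxE /ip !mxE; apply: eq_bigr => l _; rewrite !mxE; congr (_ * _).
    by apply: eq_bigr => l' _; rewrite !mxE.
  have ipc : forall i j, ip g (cols i) (cols j) = if i == j then
      if i == ix1 then b * b else if i == ix2 then a * a else 1 else 0.
    move=> i j; rewrite /cols; case: (ord3P i) => ->; case: (ord3P j) => ->;
      by rewrite /= -?(ef_xi EF) ?ipZl ?ipZr orth /= ?mulr0 ?mulr1.
  apply/matrixP => i j; rewrite evm_entry mxE ipc !(fun_if (fun z : smo U => z y)) aa bb ev0 ev1//.
  by case: (ord3P i) => ->; case: (ord3P j) => ->; rewrite blkE /= ?mxE /=.
Qed.

End Coordinates.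

(** As $\xi=\partial_t$, the components of $L_\xi\varphi$ are the derivatives of those
of $\varphi$. *)
Lemma h_blk (R : realType) (M : manifold R 3) (S : acm M) (c : mchart M) (ph : R -> 'M[R]_2)
    (dph : 'M[R]_2) q : chart_dom c q ->
  (forall q, chart_dom c q -> phi S c q = blk (ph (tcoord c q)) 0) ->
  (forall q, chart_dom c q -> xi S c q = delta_mx it 0) ->
  (forall i j, is_derive (tcoord c q) 1 ((fun s => ph s i j) : R -> R^o) (dph i j)) ->
  h_tensor S c q = 2^-1 *: blk dph 0.
Proof.
move=> cq phE xiE d; congr (_ *: _); apply/matrixP => k j; rewrite mxE.
have -> : bracket c (xi S c) (fun=> delta_mx j 0) q = 0.
  apply/colP => i; rewrite !mxE big1// => l _; rewrite pder_cst mulr0.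
  rewrite (pder_eq l cq (G := fun=> (delta_mx it 0 : 'cV[R]_3) i 0)) ?pder_cst ?mulr0 ?subr0//.
  by move=> q' cq'; rewrite xiE.
rewrite mulmx0 subr0 mxE (bigD1 it)//= big1 ?addr0; last first.
  move=> l /negPf lt; rewrite xiE// mxE lt mul0r.
  rewrite (pder_eq l cq (G := fun=> (delta_mx it 0 : 'cV[R]_3) k 0)) ?pder_cst ?mulr0 ?subr0//.
  by move=> q' cq'; rewrite xiE.
rewrite xiE// mxE eqxx mul1r.
rewrite (pder_eq it cq (F := fun q => xi S c q k 0) (G := fun=> (delta_mx it 0 : 'cV[R]_3) k 0)); last first.
  by move=> q' cq'; rewrite xiE.
rewrite pder_cst mulr0 subr0.
rewrite (pder_fun_t it (u := fun s => blk (ph s) 0 k j) cq _ (is_derive_blk 0 k j d)) ?eqxx ?mulr1//.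
by move=> q' cq'; rewrite mxE phE.
Qed.

Lemma blkM (R : realType) (A B : 'M[R]_2) a b : blk A a *m blk B b = blk (A *m B) (a * b).
Proof.
have sum2 (F : 'I_2 -> R) : \sum_i F i = F 0 + F 1.
  by rewrite !big_ord_recl big_ord0 addr0; congr (_ + F _); exact: val_inj.
apply/matrixP => i j; rewrite mxE sum3.
by case: (ord3P i) => ->; case: (ord3P j) => ->; rewrite !blkE ?mxE ?sum2 ?(mulr0, mul0r, addr0, add0r).
Qed.

Lemma blkZ (R : realType) (A : 'M[R]_2) a z : z *: blk A a = blk (z *: A) (z * a).
Proof.
apply/matrixP => i j; rewrite mxE.
by case: (ord3P i) => ->; case: (ord3P j) => ->; rewrite !blkE ?mxE ?mulr0.
Qed.

Lemma mx2M (R : realType) (a b d e a' b' d' e' : R) : mx2 a b d e *m mx2 a' b' d' e' =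
  mx2 (a * a' + b * d') (a * b' + b * e') (d * a' + e * d') (d * b' + e * e').
Proof.
by apply/matrixP => i j; rewrite !mxE !big_ord_recl big_ord0 addr0 !mxE /=;
  case: (i == 0); case: (j == 0).
Qed.

Lemma is_derive_mx2 (R : realType) (a b d e : R -> R) (a' b' d' e' t : R) :
  is_derive t 1 (a : R -> R^o) a' -> is_derive t 1 (b : R -> R^o) b' ->
  is_derive t 1 (d : R -> R^o) d' -> is_derive t 1 (e : R -> R^o) e' ->
  forall i j, is_derive t 1 ((fun s => mx2 (a s) (b s) (d s) (e s) i j) : R -> R^o) (mx2 a' b' d' e' i j).
Proof.
move=> da db dd de i j; rewrite mxE.
by under eq_fun do rewrite mxE; case: (i == 0); case: (j == 0).
Qed.

Section ForwardTheorem.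
Variables (R : realType) (M : manifold R 3) (S : acm M) (kappa mu : M -> R).
Hypothesis AK : almost_kenmotsu S.
Hypothesis KM : generalized_kappa_mu' S kappa mu.
Hypotheses (ks : smooth_fun kappa) (ms : smooth_fun mu).
Hypothesis dk : forall (c : mchart M) (p : M), atlas c -> chart_dom c p ->
  wedge11 (grad c kappa p) (eta S c p) = 0.
Hypothesis hn : forall (c : mchart M) (p : M), atlas c -> chart_dom c p ->
  h_tensor S c p <> 0.
Notation lambda := (lambda_of kappa).

(** With $r=e^{2u-2t}$, in the coordinates of [coframe_chart] $\varphi$ has the
off-diagonal entries $r,-1/r$, so $h=\frac12\partial_t\varphi$ has entries
$\lambda r,\lambda/r$ and $h'$ is diagonal with entries $-\lambda,\lambda$. The
system then amounts to $r'=2\lambda r$ and $\lambda'=-(\mu+2)\lambda$. *)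
Theorem adapted_of_kmu p : exists c : mchart M,
  [/\ atlas c, chart_dom c p & adapted_coordinates S kappa mu c].
Proof.
have [c [y0 [r [u [ac cp cE us H]]]]] := coframe_chart AK KM ks ms dk hn p.
exists c; split=> //.
have oc := @chart_cod_open _ _ _ c.
have l0 q : 0 < lambda q by rewrite sqrtr_gt0; exact: (kappa_lt AK KM ks ms hn).
have ls := lambda_smooth AK KM ks ms hn ac.
have lg q : chart_dom c q -> grad c lambda q = (- (mu q + 2) * lambda q) *: delta_mx 0 it.
  move=> cq; have [_ _ _ <- _] := H q cq.
  exact: (lambda_grad AK KM ks ms dk hn ac cq).
have [L LE] := box_one_variable cE ls lg.
have ug q : chart_dom c q -> grad c u q = (1 + lambda q) *: delta_mx 0 it by move=> /H[].
have [V VE] := box_one_variable cE us ug.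
pose rf s := expR (2 * V s - 2 * s); pose ri s := expR (2 * s - 2 * V s).
have rri s : rf s * ri s = 1 by rewrite -expRD addrA subrK subrr expR0.
(* mu is recovered from the equation L' = - (mu + 2) L *)
exists (fun s => - 2 - ('D_1 (L : R -> R^o) s) / L s), (fun q => - ln (lambda q)),
  (fun s => mx2 0 (rf s) (- ri s) 0),
  (fun s => mx2 (expR (2 * s) * ri s) 0 0 (expR (2 * s) * rf s)),
  (fun s => mx2 0 (L s * rf s) (L s * ri s) 0),
  (fun s => mx2 (- L s) 0 0 (L s)).
have phE q : chart_dom c q -> phi S c q = blk (mx2 0 (rf (tcoord c q)) (- ri (tcoord c q)) 0) 0.
  by move=> cq; have [_ -> _ _ _] := H q cq; have [uE _] := VE q cq; rewrite /rf /ri -uE.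
have xiE q : chart_dom c q -> xi S c q = delta_mx it 0 by move=> cq; have [_ _ -> _ _] := H q cq.
have dL q : chart_dom c q -> is_derive (tcoord c q) 1 (L : R -> R^o) (- (mu q + 2) * L (tcoord c q)).
  by move=> cq; have [<- dl] := LE q cq.
have dexp2 (w : R -> R) (dw s : R) : is_derive s 1 (w : R -> R^o) dw ->
    is_derive s 1 ((fun s => expR (w s)) : R -> R^o) (dw * expR (w s)).
  by move=> wd; rewrite mulrC; exact: (@is_derive1_comp _ expR w s _ _ (is_derive_expR _) wd).
have d2 (w : R -> R) (dw s : R) : is_derive s 1 (w : R -> R^o) dw ->
    is_derive s 1 ((fun s => 2 * w s) : R -> R^o) (2 * dw).
  by move=> wd; exact: (@is_deriveZ R R^o R^o w 2 s 1 dw wd).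
have drf q : chart_dom c q -> is_derive (tcoord c q) 1 (rf : R -> R^o)
    (2 * (L (tcoord c q) * rf (tcoord c q))).
  move=> cq; have [_ dV] := VE q cq; have [lE _] := LE q cq.
  have h1 := is_deriveB (d2 _ _ _ dV) (d2 _ _ _ (is_derive_id (tcoord c q) (1 : R))).
  apply: (is_derive_eq (dexp2 _ _ _ h1)); rewrite lE /rf; ring.
have dri q : chart_dom c q -> is_derive (tcoord c q) 1 (ri : R -> R^o)
    (- (2 * (L (tcoord c q) * ri (tcoord c q)))).
  move=> cq; have [_ dV] := VE q cq; have [lE _] := LE q cq.
  have h1 := is_deriveB (d2 _ _ _ (is_derive_id (tcoord c q) (1 : R))) (d2 _ _ _ dV).
  apply: (is_derive_eq (dexp2 _ _ _ h1)); rewrite lE /ri; ring.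
have c0 (s : R) : is_derive s 1 ((fun=> 0) : R -> R^o) 0 by exact: is_derive_cst.
have dph q : chart_dom c q -> forall i j, is_derive (tcoord c q) 1
    ((fun s => mx2 0 (rf s) (- ri s) 0 i j) : R -> R^o)
    (2 * mx2 0 (L (tcoord c q) * rf (tcoord c q)) (L (tcoord c q) * ri (tcoord c q)) 0 i j).
  move=> cq i j; have dN := is_deriveN (dri q cq); rewrite opprK in dN.
  apply: (is_derive_eq (is_derive_mx2 (c0 _) (drf q cq) dN (c0 _) i j)).
  by rewrite !mxE; case: (i == 0); case: (j == 0); rewrite ?mulr0.
have hE q : chart_dom c q -> h_tensor S c q =
    blk (mx2 0 (L (tcoord c q) * rf (tcoord c q)) (L (tcoord c q) * ri (tcoord c q)) 0) 0.
  move=> cq; set X := mx2 _ _ _ _.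
  have d' i j : is_derive (tcoord c q) 1 ((fun s => mx2 0 (rf s) (- ri s) 0 i j) : R -> R^o)
      ((2 *: X) i j) by rewrite mxE; exact: dph.
  by rewrite (h_blk cq phE xiE d') blkZ scalerA mulVf ?scale1r ?mulr0.
have kE q : kappa q = - 1 - lambda q ^+ 2.
  rewrite sqr_sqrtr; first by ring.
  exact/ltW/(kappa_lt AK KM ks ms hn).
have e2 q : expR (- (2 * - ln (lambda q))) = lambda q ^+ 2.
  by rewrite mulrN opprK mulrDl mul1r expRD lnK ?posrE.
split.
- by move=> k; apply: Ck_onN => //; apply: Ck_on_ln => // y _; exact: l0.
- move=> q cq; have [lE dl] := LE q cq; split.
  + have [_ ->] := dL q cq; rewrite mulfK ?opprB; first by rewrite opprK; ring.
    by rewrite -lE gt_eqF.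
  + apply/rowP => i; rewrite !mxE /pder -pdE.
    have ns : smooth_on (chart_cod c) (fun y => lambda (chart_inv c y)) by exact: ls.
    have dn : is_derive (lambda (chart_inv c (chart_map c q))) 1 ((fun s : R => - ln s) : R -> R^o)
        (- (lambda q)^-1).
      by rewrite chart_mapK//; exact: (is_deriveN (is_derive1_ln (l0 q))).
    rewrite pdE; have [_ ->] := pd_comp i oc (chart_map_cod cq) (ns 1%N) dn.
    have /rowP/(_ i) := lg q cq; rewrite !mxE /pder -pdE => ->.
    by move: (lambda q) (l0 q) => l lp; field; rewrite gt_eqF.
  + by rewrite kE e2.
- move=> q cq; have [_ _ xiq etaq gq] := H q cq; split=> //; first exact: phE.
  by have [uE _] := VE q cq; rewrite gq /rf /ri /= -uE.
- move=> q cq; have [_ _ _ _ gq] := H q cq; split.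
  + rewrite fundamental_formE phE// gq; have [-> _] := VE q cq.
    rewrite -/(rf _) -/(ri _) blkM mx2M.
    have e1 (z w : R) : z * ri w * rf w = z.
      by have := rri w; move: (rf w) (ri w) => a b ab; rewrite -mulrA [b * a]mulrC ab mulr1.
    have e3 (z w : R) : z * rf w * - ri w = - z.
      by have := rri w; move: (rf w) (ri w) => a b ab; rewrite mulrN -mulrA ab mulr1.
    rewrite e1 e3 !(mul0r, mulr0, addr0, add0r); apply/matrixP => i j.
    by case: (ord3P i) => ->; case: (ord3P j) => ->; rewrite blkE !mxE /=; ring.
  + exact: hE.
  + rewrite /h'_tensor hE// phE// blkM mx2M; congr blk; last by rewrite mulr0.
    rewrite !mul0r !mulr0 !add0r !addr0 mulrN -!mulrA [ri _ * _]mulrC !rri !mulr1.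
    by [].
- move=> q cq i j t lam; have [lE _] := LE q cq; rewrite /lam opprK lnK ?posrE//.
  split.
  + rewrite e2 !big_ord_recl big_ord0 addr0 lE !mxE.
    by move: i j => [[|[|//]] Hi] [[|[|//]] Hj]; rewrite /= -?[Ordinal _]/0; cbn; ring.
  + exact: dph.
  + have dN := is_deriveN (dL q cq).
    apply: (is_derive_eq (is_derive_mx2 dN (c0 _) (c0 _) (dL q cq) i j)).
    by rewrite !mxE; case: (i == 0); case: (j == 0); rewrite ?mulr0// mulrN.
  + have := is_deriveM (dL q cq) (drf q cq) => d3.
    have := is_deriveM (dL q cq) (dri q cq) => d4.
    apply: (is_derive_eq (is_derive_mx2 (c0 _) d3 d4 (c0 _) i j)).
    have sE (x y : R) : x *: (y : R^o) = x * y by [].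
    rewrite !mxE !sE lE /t; case: (i == 0); case: (j == 0); ring.
Qed.

End ForwardTheorem.

(** * From adapted coordinates to the curvature condition *)

Section Converse.
Variables (R : realType) (M : manifold R 3) (S : acm M) (kappa mu : M -> R).
Hypotheses (ks : smooth_fun kappa) (ms : smooth_fun mu).
Variables (c d : mchart M) (p : M).
Hypotheses (ac : atlas c) (ad : atlas d) (cp : chart_dom c p) (dp : chart_dom d p).
Hypothesis adapted : adapted_coordinates S kappa mu c.

Let U : sdom R 3 := @Sdom R 3 (overlap d c) (@overlap_open R 3 M d c)
  (ex_intro _ _ (@overlap_map R 3 M d c p dp cp)).
Notation dS := (@derS R 3 U).
Notation hS := (halfS U).
Let Uc z : U z -> chart_cod d z. Proof. by case. Qed.
Let HD : dsys dS := @derS_dsys R 3 U.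

Variables (g gi f : 'M[smo U]_3) (x : 'cV[smo U]_3) (e : 'rV[smo U]_3) (k m : smo U).
Hypothesis RP : represents S kappa mu d g gi f x e k m.

Let F := g *m f.

(** In an arbitrary chart [d] the coordinate fields of the adapted chart [c] form a
commuting frame $E$, with dual coframe $dy_i$, in which the components of the
structure depend on $t=y_3$ only: [adapted_curv] applies. Moreover $\eta=dy_3$ and
$\Phi=e^{2y_3}dy_1\wedge dy_2$. *)
Theorem converse_ring : [/\ forall i j, dS i (e 0 j) = dS j (e 0 i),
  forall i j l, dS i (F j l) + dS j (F l i) + dS l (F i j) =
    (1 + 1) * (e 0 i * F j l + e 0 j * F l i + e 0 l * F i j) &
  forall X Y, curv dS hS g gi X Y x =
    k *: ((e *m Y) 0 0 *: X - (e *m X) 0 0 *: Y)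
    + m *: ((e *m Y) 0 0 *: (hS *: lie dS x f *m f *m X)
            - (e *m X) 0 0 *: (hS *: lie dS x f *m f *m Y))].
Proof.
have [mm [ff [ph [gg [h [B [fs A1 A2 A3 A4]]]]]]] := adapted.
have [Y YE] : exists Y : 'I_3 -> smo U, forall i z, U z -> Y i z = chart_map c (chart_inv d z) 0 i.
  exists (fun i => mkS (U := U) (transition_smooth ad ac i)) => i z Uz.
  by rewrite /= cutoffE.
have domd z : U z -> chart_dom d (chart_inv d z) by move=> [dz _]; exact: chart_inv_dom.
have domc z : U z -> chart_dom c (chart_inv d z) by case.
pose Ei : 'M[smo U]_3 := \matrix_(i, j) dS j (Y i).
have EiJ z : U z -> evm z Ei = jac d c (chart_inv d z).
  move=> Uz; apply/matrixP => i j; rewrite !mxE; symmetry; apply: (pder_repr Uc) => // z' Uz'.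
  by rewrite YE.
have Eiu z : U z -> evm z Ei \in unitmx.
  move=> Uz; rewrite EiJ//; have := jac_inv ad ac (domd z Uz) (domc z Uz).
  by move=> /mulmx1_unit[].
have [E EEi Einv] := smo_mx_inv Eiu.
have EiE : Ei *m E = 1%:M by exact: mulmx1C.
have evE1 z : U z -> evm z Ei *m evm z E = 1%:M by move=> Uz; rewrite -evmM EiE evm1.
have dY a i : dir dS (col a E) (Y i) = (i == a)%:R.
  have /matrixP/(_ i a) := EiE; rewrite !mxE => <-; apply: eq_bigr => l _.
  by rewrite !mxE mulrC.
have Ebrk a b : brk dS (col a E) (col b E) = 0.
  suff Eib : Ei *m brk dS (col a E) (col b E) = 0.
    by rewrite -[LHS]mul1mx -EEi -mulmxA Eib mulmx0.
  apply/colP => i; rewrite mxE [RHS]mxE.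
  transitivity (dir dS (brk dS (col a E) (col b E)) (Y i)).
    by apply: eq_bigr => l _; rewrite mxE mulrC.
  rewrite (dir_brk HD) !dY.
  have d0 V (t : bool) : dir dS V t%:R = 0 by case: t; rewrite ?(dir0 HD) ?(dir1 HD).
  by rewrite !d0 subrr.
(* the components in c, as functions on the domain in d *)
pose P := Ei *m f *m E; pose H := hS *: map_mx (dframe dS E it) P; pose Br := H *m P.
pose G := E^T *m g *m E.
have PE z : U z -> evm z P = phi S c (chart_inv d z).
  move=> Uz; rewrite /P !evmM EiJ// -(rp_phi RP)// -(endo_law (phi S) ad ac (domd z Uz) (domc z Uz)).
  by rewrite -mulmxA -EiJ// evE1// mulmx1.
have GE z : U z -> evm z G = met S c (chart_inv d z).
  move=> Uz; rewrite /G !evmM evmT -(rp_g RP)// (metric_law (met S) ad ac (domd z Uz) (domc z Uz)).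
  rewrite -EiJ// !mulmxA -mulmxA evE1// mulmx1 -trmx_mul evE1// trmx1 mul1mx.
  by [].
have tE z : U z -> tcoord c (chart_inv d z) = Y it z by move=> Uz; rewrite YE.
have frame_t a (w : smo U) (u : R -> R) (du : R) z : U z ->
    (forall z, U z -> w z = u (tcoord c (chart_inv d z))) ->
    is_derive (tcoord c (chart_inv d z)) 1 (u : R -> R^o) du ->
    dframe dS E a w z = (a == it)%:R * du.
  move=> Uz wE ud; have dw i : dS i w z = du * dS i (Y it) z.
    rewrite !ev_der// (pd_eq (g := fun z => u (Y it z)) i (dset_open U))//; last first.
      by move=> z' Uz'; rewrite wE// tE.
    rewrite tE// in ud; rewrite pdE.
    by have [_ ->] := pd_comp i (dset_open U) Uz (@smo_smooth _ _ _ (Y it) 1%N) ud.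
  rewrite /dframe /dir ev_sum.
  have := dY a it => /(congr1 (fun w : smo U => w z)); rewrite ev_nat// eq_sym => <-.
  rewrite /dir ev_sum mulr_suml; apply: eq_bigr => i _.
  by rewrite !evM dw mulrCA mulrC.
have dPz a z i j : U z -> dframe dS E a (P i j) z =
    (a == it)%:R * blk (2 *: h (tcoord c (chart_inv d z))) 0 i j.
  move=> Uz; apply: (frame_t a _ (fun s => blk (ph s) 0 i j) _ z Uz).
    move=> z' Uz'; rewrite -evm_entry PE//.
    by have [-> _ _ _] := A2 _ (domc _ Uz').
  apply: is_derive_blk => i' j'; have [_ + _ _] := A4 _ (domc _ Uz) i' j'.
  by rewrite mxE.
have HE z : U z -> evm z H = h_tensor S c (chart_inv d z).
  move=> Uz; have [_ -> _] := A3 _ (domc _ Uz); apply/matrixP => i j.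
  transitivity ((2^-1 *: blk (2 *: h (tcoord c (chart_inv d z))) 0) i j); last first.
    by rewrite blkZ scalerA mulVf ?pnatr_eq0// scale1r mulr0.
  rewrite evm_entry.
  have -> : H i j = hS * dframe dS E it (P i j) by rewrite [LHS]mxE [X in _ * X]mxE.
  by rewrite [RHS]mxE evM ev_cst// dPz// eqxx mul1r.
have BE z : U z -> evm z Br = blk (B (tcoord c (chart_inv d z))) 0.
  by move=> Uz; have [_ _ <-] := A3 _ (domc _ Uz); rewrite /Br evmM HE// PE.
have HH : H + H = map_mx (dframe dS E it) P by rewrite -scalerDl halfS2 scale1r.
have dP a : map_mx (dframe dS E a) P = (a == it)%:R *: (H + H).
  rewrite HH; case: (eqVneq a it) => [->|/negPf ai]; first by rewrite scale1r.
  rewrite scale0r; apply/matrixP => i j; apply: smoP => z Uz.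
  by rewrite [in LHS]mxE dPz// ai mul0r mxE ev0.
have dB a : map_mx (dframe dS E a) Br = (a == it)%:R *: (- (m + 1 + 1) *: Br).
  apply/matrixP => i j; apply: smoP => z Uz; rewrite [in LHS]mxE.
  rewrite -[RHS]evm_entry !evmZ BE// blkZ mulr0 ev_nat// evN !evD ev1// -(rp_m RP)//.
  rewrite [RHS]mxE; apply: (frame_t a _ (fun s => blk (B s) 0 i j) _ z Uz).
    by move=> z' Uz'; rewrite -evm_entry BE.
  apply: is_derive_blk => i' j'; have [_ _ + _] := A4 _ (domc _ Uz) i' j'.
  by rewrite mxE -addrA.
have [ex [exE dex]] := derS_exp (Y it + Y it).
have dex' a : dframe dS E a ex = (a == it)%:R * (ex + ex).
  have -> : dframe dS E a ex = ex * (dir dS (col a E) (Y it) + dir dS (col a E) (Y it)).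
    rewrite -(dirD HD) /dframe /dir mulr_sumr; apply: eq_bigr => i _.
    by rewrite dex mulrCA.
  by rewrite dY eq_sym; ring.
pose J : 'M[smo U]_3 := delta_mx ix1 ix2 - delta_mx ix2 ix1.
have dJ a : map_mx (dframe dS E a) J = 0.
  have d0 V (t : bool) : dir dS V t%:R = 0 by case: t; rewrite ?(dir0 HD) ?(dir1 HD).
  by apply/matrixP => i j; rewrite !mxE /dframe (dirD HD) (dirN HD) !d0 subrr.
have GP : G *m P = ex *: J.
  apply: evmP => z Uz; rewrite evmM GE// PE// -fundamental_formE.
  have [-> _ _] := A3 _ (domc _ Uz).
  rewrite evmZ exE// tE// evmD evmN !evm_delta// evD mulrDl mul1r; congr (_ *: _).
  apply/matrixP => i j.
  by case: (ord3P i) => ->; case: (ord3P j) => ->; rewrite !mxE /=; ring.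
have P2 : P *m P = - 1%:M + delta_mx it (0 : 'I_1) *m delta_mx 0 it.
  apply: evmP => z Uz; rewrite evmM PE// evmD evmN evm1// evmM !evm_delta//.
  rewrite acm_phi2//; last exact: domc.
  by have [_ -> -> _] := A2 _ (domc _ Uz).
have Bxi : Br *m delta_mx it (0 : 'I_1) = 0.
  apply: evmP => z Uz; rewrite evmM evm0 evm_delta// BE// -colE.
  by apply/colP => i; rewrite mxE [RHS]mxE; case: (ord3P i) => ->; rewrite blkE.
have etaB : delta_mx (0 : 'I_1) it *m Br = 0.
  apply: evmP => z Uz; rewrite evmM evm0 evm_delta// BE// -rowE.
  by apply/rowP => i; rewrite mxE [RHS]mxE; case: (ord3P i) => ->; rewrite blkE.
have B2 : Br *m Br = (- 1 - k) *: (1%:M - delta_mx it (0 : 'I_1) *m delta_mx 0 it).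
  apply: evmP => z Uz; rewrite evmM BE// blkM mulr0 evmZ evmD evmN evm1// evmM !evm_delta//.
  rewrite evD !evN ev1// -(rp_k RP)//.
  have [_ _ kE] := A1 _ (domc _ Uz); rewrite kE.
  set q := chart_inv d z; set t := tcoord c q.
  have BB : B t *m B t = expR (- (2 * ff q)) *: 1%:M.
    apply/matrixP => i j; have [+ _ _ _] := A4 _ (domc _ Uz) i j.
    by rewrite !mxE.
  have -> : - 1 - (- 1 - expR (- (2 * ff q))) = expR (- (2 * ff q)) by ring.
  rewrite BB; apply/matrixP => i j.
  rewrite [RHS]mxE mul_delta_mx.
  by case: (ord3P i) => ->; case: (ord3P j) => ->; rewrite blkE !mxE /= ?(mulr0, mulr1, subr0, subrr).
have Gs : G^T = G by rewrite /G !trmx_mul trmxK (rp_gs ad Uc RP) mulmxA.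
have Gxi : G *m delta_mx it (0 : 'I_1) = delta_mx it 0.
  apply: evmP => z Uz; rewrite evmM evm_delta// GE// -colE.
  have [_ _ _ ->] := A2 _ (domc _ Uz).
  by apply/colP => i; rewrite mxE [RHS]mxE; case: (ord3P i) => ->; rewrite blkE.
have gE : Ei^T *m G *m Ei = g.
  by rewrite /G !mulmxA -trmx_mul EEi trmx1 mul1mx -mulmxA EEi mulmx1.
have fE : E *m P *m Ei = f by rewrite /P !mulmxA EEi mul1mx -mulmxA EEi mulmx1.
have xE : E *m delta_mx it 0 = x.
  rewrite -[RHS]mul1mx -EEi -mulmxA; congr (_ *m _); apply: evmP => z Uz.
  rewrite evm_delta// evmM EiJ// -(rp_xi RP)// -(vfield_law (xi S) ad ac (domd z Uz) (domc z Uz)).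
  by have [_ -> _ _] := A2 _ (domc _ Uz).
have eE : delta_mx 0 it *m Ei = e.
  apply: evmP => z Uz; rewrite evmM evm_delta// EiJ// -(rp_eta RP)//.
  rewrite (form1_law (eta S) ad ac (domd z Uz) (domc z Uz)).
  by have [_ _ -> _] := A2 _ (domc _ Uz).
have ej j : e 0 j = dS j (Y it) by rewrite -eE -rowE !mxE.
split.
- by move=> i j; rewrite !ej (dsysC HD).
- have FE i j : F i j = ex * (dS i (Y ix1) * dS j (Y ix2) - dS i (Y ix2) * dS j (Y ix1)).
    have -> : F = ex *: (Ei^T *m J *m Ei).
      have conj (A0 B0 C0 D0 J0 : 'M[smo U]_3) : C0 *m D0 = 1%:M ->
          A0 *m B0 *m C0 *m (D0 *m J0 *m C0) = A0 *m (B0 *m J0) *m C0.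
        by move=> CD; rewrite !mulmxA -[A0 *m B0 *m C0 *m D0]mulmxA CD mulmx1.
      by rewrite /F -gE -fE conj// GP -scalemxAr -scalemxAl.
    rewrite mxE; congr (_ * _).
    by rewrite !mxE sum3 !mxE !sum3 !mxE /=; ring.
  move=> i j l; rewrite !FE !ej !(dsysM HD) !(dsysD HD) !(dsysN HD) !(dsysM HD) !dex !(dsysD HD).
  rewrite !(dsysC HD j i) !(dsysC HD l i) !(dsysC HD l j).
  ring.
- move=> V W; have gig : gi *m (Ei^T *m G *m Ei) = 1%:M by rewrite gE; exact: rp_gi RP.
  have h'E := adapted_h' HD (halfS2 U) EiE Ebrk dP (erefl Br).
  rewrite fE xE in h'E; rewrite h'E.
  have := adapted_curv HD (halfS2 U) EiE Ebrk dP dB dex' dJ GP P2 (erefl Br) Bxi etaB B2 Gs Gxi gig V W.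
  have -> : - 1 - (- 1 - k) = k by ring.
  by rewrite gE xE eE.
Qed.

End Converse.

Theorem kmu_of_adapted (R : realType) (M : manifold R 3) (S : acm M) (kappa mu : M -> R) :
  smooth_fun kappa -> smooth_fun mu ->
  (forall p : M, exists c : mchart M,
     [/\ atlas c, chart_dom c p & adapted_coordinates S kappa mu c]) ->
  almost_kenmotsu S /\ generalized_kappa_mu' S kappa mu.
Proof.
move=> ks ms adapted.
have ring_data (d : mchart M) p (ad : atlas d) (dp : chart_dom d p) : exists U : sdom R 3,
    [/\ U (chart_map d p), forall z, U z -> chart_cod d z &
      exists g gi f x e k m, represents S kappa mu d (U := U) g gi f x e k m /\
        [/\ forall i j, derS i (e 0 j) = derS j (e 0 i),
        forall i j l, derS i ((g *m f) j l) + derS j ((g *m f) l i) + derS l ((g *m f) i j) =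
          (1 + 1) * (e 0 i * (g *m f) j l + e 0 j * (g *m f) l i + e 0 l * (g *m f) i j) &
        forall X Y, curv (@derS R 3 U) (halfS U) g gi X Y x =
          k *: ((e *m Y) 0 0 *: X - (e *m X) 0 0 *: Y)
          + m *: ((e *m Y) 0 0 *: (halfS U *: lie (@derS R 3 U) x f *m f *m X)
            - (e *m X) 0 0 *: (halfS U *: lie (@derS R 3 U) x f *m f *m Y))]].
  have [c [ac cp A]] := adapted p.
  pose Ux := @overlap_map R 3 M d c p dp cp.
  pose U := @Sdom R 3 (overlap d c) (@overlap_open R 3 M d c) (ex_intro _ _ Ux).
  have Uc z : U z -> chart_cod d z by case.
  have [g [gi [f [x [e [k [m RP]]]]]]] := represents_exists S (U := U) ad Uc ks ms.
  exists U; split=> //; exists g, gi, f, x, e, k, m; split=> //.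
  exact: (@converse_ring R M S kappa mu c d p ac ad cp dp A g gi f x e k m RP).
split.
  move=> d ad p dp.
  have [U [Ux Uc [g [gi [f [x [e [k [m [RP [E1 E2 _]]]]]]]]]]] := ring_data d p ad dp.
  rewrite -(chart_mapK dp); split=> [i j|i j l].
    rewrite /ext_d1 (pder_repr_entry Uc i 0 j (rp_eta RP) Ux).
    by rewrite (pder_repr_entry Uc j 0 i (rp_eta RP) Ux) E1 subrr.
  have FE := rp_F RP.
  have := E2 i j l => /(congr1 (fun w : smo U => w (chart_map d p))).
  rewrite !evE ev1// => E.
  rewrite /ext_d2 /wedge12 !(pder_repr_entry Uc _ _ _ FE Ux) E.
  by rewrite (rp_eta RP)// FE// !evm_entry.
move=> X Y d ad p dp.
have [U [Ux Uc [g [gi [f [x [e [k [m [RP [_ _ E3]]]]]]]]]]] := ring_data d p ad dp.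
have [Xr XrE] : exists Xr : 'cV[smo U]_3, repr_mx d (X d) Xr.
  by apply: repr_exists => // i j; rewrite ord1; exact: vfield_smooth.
have [Yr YrE] : exists Yr : 'cV[smo U]_3, repr_mx d (Y d) Yr.
  by apply: repr_exists => // i j; rewrite ord1; exact: vfield_smooth.
have := curvature_repr Uc (rp_g RP) (rp_gi RP) XrE YrE (rp_xi RP) Ux.
rewrite E3 chart_mapK// => ->.
have := rp_h' Uc RP Ux; rewrite chart_mapK// => ->.
have := rp_eta RP Ux; rewrite chart_mapK// => ->.
have := rp_k RP Ux; rewrite chart_mapK// => ->.
have := rp_m RP Ux; rewrite chart_mapK// => ->.
have := XrE _ Ux; rewrite chart_mapK// => ->.
have := YrE _ Ux; rewrite chart_mapK// => ->.
by rewrite evmD !evmZ !evmD !evmN !evmZ !evmM /ev1 !evm_scal !evmM.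
Qed.

Theorem theorem6p2 (R : realType) (M : manifold R 3) (S : acm M)
    (kappa mu : M -> R)
    (h_neq0 : forall (c : mchart M) (p : M), atlas c -> chart_dom c p ->
       h_tensor S c p <> 0)
    (kappa_smooth : smooth_fun kappa) (mu_smooth : smooth_fun mu)
    (dkappa_eta : forall (c : mchart M) (p : M), atlas c -> chart_dom c p ->
       wedge11 (grad c kappa p) (eta S c p) = 0)
    (mu_neq : forall p : M, mu p <> - 2) :
  almost_kenmotsu S /\ generalized_kappa_mu' S kappa mu
  <->
  (forall p : M, exists c : mchart M,
     [/\ atlas c, chart_dom c p & adapted_coordinates S kappa mu c]).
Proof.
split; last exact: kmu_of_adapted.
by move=> [AK KM] p; exact: adapted_of_kmu.
Qed.
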